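(* Assume $R>1$. Then the asymptotic entropy $h=\lim_{n\to\infty}\frac1n\mathbb{E}[-\log\pi_n(X_n)]$ of the random walk $(X_n)_{n\ge 0}$ on the free product $V=V_1\ast\dots\ast V_r$ exists and is given by $$h=\ell_0\cdot\sum_{g\in V_\ast^\times} l(g)\,\pi\bigl(g,\tau(g)\bigr)=\ell,$$ where $\ell_0=\lim_{n\to\infty}\|X_n\|/n$ (almost sure limit) is the rate of escape w.r.t. the block length and $\ell=\lim_{n\to\infty} l(X_n)/n$ (almost sure limit) is the rate of escape w.r.t. the length function $l$.
   Context: Free product. Let $r\ge 2$, $\mathcal I=\{1,\dots,r\}$. For $i\in\mathcal I$ let $V_i$ be a finite or countable set with distinguished root $o_i\in V_i$ (the $V_i$ pairwise disjoint) and let $P_i=(p_i(x,y))_{x,y\in V_i}$ be a stochastic transition matrix, with $n$-step probabilities $p_i^{(n)}(x,y)$. The case $r=2=|V_1|=|V_2|$ is excluded. Standing assumptions: for every $x\in V_i$ there is $n\in\mathbb N$ with $p_i^{(n)}(o_i,x)>0$; $p_i(x,x)=0$ for all $x\in V_i$; uniform irreducibility: there are $\varepsilon_0^{(i)}>0$, $K_i\in\mathbb N$ such that for all $x,y\in V_i$ with $p_i(x,y)>0$ one has $p_i^{(k)}(x,y)\ge\varepsilon_0^{(i)}$ for some $k\le K_i$. Put $V_i^\times=V_i\setminus\{o_i\}$, $V_\ast^\times=\bigcup_i V_i^\times$. The free product $V=V_1\ast\dots\ast V_r$ is the set of all finite words $x_1\dots x_n$ with letters in $V_\ast^\times$, no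 two consecutive letters from the same $V_i$, together with the empty word $o$. Each $o_i$ is identified with $o$, so $V_i\subseteq V$, and $xo_i:=x$. For $u=u_1\dots u_m\in V$: block length $\|u\|=m$ ($\|o\|=0$), type $\tau(u)=i$ if $u_m\in V_i^\times$ ($\tau(o)=0$). Random walk. For $x\in V$ with $\tau(x)\ne i$ and $v,w\in V_i$ put $\bar p_i(xv,xw)=p_i(v,w)$, and $\bar p_i=0$ otherwise. Fix $\alpha_1,\dots,\alpha_r>0$ with $\sum_i\alpha_i=1$ and let $P=\sum_i\alpha_i\bar P_i$, with $n$-step probabilities $p^{(n)}(x,y)$. $(X_n)_{n\ge0}$ is the Markov chain on $V$ with $X_0=o$ and transition matrix $P$; $\pi_n$ is the distribution of $X_n$. $R$ denotes the radius of convergence of the Green functions $G(x,y|z)=\sum_{n\ge0}p^{(n)}(x,y)z^n$ (the infimum over $x,y\in V$ of the radii of convergence). Generating functions. $G_i(x,y|z)=\sum_{n\ge0}p_i^{(n)}(x,y)z^n$. With $T_o=\inf\{m\ge1: X_m=o\}$, $\overline H_i(z)=\sum_{n\ge1}\mathbb P[T_o=n,\,X_1\notin V_i^\times]z^n$, $\xi_i(z)=\alpha_iz/(1-\overline H_i(z))$, $\xi_i=\xi_i(1)$ (known: $0<\xi_i<1$). Last visit functions: $L_i(x,y|z)=\sum_{n\ge0}\mathbb P[Y^{(i)}_n=y,\ Y^{(i)}_m\neq x\ \forall 1\le m\le n\mid Y^{(i)}_0=x]z^n$ for the chain $Y^{(i)}$ on $V_i$ governed by $P_i$, and $L(x,y|z)$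 defined in the same way for the chain on $V$ governed by $P$. Length function. $l(x):=-\log L(o,x|1)$ for $x\in V$; for $g\in V_i^\times$ this equals $-\log L_i(o_i,g|\xi_i)$, and $l(v_1\dots v_n)=\sum_j l(v_j)$. Measures. $\nu(i)=C^{-1}\frac{\alpha_i(1-\xi_i)}{\xi_i}\bigl(1-(1-\xi_i)G_i(o_i,o_i|\xi_i)\bigr)$ for $i\in\mathcal I$, with $C$ the normalizing constant such that $\sum_i\nu(i)=1$; $q((\ast,i),(g,j))=\frac{\alpha_j}{\alpha_i}\frac{\xi_i}{\xi_j}\frac{1-\xi_j}{1-\xi_i}L_j(o_j,g|\xi_j)$ if $i\ne j$ and $0$ if $i=j$, for $g\in V_j^\times$; $\pi(g,i)=\sum_{j\in\mathcal I}\nu(j)\,q((\ast,j),(g,i))$ for $g\in V_i^\times$. The almost sure limits $\ell_0$ (a positive constant) and $\ell$ (a real constant) exist. *)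

(* Defs.v *)
From HB Require Import structures.
From mathcomp Require Import all_boot all_order all_algebra.
From mathcomp Require Import all_classical all_reals all_analysis.

Set Implicit Arguments.
Unset Strict Implicit.
Unset Printing Implicit Defensive.

Import Order.TTheory GRing.Theory Num.Theory.
Import numFieldNormedType.Exports.

Local Open Scope classical_set_scope.
Local Open Scope ring_scope.

Definition stochastic (R : realType) (S : countType) (q : S -> S -> R) : Prop :=
  (forall x y, 0 <= q x y) /\
  (forall x, (\esum_(y in [set: S]) (q x y)%:E = 1)%E).

Fixpoint path_prob (R : realType) (S : countType) (q : S -> S -> R)
    (x : S) (s : seq S) : R :=
  if s is y :: s' then q x y * path_prob q y s' else 1.

(** The probability that the first [n] steps [[:: Y_1; ...; Y_n]] (the starting
    point is not listed) of the chain governed by [q] and started at [Y_0 = x]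
    belong to [E]. *)
Definition chain_prob (R : realType) (S : countType) (q : S -> S -> R)
    (x : S) (n : nat) (E : set (seq S)) : \bar R :=
  (\esum_(s in [set s | size s = n /\ E s]) (path_prob q x s)%:E)%E.

Definition nstep (R : realType) (S : countType) (q : S -> S -> R)
    (n : nat) (x y : S) : \bar R :=
  chain_prob q x n [set s | last x s = y].

Definition last_visit (R : realType) (S : countType) (q : S -> S -> R)
    (n : nat) (x y : S) : \bar R :=
  chain_prob q x n [set s | last x s = y /\ (forall u, u \in s -> u <> x)].

(** All power series below have nonnegative coefficients and are evaluated at
    nonnegative reals, so that their sums always make sense in [\bar R]. *)
Definition green (R : realType) (S : countType) (q : S -> S -> R)
    (x y : S) (z : R) : \bar R :=
  (\sum_(0 <= n <oo) nstep q n x y * (z ^+ n)%:E)%E.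

Definition last_visit_gf (R : realType) (S : countType) (q : S -> S -> R)
    (x y : S) (z : R) : \bar R :=
  (\sum_(0 <= n <oo) last_visit q n x y * (z ^+ n)%:E)%E.

Definition green_radius (R : realType) (S : countType) (q : S -> S -> R) :
    \bar R :=
  ereal_inf [set ereal_sup [set z%:E | z in
      [set z : R | 0 <= z /\ (green q xy.1 xy.2 z < +oo)%E]]
    | xy in [set: S * S]].

Definition root_accessible (R : realType) (S : countType) (q : S -> S -> R)
    (x0 : S) : Prop :=
  forall x, exists n, (0 < nstep q n x0 x)%E.

Definition uniformly_irreducible (R : realType) (S : countType)
    (q : S -> S -> R) : Prop :=
  exists (eps : R) (K : nat), 0 < eps /\
    forall x y, 0 < q x y ->
      exists k : nat, (k <= K)%N /\ (eps%:E <= nstep q k x y)%E.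

(** The Markov property is stated with the conditional probabilities multiplied
    out, which covers histories of probability zero. *)
Definition markov_chain (R : realType) (S : countType) (q : S -> S -> R)
    (x0 : S) (d : measure_display) (T : measurableType d)
    (Pr : probability T R) (X : nat -> T -> S) : Prop :=
  [/\ forall n x, measurable (X n @^-1` [set x]),
      Pr (X 0 @^-1` [set x0]) = 1%E
    & forall (n : nat) (x : nat -> S),
        (Pr (\bigcap_(k in `I_n.+2) (X k @^-1` [set x k])) =
         Pr (\bigcap_(k in `I_n.+1) (X k @^-1` [set x k])) *
         (q (x n) (x n.+1))%:E)%E].

Definition law (R : realType) (S : countType) (d : measure_display)
    (T : measurableType d) (Pr : probability T R) (X : nat -> T -> S)
    (n : nat) (x : S) : R :=
  fine (Pr (X n @^-1` [set x])).

(** Sum over a countable set of a real family of arbitrary sign; meaningful when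
    the family is [summable]. *)
Definition csum (R : realType) (S : countType) (f : S -> R) : R :=
  fine (\esum_(x in [set: S]) (Num.max (f x) 0)%:E)%E -
  fine (\esum_(x in [set: S]) (Num.max (- f x) 0)%:E)%E.

Definition nonroot (r : nat) (V : 'I_r -> countType) (o : forall i, V i)
    (i : 'I_r) : countType := {x : V i | x != o i}.

(** The disjoint union of the sets [V i] minus their roots; [tag] is the type of
    a letter. *)
Definition letter (r : nat) (V : 'I_r -> countType) (o : forall i, V i) :
  countType := {i : 'I_r & nonroot o i}.

Definition reduced (r : nat) (V : 'I_r -> countType) (o : forall i, V i)
    (w : seq (letter o)) : bool :=
  sorted (fun a b => tag a != tag b) w.

Definition freeprod (r : nat) (V : 'I_r -> countType) (o : forall i, V i) :
  countType := {w : seq (letter o) | reduced w}.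

Definition fp_root (r : nat) (V : 'I_r -> countType) (o : forall i, V i) :
  freeprod o := exist _ [::] isT.

Definition fp_letter (r : nat) (V : 'I_r -> countType) (o : forall i, V i)
  (g : letter o) : freeprod o := exist _ [:: g] isT.

Definition block_length (r : nat) (V : 'I_r -> countType) (o : forall i, V i)
  (u : freeprod o) : nat := size (sval u).

(** The type of a word; [None] stands for the type 0 of the empty word. *)
Definition wtype (r : nat) (V : 'I_r -> countType) (o : forall i, V i)
    (w : seq (letter o)) : option 'I_r :=
  if w is a :: s then Some (tag (last a s)) else None.

(** [x v] for [v] in [V i], with the convention [x o_i = x]. *)
Definition wcat (r : nat) (V : 'I_r -> countType) (o : forall i, V i)
    (x : seq (letter o)) (i : 'I_r) (v : V i) : seq (letter o) :=
  if insub v is Some g then rcons x (Tagged (nonroot o) (g : nonroot o i))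
  else x.

(** Every word is [wcat (stem i w) (coord i w)] with [wtype (stem i w)] different
    from [i], and this decomposition is unique: see [stem_coord] and
    [stem_wcat]. *)
Definition stem (r : nat) (V : 'I_r -> countType) (o : forall i, V i)
    (i : 'I_r) (w : seq (letter o)) : seq (letter o) :=
  if rev w is a :: s then (if tag a == i then rev s else w) else w.

Definition coord (r : nat) (V : 'I_r -> countType) (o : forall i, V i)
    (i : 'I_r) (w : seq (letter o)) : V i :=
  if rev w is a :: _ then untag (o i) (fun g : nonroot o i => val g) a
  else o i.

(** The lift of the [i]-th transition matrix, i.e. [p i v v'] at the pair
    [(x v, x v')] for [x] of type different from [i] and [v], [v'] in [V i], and 0
    elsewhere: see [lift_mxE] and [lift_mx0]. *)
Definition lift_mx (R : realType) (r : nat) (V : 'I_r -> countType)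
    (o : forall i, V i) (p : forall i, V i -> V i -> R)
    (i : 'I_r) (y y' : freeprod o) : R :=
  if stem i (sval y) == stem i (sval y')
  then p i (coord i (sval y)) (coord i (sval y')) else 0.

Definition fp_mx (R : realType) (r : nat) (V : 'I_r -> countType)
    (o : forall i, V i) (p : forall i, V i -> V i -> R) (alpha : 'I_r -> R)
    (y y' : freeprod o) : R :=
  \sum_(i < r) alpha i * lift_mx p i y y'.

Lemma wcat_root (r : nat) (V : 'I_r -> countType) (o : forall i, V i)
  (x : seq (letter o)) (i : 'I_r) : wcat x (o i) = x.
Proof. by rewrite /wcat insubF // eqxx. Qed.

Lemma wcat_nonroot (r : nat) (V : 'I_r -> countType) (o : forall i, V i)
    (x : seq (letter o)) (i : 'I_r) (g : nonroot o i) :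
  wcat x (val g) = rcons x (Tagged (nonroot o) g).
Proof. by rewrite /wcat valK. Qed.

Lemma wtype_rcons (r : nat) (V : 'I_r -> countType) (o : forall i, V i)
  (x : seq (letter o)) (a : letter o) : wtype (rcons x a) = Some (tag a).
Proof. by case: x => //= b x; rewrite last_rcons. Qed.

Lemma stem_coord (r : nat) (V : 'I_r -> countType) (o : forall i, V i)
    (i : 'I_r) (w : seq (letter o)) : reduced w ->
  wtype (stem i w) <> Some i /\ wcat (stem i w) (coord i w) = w.
Proof.
case/lastP: w => [|w a] red_w; first by split => //; exact: wcat_root.
rewrite /stem /coord rev_rcons; case: eqP => [tai|/eqP tai]; last first.
  rewrite untag_dflt // wcat_root; split => //.
  by rewrite wtype_rcons => -[/eqP]; rewrite (negbTE tai).
rewrite revK (untagE _ _ tai).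
case: i / tai; rewrite /= wcat_nonroot; split; last by case: a red_w.
case/lastP: w red_w => // w b; rewrite wtype_rcons => red_w [tba].
by move: red_w; rewrite /reduced; case: w => [|c w] /=;
  rewrite ?rcons_path ?last_rcons tba eqxx ?andbF.
Qed.

Lemma stem_wcat (r : nat) (V : 'I_r -> countType) (o : forall i, V i)
    (x : seq (letter o)) (i : 'I_r) (v : V i) : wtype x <> Some i ->
  stem i (wcat x v) = x /\ coord i (wcat x v) = v.
Proof.
move=> tx; have [->|nv] := eqVneq v (o i).
  rewrite wcat_root; case/lastP: x tx => // x a; rewrite wtype_rcons => ta.
  have {}ta : tag a != i by apply/eqP => e; apply: ta; rewrite e.
  by rewrite /stem /coord rev_rcons (negbTE ta) untag_dflt.
rewrite -[v]/(val (Sub v nv : nonroot o i)) wcat_nonroot.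
rewrite /stem /coord rev_rcons /= eqxx revK; split => //.
by rewrite (@untagE _ (nonroot o) _ _ i _ (Tagged _ _) (erefl i)).
Qed.

Lemma lift_mxE (R : realType) (r : nat) (V : 'I_r -> countType)
    (o : forall i, V i) (p : forall i, V i -> V i -> R) (i : 'I_r)
    (x : freeprod o) (v v' : V i) (y y' : freeprod o) :
  wtype (sval x) <> Some i ->
  sval y = wcat (sval x) v -> sval y' = wcat (sval x) v' ->
  lift_mx p i y y' = p i v v'.
Proof.
move=> tx yE y'E; rewrite /lift_mx yE y'E.
have [-> ->] := stem_wcat v tx; have [-> ->] := stem_wcat v' tx.
by rewrite eqxx.
Qed.

Lemma lift_mx0 (R : realType) (r : nat) (V : 'I_r -> countType)
    (o : forall i, V i) (p : forall i, V i -> V i -> R) (i : 'I_r)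
    (y y' : freeprod o) :
  (forall (x : freeprod o) (v v' : V i), wtype (sval x) <> Some i ->
     sval y = wcat (sval x) v -> sval y' = wcat (sval x) v' -> False) ->
  lift_mx p i y y' = 0.
Proof.
move=> out; rewrite /lift_mx; case: eqP => // e; exfalso.
have [t1 e1] := stem_coord i (svalP y); have [_ e2] := stem_coord i (svalP y').
have red_s : reduced (stem i (sval y)).
  move: (svalP y); rewrite -[in X in X -> _]e1 /wcat; case: insub => // g.
  rewrite /reduced; case: (stem _ _) => //= a s.
  by rewrite rcons_path => /andP[].
pose x : freeprod o := exist (fun w => is_true (reduced w)) _ red_s.
by apply: (out x (coord i (sval y)) (coord i (sval y'))); rewrite //= e e2.
Qed.

(** The coefficient [P[T_o = n, X_1 notin V_i^x]]: on a path [s = [:: X_1; ...; X_n]]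
    the first return time to the root is [(index o s).+1]. *)
Definition Hbar_coef (R : realType) (r : nat) (V : 'I_r -> countType)
    (o : forall i, V i) (p : forall i, V i -> V i -> R) (alpha : 'I_r -> R)
    (i : 'I_r) (n : nat) : \bar R :=
  chain_prob (@fp_mx R r V o p alpha) (fp_root o) n
    [set s | (index (fp_root o) s).+1 = n /\
             forall g : letter o, tag g = i ->
               head (fp_root o) s <> fp_letter g].

Definition Hbar (R : realType) (r : nat) (V : 'I_r -> countType)
    (o : forall i, V i) (p : forall i, V i -> V i -> R) (alpha : 'I_r -> R)
    (i : 'I_r) (z : R) : \bar R :=
  (\sum_(1 <= n <oo) Hbar_coef o p alpha i n * (z ^+ n)%:E)%E.

Definition xi_fun (R : realType) (r : nat) (V : 'I_r -> countType)
    (o : forall i, V i) (p : forall i, V i -> V i -> R) (alpha : 'I_r -> R)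
    (i : 'I_r) (z : R) : R :=
  alpha i * z / (1 - fine (Hbar o p alpha i z)).

Definition xi (R : realType) (r : nat) (V : 'I_r -> countType)
    (o : forall i, V i) (p : forall i, V i -> V i -> R) (alpha : 'I_r -> R)
    (i : 'I_r) : R := xi_fun o p alpha i 1.

Definition fp_len (R : realType) (r : nat) (V : 'I_r -> countType)
    (o : forall i, V i) (p : forall i, V i -> V i -> R) (alpha : 'I_r -> R)
    (x : freeprod o) : R :=
  - ln (fine (last_visit_gf (@fp_mx R r V o p alpha) (fp_root o) x 1)).

Definition nu_weight (R : realType) (r : nat) (V : 'I_r -> countType)
    (o : forall i, V i) (p : forall i, V i -> V i -> R) (alpha : 'I_r -> R)
    (i : 'I_r) : R :=
  let xi_i := xi o p alpha i in
  alpha i * (1 - xi_i) / xi_i *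
  (1 - (1 - xi_i) * fine (green (p i) (o i) (o i) xi_i)).

Definition nu (R : realType) (r : nat) (V : 'I_r -> countType)
    (o : forall i, V i) (p : forall i, V i -> V i -> R) (alpha : 'I_r -> R)
    (i : 'I_r) : R :=
  (\sum_(j < r) nu_weight o p alpha j)^-1 * nu_weight o p alpha i.

(** The weight of the transition from any letter of type [i] to [(g, j)], with
    [j = tag g]; it does not depend on the first letter. *)
Definition q_mx (R : realType) (r : nat) (V : 'I_r -> countType)
    (o : forall i, V i) (p : forall i, V i -> V i -> R) (alpha : 'I_r -> R)
    (i : 'I_r) (g : letter o) : R :=
  let j := tag g in
  let xi_i := xi o p alpha i in
  let xi_j := xi o p alpha j in
  if i == j then 0
  else alpha j / alpha i * (xi_i / xi_j) * ((1 - xi_j) / (1 - xi_i)) *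
       fine (last_visit_gf (p j) (o j) (val (tagged g)) xi_j).

(** [pi(g, tau(g))]. *)
Definition pi_letter (R : realType) (r : nat) (V : 'I_r -> countType)
    (o : forall i, V i) (p : forall i, V i -> V i -> R) (alpha : 'I_r -> R)
    (g : letter o) : R :=
  \sum_(j < r) nu o p alpha j * q_mx p alpha j g.

(* Main.v *)
(** Write [L(x)] for [L(o,x|1)] and [G] for [G(o,o|1)]. As [G(o,x|1) = G L(x)] and [L] is
    the least solution of a linear equation, comparing super- and subsolutions gives
    [L(x_1 ... x_k) = prod_j L_(i_j)(o, x_j | xi_(i_j))].

    Since [pi_n(x) <= G(o,x|1)], the entropy of [X_n] is at least [E[l(X_n)] - ln G].
    Since [L] has total mass [O(n)] on the words of block length at most [n], Gibbs'
    inequality bounds it above by [E[l(X_n)] + O(ln n)]. Uniform irreducibility gives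
    [|l(X_n)| <= C n], so [E[l(X_n)] / n] tends to [ell] by dominated convergence, and
    [h = ell].

    For [ell = ell0 * mbar] with [mbar = sum_g l(g) pi(g)]: under the weights
    [L(x) w_tau(x)] on the sphere of block length [k], the letters form a Markov chain
    whose Poisson equation has an explicit solution [u], so
    [y(x) = l(x) + u(tau(x)) - k mbar] is a martingale with second moment [O(k)]. As
    [G(o,x|1)] is the expected number of visits to [x], this yields
    [sum_(n < N) E[y(X_n)^2] = O(N^2)], whereas [y(X_n) / n] tends to
    [ell - ell0 * mbar] boundedly. *)

(* The constants are escape probabilities. With [t i] from [ret_pr], [B = 1 - sum_i alpha_i t_i] is
   the probability of never returning to the root, so [B G = 1], and [b_i = alpha_i (1 - t_i)] is
   the part of it that leaves through [V i]. Then [w_i = alpha_i (1 - xi_i) / xi_i] equals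
   [B - b_i], the probability of escaping through a factor other than [i], and [G L(x) w_tau(x)] is
   the probability that [x] is a prefix of the limit word. This is why the weights have the same
   total mass [B] on every sphere, why [nu] is proportional to [w_i b_i], and why [pi(g, i)] is
   proportional to [w_i^2 L_i(g)]. As [ell0] and [ell] are given as limits, only their relation is
   wanted, and expected visit numbers suffice for it: neither last exit times nor an ergodic theorem
   for the letters is used. The strict inequality [xi_i < 1], on which all letter sums rest, comes
   from [B > 0] and the bounds [t_i <= 1] and [t_i <= xi_i], which are mass balances for the chain
   killed at the root. *)
Require Import Defs.
From HB Require Import structures.
From mathcomp Require Import all_boot all_order all_algebra.
From mathcomp Require Import all_classical all_reals all_analysis.
From mathcomp Require Import measurable_realfun ring lra.
Set Implicit Arguments.
Unset Strict Implicit.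
Unset Printing Implicit Defensive.
Import Order.TTheory GRing.Theory Num.Theory.
Import numFieldNormedType.Exports.
Local Open Scope classical_set_scope.
Local Open Scope ring_scope.
Local Notation coord := Defs.coord.

(** * Countable sums *)

Section esum_extra.
Local Open Scope ereal_scope.
Context {R : realType}.
Implicit Types (T U : choiceType).

Lemma esum_ge_term T (I : set T) (a : T -> \bar R) x :
  I x -> (forall i, 0 <= a i) -> a x <= \esum_(i in I) a i.
Proof.
move=> Ix a0; apply: esum_ge; exists [set x]; first by split=> // y ->.
by rewrite fsbig_set1.
Qed.

Lemma esum_gt0_ex T (I : set T) (a : T -> \bar R) :
  0 < \esum_(i in I) a i -> exists2 x, I x & 0 < a x.
Proof.
move=> a0; apply: contrapT => h; move: a0; apply/negP; rewrite -leNgt.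
rewrite (le_trans (@le_esum _ _ _ _ (fun=> 0) _))// ?esum1// => i Ii.
by rewrite leNgt; apply/negP => ai; apply: h; exists i.
Qed.

Lemma esumZl T (I : set T) (c : \bar R) (a : T -> \bar R) : 0 <= c ->
  (forall i, 0 <= a i) ->
  \esum_(i in I) (c * a i) = c * \esum_(i in I) a i.
Proof.
(* Finite subsums give this inequality directly. The converse is the same inequality for the factor
   [c^-1], so that only [c = 0] and [c = +oo] need separate treatment. *)
have leZ (d : \bar R) (b : T -> \bar R) : 0 <= d -> (forall i, 0 <= b i) ->
    \esum_(i in I) (d * b i) <= d * \esum_(i in I) b i.
  move=> d0 b0; apply: ge_ereal_sup => _ [X [finX XI] <-].
  rewrite -ge0_mule_fsumr//; apply: lee_wpmul2l => //.
  by apply: ereal_sup_ubound; exists X.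
move=> + a0; case: c => [c| |//] c0; last first.
  have [a_eq0|] := eqVneq (\esum_(i in I) a i) 0.
    rewrite a_eq0 mule0 esum1// => i Ii.
    suff -> : a i = 0 by rewrite mule0.
    by apply/eqP; rewrite eq_le a0 andbT -a_eq0; exact: esum_ge_term.
  move=> ane0; have apos : 0 < \esum_(i in I) a i.
    by rewrite lt_neqAle eq_sym ane0 esum_ge0.
  rewrite gt0_mulye//; have [x Ix ax] := esum_gt0_ex apos.
  apply/eqP; rewrite -leye_eq.
  have := @esum_ge_term _ _ (fun i => +oo * a i) _ Ix; rewrite gt0_mulye//.
  by apply=> i; exact: mule_ge0.
have [->|cn0] := eqVneq c 0%R.
  by rewrite mul0e esum1// => i _; rewrite mul0e.
apply/eqP; rewrite eq_le leZ//=.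
have /leZ : 0 <= (c^-1)%:E :> \bar R by rewrite lee_fin invr_ge0 -lee_fin.
move=> /(_ (fun i => c%:E * a i)).
have -> : \esum_(i in I) ((c^-1)%:E * (c%:E * a i)) = \esum_(i in I) a i.
  by apply: eq_esum => i _; rewrite muleA -EFinM mulVf// mul1e.
move=> /(_ (fun i => mule_ge0 c0 (a0 i))) h.
rewrite (le_trans (lee_wpmul2l c0 h))// muleA -EFinM mulfV// mul1e//.
Qed.

Lemma esumZr T (I : set T) (c : \bar R) (a : T -> \bar R) : 0 <= c ->
  (forall i, 0 <= a i) ->
  \esum_(i in I) (a i * c) = (\esum_(i in I) a i) * c.
Proof.
by move=> c0 a0; rewrite muleC -esumZl//; apply: eq_esum => i _; rewrite muleC.
Qed.

Lemma esum_exchange T U (I : set T) (J : set U) (a : T -> U -> \bar R) :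
  (forall i j, 0 <= a i j) ->
  \esum_(i in I) \esum_(j in J) a i j = \esum_(j in J) \esum_(i in I) a i j.
Proof.
move=> a0; rewrite !esum_esum//.
rewrite (reindex_esum (J `*` I) _ (fun x => (x.2, x.1)))//; split => //=.
- by move=> [i j] [].
- by move=> [i1 i2] [j1 j2] /= _ _ [] -> ->.
- by move=> [i j] [/= Ii Jj]; exists (j, i).
Qed.

Lemma esum_fiber T U (f : T -> U) (I : set T) (a : T -> \bar R) :
  (forall i, 0 <= a i) ->
  \esum_(i in I) a i =
  \esum_(y in [set: U]) \esum_(i in [set i | I i /\ f i = y]) a i.
Proof.
move=> a0; rewrite esum_esum//.
rewrite (reindex_esum I _ (fun x => (f x, x)))//; split => //=.
- by move=> x y _ _ [].
- by move=> [y i] [/= _ [Ii <-]]; exists i.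
Qed.

Lemma esum_inj T U (e : T -> U) (a : U -> \bar R) : injective e ->
  (forall j, (forall i, e i <> j) -> a j = 0) ->
  \esum_(j in [set: U]) a j = \esum_(i in [set: T]) a (e i).
Proof.
move=> einj a0; rewrite -(@esum_image _ _ _ setT e a); last first.
  by move=> x y _ _; exact: einj.
rewrite [RHS]esum_mkcond; apply: eq_esum => j _; case: ifPn => //.
rewrite notin_setE => nj; apply: a0 => i ij; apply: nj; by exists i.
Qed.

Lemma nneseries_esum_exchange T (I : set T) (a : nat -> T -> \bar R) :
  (forall n x, 0 <= a n x) ->
  \sum_(0 <= n <oo) \esum_(x in I) a n x = \esum_(x in I) \sum_(0 <= n <oo) a n x.
Proof.
move=> a0; rewrite nneseries_esumT; last by move=> n; exact: esum_ge0.
rewrite esum_exchange//; apply: eq_esum => x _; by rewrite nneseries_esumT.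
Qed.

Lemma le_esum_subset T (I J : set T) (a : T -> \bar R) : I `<=` J ->
  (forall i, 0 <= a i) -> \esum_(i in I) a i <= \esum_(i in J) a i.
Proof.
move=> IJ a0; rewrite esum_mkcond [leRHS]esum_mkcond; apply: le_esum => i _.
case: ifPn => [/set_mem/IJ/mem_set ->//|_]; by case: ifP.
Qed.

Lemma eseries_recl (a : nat -> \bar R) : (forall n, 0 <= a n) ->
  \sum_(0 <= n <oo) a n = a 0%N + \sum_(0 <= n <oo) a n.+1.
Proof.
move=> a0; rewrite nneseries_recl//; congr (_ + _).
by rewrite -nneseries_addn//; under eq_eseriesr do rewrite addn1.
Qed.

End esum_extra.

(** * Taboo probabilities and their generating functions *)

Section taboo.
Local Open Scope ereal_scope.
Context {R : realType} {S : countType} (q : S -> S -> R).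
Hypothesis q0 : forall x y, (0 <= q x y)%R.
Implicit Types (a : pred S) (x y u : S) (n : nat) (z : R) (m : S -> \bar R).

Let q0E x y : 0 <= (q x y)%:E. Proof. by rewrite lee_fin. Qed.
#[local] Hint Resolve q0E : core.

Lemma path_prob_ge0 x s : (0 <= path_prob q x s)%R.
Proof. by elim: s x => [//|y s ih] x /=; rewrite mulr_ge0. Qed.

Lemma path_prob_rcons x s y :
  path_prob q x (rcons s y) = (path_prob q x s * q (last x s) y)%R.
Proof. by elim: s x => [|u s ih] x /=; rewrite ?mulr1 ?mul1r// ih mulrA. Qed.

(** One family for both kernels: [predT] gives the Green function and [predC1 x] the last visits, so
    recursion and minimality are proved once. The start is exempt from [a], which lets a last-visit
    path begin at the forbidden point. *)
Definition taboo a n x y : \bar R :=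
  chain_prob q x n [set s | last x s = y /\ all a s].

Lemma nstep_taboo n x y : nstep q n x y = taboo predT n x y.
Proof.
congr esum; apply/seteqP; split => s /=.
  by move=> [? ?]; rewrite all_predT.
by move=> [? [? _]].
Qed.

Lemma last_visit_taboo n x y : last_visit q n x y = taboo (predC1 x) n x y.
Proof.
congr esum; apply/seteqP; split => s /=.
  by move=> [? [? h]]; split=> //; split=> //; apply/allP => u /h/eqP.
by move=> [? [? /allP h]]; split=> //; split=> // u /h/eqP.
Qed.

Lemma taboo_ge0 a n x y : 0 <= taboo a n x y.
Proof. by apply: esum_ge0 => s _; rewrite lee_fin path_prob_ge0. Qed.
#[local] Hint Resolve taboo_ge0 : core.

Lemma taboo0 a x y : taboo a 0 x y = (x == y)%:R%:E.
Proof.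
rewrite /taboo /chain_prob; have [<-|xy] := eqVneq x y.
  rewrite (_ : mkset _ = [set [::]]) ?esum_set1//=.
  apply/seteqP; split => [s [/size0nil -> _]//|s ->] /=; by [].
rewrite (_ : mkset _ = set0) ?esum_set0//.
apply/seteqP; split => [s [/size0nil -> [/= xy' _]]|//].
by move: xy; rewrite xy' eqxx.
Qed.

Lemma tabooS a n x y : taboo a n.+1 x y =
  if a y then \esum_(u in [set: S]) (taboo a n x u * (q u y)%:E) else 0.
Proof.
rewrite /taboo /chain_prob; case: ifPn => ay; last first.
  apply: esum1 => s [/= ss [sy sa]]; move: s ss sy sa; apply: last_ind => // s v _ _.
  by rewrite last_rcons all_rcons => ->; rewrite (negbTE ay).
rewrite (reindex_esum [set s : seq S | size s = n /\ all a s] _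
  (fun s => rcons s y)); last first.
  split => /=.
  - by move=> s [<- sa]; rewrite /= size_rcons last_rcons all_rcons ay sa.
  - by move=> s t _ _ /rcons_inj[].
  - move=> s [ss [sy sa]]; move: s ss sy sa; apply: last_ind => // s v _.
    rewrite size_rcons last_rcons all_rcons => -[sn] -> /andP[_ sa].
    by exists s.
under eq_esum do rewrite path_prob_rcons EFinM.
rewrite (esum_fiber (last x)); last first.
  by move=> s; rewrite -EFinM lee_fin mulr_ge0// path_prob_ge0.
apply: eq_esum => u _; rewrite -esumZr//; last first.
  by move=> s; rewrite lee_fin path_prob_ge0.
have -> : [set i | [set s | size s = n /\ all a s] i /\ last x i = u] =
    [set s | size s = n /\ [set s0 | last x s0 = u /\ all a s0] s].
  by apply/seteqP; split => s /=; tauto.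
by apply: eq_esum => s [_ [-> _]].
Qed.

Definition taboo_gf a x y z : \bar R :=
  \sum_(0 <= n <oo) (taboo a n x y * (z ^+ n)%:E).

Lemma green_taboo x y z : green q x y z = taboo_gf predT x y z.
Proof. by apply: eq_eseriesr => n _; rewrite nstep_taboo. Qed.

Lemma last_visit_gf_taboo x y z :
  last_visit_gf q x y z = taboo_gf (predC1 x) x y z.
Proof. by apply: eq_eseriesr => n _; rewrite last_visit_taboo. Qed.

Section fixed_z.
Variable z : R.
Implicit Type c : R.
Hypothesis z0 : (0 <= z)%R.

Let z0X n : 0 <= (z ^+ n)%:E. Proof. by rewrite lee_fin exprn_ge0. Qed.
Let z0E : 0 <= z%:E. Proof. by rewrite lee_fin. Qed.

Lemma taboo_gf_ge0 a x y : 0 <= taboo_gf a x y z.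
Proof. by apply: nneseries_ge0 => n _ _; exact: mule_ge0. Qed.
#[local] Hint Resolve taboo_gf_ge0 : core.

Lemma taboo_gf_eq a x y : taboo_gf a x y z = (x == y)%:R%:E +
  if a y then z%:E * \esum_(u in [set: S]) (taboo_gf a x u z * (q u y)%:E)
  else 0.
Proof.
rewrite {1}/taboo_gf eseries_recl => [|n]; last exact: mule_ge0.
rewrite taboo0 expr0 mule1; congr (_ + _); case: ifPn => ay; last first.
  by rewrite eseries0// => n _ _; rewrite tabooS (negbTE ay) mul0e.
rewrite -esumZl//; last by move=> u; exact: mule_ge0.
transitivity (\sum_(0 <= n <oo) \esum_(u in [set: S])
   (z%:E * (taboo a n x u * (z ^+ n)%:E * (q u y)%:E))).
  apply: eq_eseriesr => n _; rewrite tabooS ay -esumZr//; last first.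
    by move=> u; exact: mule_ge0.
  apply: eq_esum => u _; rewrite exprS EFinM muleCA; congr (_ * _).
  by rewrite muleAC.
rewrite nneseries_esum_exchange; last first.
  by move=> n u; rewrite mule_ge0// mule_ge0// mule_ge0.
apply: eq_esum => u _; rewrite nneseriesZl; last first.
  by move=> n _; rewrite mule_ge0// mule_ge0.
congr (_ * _); rewrite muleC /taboo_gf -nneseriesZl; last first.
  by move=> n _; rewrite mule_ge0.
by apply: eq_eseriesr => n _; rewrite muleC.
Qed.

(** [c] times the partial sums are the iterates from 0 of the monotone affine map in the hypothesis,
    so they stay below every supersolution [m]. The factor [c] allows comparisons that start from a
    value other than 1 at [x]. *)
Lemma taboo_gf_min a x c m : (0 <= c)%R -> (forall y, 0 <= m y) ->
  (forall y, (x == y)%:R%:E * c%:E +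
     (if a y then z%:E * \esum_(u in [set: S]) (m u * (q u y)%:E) else 0)
     <= m y) ->
  forall y, c%:E * taboo_gf a x y z <= m y.
Proof.
move=> c0 m0 hm y; have c0E : 0 <= c%:E by rewrite lee_fin.
have H N u : c%:E * \sum_(0 <= n < N) (taboo a n x u * (z ^+ n)%:E) <= m u.
  elim: N u => [|N ih] u; first by rewrite big_nil mule0.
  apply: le_trans (hm u).
  rewrite big_nat_recl// taboo0 expr0 mule1 ge0_muleDr ?lee_fin//; last first.
    by rewrite sume_ge0// => n _; exact: mule_ge0.
  rewrite muleC leeD2l//; case: ifPn => au; last first.
    by rewrite big1 ?mule0// => n _; rewrite tabooS (negbTE au) mul0e.
  have -> : \sum_(0 <= n < N) (taboo a n.+1 x u * (z ^+ n.+1)%:E) =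
     z%:E * \esum_(v in [set: S])
       ((\sum_(0 <= n < N) (taboo a n x v * (z ^+ n)%:E)) * (q v u)%:E).
    rewrite -esumZl; [|by []|]; last first.
      by move=> v; rewrite mule_ge0// sume_ge0// => n _; exact: mule_ge0.
    transitivity (\sum_(0 <= n < N) \esum_(v in [set: S])
       (z%:E * (taboo a n x v * (z ^+ n)%:E * (q v u)%:E))).
      apply: eq_bigr => n _; rewrite tabooS au -esumZr//; last first.
        by move=> v; exact: mule_ge0.
      apply: eq_esum => v _; rewrite exprS EFinM muleCA; congr (_ * _).
      by rewrite muleAC.
    rewrite -esum_sum; last by move=> v n _ _; rewrite mule_ge0// mule_ge0// mule_ge0.
    apply: eq_esum => v _; rewrite -ge0_sume_distrr; last first.
      by move=> n _; rewrite mule_ge0// mule_ge0.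
    congr (_ * _); rewrite -ge0_sume_distrl// => n _; exact: mule_ge0.
  rewrite muleCA; apply: lee_wpmul2l => //; rewrite -esumZl//; last first.
    by move=> v; rewrite mule_ge0// sume_ge0// => n _; exact: mule_ge0.
  by apply: le_esum => v _; rewrite muleA; apply: lee_wpmul2r => //; exact: ih.
rewrite /taboo_gf -limeMl//; last first.
  by apply: is_cvg_nneseries => n _ _; exact: mule_ge0.
apply: lime_le; last by apply: nearW => N; exact: H.
apply: is_cvgeZl => //; apply: is_cvg_nneseries => n _ _; exact: mule_ge0.
Qed.

End fixed_z.
End taboo.

(** * Green function, last visits and mass balance for a general chain *)

Section green_last_visit.
Local Open Scope ereal_scope.
Context {R : realType} {S : countType} (q : S -> S -> R).
Hypothesis q0 : forall x y, (0 <= q x y)%R.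
Implicit Types (a : pred S) (x y u : S) (n : nat).

Let q0E x y : 0 <= (q x y)%:E. Proof. by rewrite lee_fin. Qed.
#[local] Hint Resolve q0E : core.

Lemma nstep_ge0 n x y : 0 <= nstep q n x y.
Proof. by rewrite nstep_taboo taboo_ge0. Qed.

Lemma last_visit_ge0 n x y : 0 <= last_visit q n x y.
Proof. by rewrite last_visit_taboo taboo_ge0. Qed.

Lemma nstep0 x y : nstep q 0 x y = (x == y)%:R%:E.
Proof. by rewrite nstep_taboo taboo0. Qed.

Lemma nstepS n x y :
  nstep q n.+1 x y = \esum_(u in [set: S]) (nstep q n x u * (q u y)%:E).
Proof.
rewrite nstep_taboo tabooS//=.
by apply: eq_esum => u _; rewrite nstep_taboo.
Qed.

Lemma last_visit_le_nstep n x y : last_visit q n x y <= nstep q n x y.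
Proof.
apply: le_esum_subset => [s /= [? []]//|s].
by rewrite lee_fin path_prob_ge0.
Qed.

Lemma nstep_gt0S n x y : 0 < nstep q n.+1 x y ->
  exists2 u, 0 < nstep q n x u & (0 < q u y)%R.
Proof.
rewrite nstepS => /esum_gt0_ex[u _ h]; exists u.
  rewrite lt_neqAle nstep_ge0 andbT eq_sym; apply/eqP => n0.
  by move: h; rewrite n0 mul0e ltxx.
rewrite lt_neqAle q0 andbT eq_sym; apply/eqP => n0.
by move: h; rewrite n0 mule0 ltxx.
Qed.

Lemma nstep_gt0_step n x u y : 0 < nstep q n x u -> (0 < q u y)%R ->
  0 < nstep q n.+1 x y.
Proof.
move=> h1 h2; rewrite nstepS.
apply: lt_le_trans (@esum_ge_term _ _ _ _ u _ _) => //.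
- by rewrite mule_gt0.
- by move=> v; rewrite mule_ge0// nstep_ge0.
Qed.

Lemma nstep_supermul n k x u y :
  nstep q n x u * nstep q k u y <= nstep q (n + k) x y.
Proof.
elim: k y => [|k ih] y.
  rewrite nstep0 addn0; have [<-|_] := eqVneq; first by rewrite mule1.
  by rewrite mule0 nstep_ge0.
rewrite addnS !nstepS -esumZl ?nstep_ge0//; last first.
  by move=> v; rewrite mule_ge0// nstep_ge0.
by apply: le_esum => v _; rewrite muleA; apply: lee_wpmul2r => //; exact: ih.
Qed.

(** Each positive step is replaced by a transition in at most [K] steps of probability at least
    [eps], and concatenation multiplies the bounds. The cap [eps <= 1] makes later powers
    decreasing. *)
Lemma uniformly_irreducible_nstep_ge : uniformly_irreducible q ->
  exists (eps : R) (K : nat), [/\ (0 < eps)%R, (eps <= 1)%R &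
    forall n x y, 0 < nstep q n x y ->
      exists k : nat, (k <= K * n)%N /\ (eps ^+ n)%:E <= nstep q k x y].
Proof.
move=> [eps0 [K [eps0_gt0 hK]]]; exists (Num.min eps0 1%R), K; split.
- by rewrite lt_min eps0_gt0 ltr01.
- by rewrite ge_min lexx orbT.
set eps := Num.min _ _.
have eps_ge0 : (0 <= eps)%R by rewrite le_min (ltW eps0_gt0) ler01.
elim=> [|n ih] x y.
  by move=> h; exists 0%N; split=> //; move: h; rewrite nstep0; case: eqP => //; rewrite ltxx.
move=> /nstep_gt0S[u /ih[k [kK hk]] /hK[j [jK hj]]].
exists (k + j)%N; split; first by rewrite mulnS addnC leq_add.
apply: le_trans (nstep_supermul _ _ _ u _).
rewrite exprSr EFinM lee_pmul// ?lee_fin ?exprn_ge0//.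
by apply: le_trans hj; rewrite lee_fin ge_min lexx.
Qed.

Section stochastic.
Hypothesis q1 : forall x, \esum_(y in [set: S]) (q x y)%:E = 1.

Lemma nstep_sum1 n x : \esum_(y in [set: S]) nstep q n x y = 1.
Proof.
elim: n => [|n ih].
  under eq_esum do rewrite nstep0.
  rewrite (esumID [set x])// setTI esum_set1// eqxx esum1 ?adde0//.
  by move=> y [_ /eqP]; rewrite eq_sym => /negbTE ->.
under eq_esum do rewrite nstepS.
rewrite esum_exchange; last by move=> *; rewrite mule_ge0// nstep_ge0.
under eq_esum do rewrite esumZl ?nstep_ge0// q1 mule1.
exact: ih.
Qed.

End stochastic.

(* Mass balance: [phi] dominates the mass that stays plus the mass [psi] that leaks. *)
Lemma last_visit_leak (phi psi : S -> \bar R) x :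
  (forall y, 0 <= phi y) -> (forall y, 0 <= psi y) ->
  (forall y, y != x -> \esum_(u in [set: S])
     (if u == x then 0 else (q y u)%:E * phi u) + psi y <= phi y) ->
  \sum_(0 <= n <oo) \esum_(y in [set: S]) (last_visit q n.+1 x y * psi y) <=
  \esum_(y in [set: S]) (last_visit q 1 x y * phi y).
Proof.
move=> phi0 psi0 h.
pose c n := \esum_(y in [set: S]) (last_visit q n.+1 x y * phi y).
pose d n := \esum_(y in [set: S]) (last_visit q n.+1 x y * psi y).
have c0 n : 0 <= c n by apply: esum_ge0 => y _; rewrite mule_ge0// last_visit_ge0.
have d0 n : 0 <= d n by apply: esum_ge0 => y _; rewrite mule_ge0// last_visit_ge0.
have cd n : c n.+1 + d n <= c n.
  have -> : c n.+1 = \esum_(y in [set: S]) (last_visit q n.+1 x y *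
      \esum_(u in [set: S]) (if u == x then 0 else (q y u)%:E * phi u)).
    transitivity (\esum_(u in [set: S]) \esum_(y in [set: S])
       (last_visit q n.+1 x y * (if u == x then 0 else (q y u)%:E * phi u))).
      apply: eq_esum => u _; rewrite last_visit_taboo tabooS//=.
      case: ifPn; last first.
        rewrite negbK => ->; rewrite mul0e esum1// => y _; exact: mule0.
      move=> /negbTE ->; rewrite -esumZr//; last first.
        by move=> y; rewrite mule_ge0// taboo_ge0.
      by apply: eq_esum => y _; rewrite -last_visit_taboo muleA.
    rewrite esum_exchange; last first.
      move=> u y; rewrite mule_ge0 ?last_visit_ge0//; case: ifP => // _.
      by rewrite mule_ge0.
    apply: eq_esum => y _; rewrite esumZl ?last_visit_ge0// => u.
    by case: ifP => // _; rewrite mule_ge0.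
  rewrite /d -esumD; last 2 first.
  - move=> y _; rewrite mule_ge0 ?last_visit_ge0// esum_ge0// => u _.
    by case: ifP => // _; rewrite mule_ge0.
  - by move=> y _; rewrite mule_ge0 ?last_visit_ge0.
  apply: le_esum => y _; rewrite -ge0_muleDr//; last first.
    by apply: esum_ge0 => u _; case: ifP => // _; rewrite mule_ge0.
  have [->|yx] := eqVneq y x.
    by rewrite last_visit_taboo tabooS//= eqxx/= !mul0e.
  by apply: lee_wpmul2l; [exact: last_visit_ge0|exact: h].
have H N : \sum_(0 <= n < N) d n + c N <= c 0%N.
  elim: N => [|N ih]; first by rewrite big_nil add0e.
  rewrite big_nat_recr//= -addeA (addeC (d N)); apply: le_trans ih.
  by rewrite leeD2l.
apply: lime_le; first by apply: is_cvg_nneseries => n _ _; exact: d0.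
by apply: nearW => N; apply: le_trans (H N); rewrite leeDl.
Qed.

Section fixed_z.
Variable z : R.
Hypothesis z0 : (0 <= z)%R.
Let z0E : 0 <= z%:E. Proof. by rewrite lee_fin. Qed.

Lemma green_ge0 x y : 0 <= green q x y z.
Proof. by rewrite green_taboo taboo_gf_ge0. Qed.

Lemma last_visit_gf_ge0 x y : 0 <= last_visit_gf q x y z.
Proof. by rewrite last_visit_gf_taboo taboo_gf_ge0. Qed.
#[local] Hint Resolve green_ge0 last_visit_gf_ge0 : core.

Lemma green_eq x y : green q x y z = (x == y)%:R%:E +
  z%:E * \esum_(u in [set: S]) (green q x u z * (q u y)%:E).
Proof.
rewrite green_taboo taboo_gf_eq//=; congr (_ + _ * _).
by apply: eq_esum => u _; rewrite green_taboo.
Qed.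

Lemma last_visit_gf_diag x : last_visit_gf q x x z = 1.
Proof. by rewrite last_visit_gf_taboo taboo_gf_eq//= eqxx adde0. Qed.

Lemma last_visit_gf_eq x y : y != x -> last_visit_gf q x y z =
  z%:E * \esum_(u in [set: S]) (last_visit_gf q x u z * (q u y)%:E).
Proof.
move=> yx; rewrite last_visit_gf_taboo taboo_gf_eq//= yx.
rewrite (eq_sym x) (negbTE yx) add0e; congr (_ * _).
by apply: eq_esum => u _; rewrite last_visit_gf_taboo.
Qed.

Lemma last_visit_gf_min x (c : R) (m : S -> \bar R) :
  (0 <= c)%R -> (forall y, 0 <= m y) -> c%:E <= m x ->
  (forall y, y != x ->
     z%:E * (\esum_(u in [set: S]) (m u * (q u y)%:E)) <= m y) ->
  forall y, c%:E * last_visit_gf q x y z <= m y.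
Proof.
move=> c0 m0 mx hm y; rewrite last_visit_gf_taboo; apply: taboo_gf_min => // {}y /=.
rewrite (eq_sym x); have [->|yx] := eqVneq y x; first by rewrite adde0 mul1e.
by rewrite mul0e add0e; exact: hm.
Qed.

(** Both inequalities come from minimality, without cutting paths at the last visit. The Green
    function is a supersolution of the last-visit equation with value [green q x x z] at [x];
    conversely the product is a supersolution of the Green equation, where the check at [x] itself
    uses the first inequality. *)
Lemma green_factor x y : green q x x z < +oo ->
  green q x y z = green q x x z * last_visit_gf q x y z.
Proof.
move=> Gfin.
have Gf : green q x x z \is a fin_num by rewrite ge0_fin_numE.
have le1 u : green q x x z * last_visit_gf q x u z <= green q x u z.
  rewrite -{1}(fineK Gf); apply: (@last_visit_gf_min _ _ (green q x ^~ z)) => //.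
  - by apply: fine_ge0.
  - by rewrite fineK.
  - by move=> v vx; rewrite [leRHS]green_eq eq_sym (negbTE vx) add0e.
apply/eqP; rewrite eq_le le1 andbT.
have := @taboo_gf_min _ _ _ q0 z z0 predT x 1 (fun u => green q x x z * last_visit_gf q x u z).
move=> /(_ ler01 (fun u => mule_ge0 (green_ge0 _ _) (last_visit_gf_ge0 _ _))) H.
rewrite [leLHS]green_taboo -[leLHS]mul1e; apply: H => {}y /=.
rewrite mule1; have [<-|xy] := eqVneq x y.
  rewrite last_visit_gf_diag mule1 [leRHS]green_eq eqxx leeD2l//.
  by apply: lee_wpmul2l => //; apply: le_esum => u _; exact: lee_wpmul2r.
rewrite add0e last_visit_gf_eq 1?eq_sym// muleCA; apply: lee_wpmul2l => //.
rewrite -esumZl//; last by move=> u; rewrite mule_ge0.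
by apply: le_esum => u _; rewrite muleA.
Qed.

Lemma green_renewal x : green q x x z < +oo ->
  green q x x z = 1 + green q x x z *
    (z%:E * \esum_(u in [set: S]) (last_visit_gf q x u z * (q u x)%:E)).
Proof.
move=> Gfin; rewrite {1}green_eq eqxx muleCA; congr (_ + _ * _).
rewrite -esumZl//; last by move=> u; rewrite mule_ge0.
by apply: eq_esum => u _; rewrite green_factor// muleA.
Qed.

End fixed_z.
End green_last_visit.

(** * Words and the transition matrix of the free product *)

Section words.
Context {r : nat} {V : 'I_r -> countType} {o : forall i, V i}.
Implicit Types (w x : seq (letter o)) (y : freeprod o) (a : letter o) (i j : 'I_r).

Lemma reduced_rcons x a :
  reduced (rcons x a) = reduced x && (wtype x != Some (tag a)).
Proof. by case: x => [//|b x]; rewrite /reduced /= rcons_path. Qed.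

Lemma reduced_stem i w : reduced w -> reduced (stem i w).
Proof.
case/lastP: w => [//|w a]; rewrite /stem rev_rcons; case: eqP => // _.
by rewrite revK reduced_rcons => /andP[].
Qed.

Lemma reduced_wcat x i (v : V i) : reduced x -> wtype x <> Some i ->
  reduced (wcat x v).
Proof.
move=> rx /eqP tx; rewrite /wcat; case: insub => [g|//].
by rewrite reduced_rcons rx.
Qed.

Lemma reduced_move i w (v : V i) : reduced w -> reduced (wcat (stem i w) v).
Proof.
move=> rw; apply: reduced_wcat; first exact: reduced_stem.
by have [] := stem_coord i rw.
Qed.

(** These are exactly the words with the same [stem i] as [y], hence the only candidates for
    neighbours of [y] under the [i]-th lift. They turn sums over words into sums over [V i]. *)
Definition fp_move i y (v : V i) : freeprod o :=
  exist _ (wcat (stem i (sval y)) v) (reduced_move v (svalP y)).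

Lemma stem_fp_move i y (v : V i) : stem i (sval (fp_move y v)) = stem i (sval y).
Proof. by have [/(stem_wcat v)[]] := stem_coord i (svalP y). Qed.

Lemma coord_fp_move i y (v : V i) : coord i (sval (fp_move y v)) = v.
Proof. by have [/(stem_wcat v)[]] := stem_coord i (svalP y). Qed.

Lemma fp_move_coord i y y' : stem i (sval y) = stem i (sval y') ->
  fp_move y (coord i (sval y')) = y'.
Proof.
move=> e; apply: val_inj => /=; rewrite e.
by have [_] := stem_coord i (svalP y').
Qed.

Lemma fp_move_inj i y : injective (@fp_move i y).
Proof. by move=> v v' /(congr1 (fun u => coord i (sval u))); rewrite !coord_fp_move. Qed.

Definition fp_emb i (v : V i) : freeprod o := fp_move (fp_root o) v.

Lemma sval_fp_emb i (v : V i) : sval (fp_emb v) = wcat [::] v.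
Proof. by []. Qed.

Lemma fp_emb_root i : fp_emb (o i) = fp_root o.
Proof. by apply: val_inj; rewrite /= wcat_root. Qed.

Lemma fp_emb_letter (g : letter o) : fp_emb (val (tagged g)) = fp_letter g.
Proof. by apply: val_inj; rewrite /= wcat_nonroot; case: g. Qed.

Lemma fp_emb_neq i (v : V i) : v != o i -> fp_emb v != fp_root o.
Proof.
by apply: contra_neq => /(congr1 (fun u => coord i (sval u))); rewrite coord_fp_move.
Qed.

Lemma wcat_cat x w i (v : V i) : wcat (x ++ w) v = x ++ wcat w v.
Proof. by rewrite /wcat; case: insub => // g; rewrite rcons_cat. Qed.

Lemma stem_cat x w i : w != [::] -> stem i (x ++ w) = x ++ stem i w.
Proof.
case/lastP: w => // w a _; rewrite /stem -rcons_cat !rev_rcons.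
by case: ifP => _; rewrite ?revK ?rcons_cat.
Qed.

Lemma coord_cat x w i : w != [::] -> coord i (x ++ w) = coord i w.
Proof. by case/lastP: w => // w a _; rewrite /coord -rcons_cat !rev_rcons. Qed.

Lemma stem_rcons_eq x a : stem (tag a) (rcons x a) = x.
Proof. by rewrite /stem rev_rcons eqxx revK. Qed.

Lemma coord_rcons_eq x a : coord (tag a) (rcons x a) = val (tagged a).
Proof. by rewrite /coord rev_rcons (untagE _ _ (erefl (tag a))). Qed.

Lemma stem_neq x i : wtype x != Some i -> stem i x = x.
Proof.
case/lastP: x => // x a; rewrite wtype_rcons /stem rev_rcons => h.
by rewrite ifN//; apply: contra h => /eqP ->.
Qed.

Lemma coord_neq x i : wtype x != Some i -> coord i x = o i.
Proof.
case/lastP: x => // x a; rewrite wtype_rcons /coord rev_rcons => h.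
by rewrite untag_dflt//; apply: contra h => /eqP ->.
Qed.

End words.

Definition fp_lv {R : realType} {r : nat} {V : 'I_r -> countType}
    {o : forall i, V i} (p : forall i, V i -> V i -> R) (alpha : 'I_r -> R)
    (x : freeprod o) : \bar R :=
  last_visit_gf (@fp_mx R r V o p alpha) (fp_root o) x 1.

Section walk.
Local Open Scope ereal_scope.
Context {R : realType} {r : nat} {V : 'I_r -> countType} {o : forall i, V i}.
Variables (p : forall i, V i -> V i -> R) (alpha : 'I_r -> R).
Arguments p : clear implicits.
Hypothesis p0 : forall i x y, (0 <= p i x y)%R.
Hypothesis alpha0 : forall i, (0 < alpha i)%R.
Implicit Types (x y w : freeprod o) (i j : 'I_r).

Let P := @fp_mx R r V o p alpha.
Let p0E i (u v : V i) : 0 <= (p i u v)%:E. Proof. by rewrite lee_fin. Qed.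
#[local] Hint Resolve p0E : core.
Let alpha0E i : 0 <= (alpha i)%:E. Proof. by rewrite lee_fin ltW. Qed.
#[local] Hint Resolve alpha0E : core.

Lemma lift_mx_ge0 i x y : (0 <= lift_mx p i x y)%R.
Proof. by rewrite /lift_mx; case: ifP. Qed.

Lemma fp_mx_ge0 x y : (0 <= P x y)%R.
Proof. by apply: sumr_ge0 => i _; rewrite mulr_ge0 ?lift_mx_ge0// ltW. Qed.

Lemma fp_mx_gt0 x y : (0 < P x y)%R -> exists i : 'I_r,
  stem i (sval x) = stem i (sval y) /\
  (0 < p i (coord i (sval x)) (coord i (sval y)))%R.
Proof.
move=> h; apply: contrapT => H; move: h; apply/negP; rewrite -leNgt.
apply: sumr_le0 => i _; apply: mulr_ge0_le0; first exact: ltW.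
rewrite /lift_mx; case: eqP => // e; rewrite leNgt; apply/negP => h.
by apply: H; exists i.
Qed.

Let P_E x y : (P x y)%:E = \sum_(i < r) ((alpha i)%:E * (lift_mx p i x y)%:E).
Proof. by rewrite /P /fp_mx -sumEFin; apply: eq_bigr. Qed.

Lemma lift_mx_fp_move i y (v : V i) :
  lift_mx p i (fp_move y v) y = p i v (coord i (sval y)).
Proof. by rewrite /lift_mx stem_fp_move eqxx coord_fp_move. Qed.

Lemma lift_mx_fp_move_r i y (v : V i) :
  lift_mx p i y (fp_move y v) = p i (coord i (sval y)) v.
Proof. by rewrite /lift_mx stem_fp_move eqxx coord_fp_move. Qed.

Lemma lift_mx_pred (m : freeprod o -> \bar R) i y :
  \esum_(x in [set: freeprod o]) (m x * (lift_mx p i x y)%:E) =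
  \esum_(v in [set: V i]) (m (fp_move y v) * (p i v (coord i (sval y)))%:E).
Proof.
rewrite (esum_inj (@fp_move_inj _ _ _ i y)).
  by apply: eq_esum => v _; rewrite lift_mx_fp_move.
move=> x hx; rewrite /lift_mx; case: eqP => [e|]; last by rewrite mule0.
by have := fp_move_coord (esym e); move/hx.
Qed.

Lemma fp_mx_pred (m : freeprod o -> \bar R) y : (forall x, 0 <= m x) ->
  \esum_(x in [set: freeprod o]) (m x * (P x y)%:E) =
  \sum_(i < r) ((alpha i)%:E * \esum_(v in [set: V i])
     (m (fp_move y v) * (p i v (coord i (sval y)))%:E)).
Proof.
move=> m0; have lE i x z : 0 <= (lift_mx p i x z)%:E by rewrite lee_fin lift_mx_ge0.
transitivity (\esum_(x in [set: freeprod o]) \sum_(i < r)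
    ((alpha i)%:E * (m x * (lift_mx p i x y)%:E))).
  apply: eq_esum => x _; rewrite P_E ge0_sume_distrr; last first.
    by move=> i _; rewrite mule_ge0.
  by apply: eq_bigr => i _; rewrite muleCA.
rewrite esum_sum; last by move=> x i _ _; rewrite mule_ge0// mule_ge0.
apply: eq_bigr => i _; rewrite esumZl//; last by move=> x; rewrite mule_ge0.
by rewrite lift_mx_pred.
Qed.

Lemma fp_mx_succ (m : freeprod o -> \bar R) x : (forall y, 0 <= m y) ->
  \esum_(y in [set: freeprod o]) ((P x y)%:E * m y) =
  \sum_(i < r) ((alpha i)%:E * \esum_(v in [set: V i])
     ((p i (coord i (sval x)) v)%:E * m (fp_move x v))).
Proof.
move=> m0; have lE i y z : 0 <= (lift_mx p i y z)%:E by rewrite lee_fin lift_mx_ge0.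
transitivity (\esum_(y in [set: freeprod o]) \sum_(i < r)
    ((alpha i)%:E * ((lift_mx p i x y)%:E * m y))).
  apply: eq_esum => y _; rewrite P_E ge0_sume_distrl; last first.
    by move=> i _; rewrite mule_ge0.
  by apply: eq_bigr => i _; rewrite muleA.
rewrite esum_sum; last by move=> y i _ _; rewrite mule_ge0// mule_ge0.
apply: eq_bigr => i _; rewrite esumZl//; last by move=> y; rewrite mule_ge0.
congr (_ * _); rewrite (esum_inj (@fp_move_inj _ _ _ i x)).
  by apply: eq_esum => v _; rewrite lift_mx_fp_move_r.
move=> y hy; rewrite /lift_mx; case: eqP => [e|]; last by rewrite mul0e.
by have := fp_move_coord e; move/hy.
Qed.

Let L := @fp_lv R r V o p alpha.

Lemma fp_lv_ge0 x : 0 <= L x.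
Proof. by apply: last_visit_gf_ge0 => //; exact: fp_mx_ge0. Qed.
#[local] Hint Resolve fp_lv_ge0 : core.

Lemma fp_lv_root : L (fp_root o) = 1.
Proof. by apply: last_visit_gf_diag => //; exact: fp_mx_ge0. Qed.

Lemma fp_lv_eq y : y != fp_root o ->
  L y = \sum_(i < r) ((alpha i)%:E * \esum_(v in [set: V i])
     (L (fp_move y v) * (p i v (coord i (sval y)))%:E)).
Proof.
move=> yo; rewrite -fp_mx_pred// -[RHS]mul1e.
by apply: last_visit_gf_eq => //; exact: fp_mx_ge0.
Qed.

(** Steps between [u] and its neighbours leave the prefix [x] alone when [u] is nonempty, so [u]
    mapped to [L(xu)] is a supersolution of the last-visit equation that starts from [L(x)] at the
    empty word. *)
Lemma fp_lv_cat x w y : sval y = sval x ++ sval w -> L x < +oo ->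
  L x * L w <= L y.
Proof.
move=> yxw Lx.
(* Where [x] followed by [u] is not reduced, [+oo] makes the inequality trivial; such words never
   occur as predecessors of a nonempty [u] for which it is reduced. *)
pose m (u : freeprod o) : \bar R :=
  if insub (sval x ++ sval u) is Some y' then L y' else +oo.
have svalK (z : freeprod o) : insub (sval z) = Some z by exact: valK.
have -> : L y = m w.
  by rewrite /m -yxw svalK.
have Lxf : L x \is a fin_num by rewrite ge0_fin_numE.
rewrite -(fineK Lxf).
have m0 u : 0 <= m u by rewrite /m; case: insub.
apply: last_visit_gf_min => //; [exact: fp_mx_ge0|exact: fine_ge0| |].
  by rewrite fineK// /m cats0 svalK.
move=> u uo; rewrite mul1e fp_mx_pred//.
have un : sval u != [::] by apply: contra uo => /eqP e; apply/eqP/val_inj.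
rewrite [in leRHS]/m; case: insubP => [z _ zE|]; last by rewrite leey.
rewrite fp_lv_eq; last first.
  apply: contra un => /eqP z0; move: zE; rewrite z0 /=.
  by case: (sval x) (sval u) => [|? ?] [|? ?].
apply: lee_sum => i _; apply: lee_wpmul2l => //; apply: le_esum => v _.
have zE' : sval z = sval x ++ sval u by exact: zE.
rewrite zE' coord_cat//; apply: lee_wpmul2r => //.
by rewrite /m /= -wcat_cat -stem_cat// -zE' -[wcat _ _]/(sval (fp_move z v)) svalK.
Qed.

End walk.

(** * First letters and return probabilities *)

Section first_letter.
Context {r : nat} {V : 'I_r -> countType} {o : forall i, V i}.
Implicit Types (w : seq (letter o)) (x : freeprod o) (i j : 'I_r).

(** Constant along a path that avoids the root: this links the factor of the first step with the
    factor of the step that returns. *)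
Definition first_type w : option 'I_r := omap tag (ohead w).

Lemma first_type_stem i w : w != [::] ->
  first_type w = if stem i w == [::] then Some i else first_type (stem i w).
Proof.
case/lastP: w => // w a _; rewrite /stem rev_rcons.
case: (eqVneq (tag a) i) => [<-|tai]; first by rewrite revK; case: w.
by rewrite ifN//; case: w.
Qed.

Lemma fp_root_neqP x : (x != fp_root o) = (sval x != [::]).
Proof. by []. Qed.

Lemma first_type_emb i (v : V i) :
  first_type (sval (fp_emb v)) = if v == o i then None else Some i.
Proof.
have [->|vo] := eqVneq v (o i); first by rewrite fp_emb_root.
rewrite (first_type_stem i) ?stem_fp_move ?eqxx//.
by rewrite -fp_root_neqP fp_emb_neq.
Qed.

End first_letter.

Section return_probabilities.
Local Open Scope ereal_scope.
Context {R : realType} {r : nat} {V : 'I_r -> countType} {o : forall i, V i}.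
Variables (p : forall i, V i -> V i -> R) (alpha : 'I_r -> R).
Arguments p : clear implicits.
Hypothesis hstoch : forall i, stochastic (p i).
Hypothesis hloop : forall i x, p i x x = 0%R.
Hypothesis alpha0 : forall i, (0 < alpha i)%R.
Hypothesis alpha1 : (\sum_(i < r) alpha i = 1)%R.
Implicit Types (x y w : freeprod o) (i j : 'I_r).

Local Notation P := (@fp_mx R r V o p alpha).
Let p0 i (u v : V i) : (0 <= p i u v)%R. Proof. by have [] := hstoch i. Qed.
Let p0E i (u v : V i) : 0 <= (p i u v)%:E. Proof. by rewrite lee_fin. Qed.
#[local] Hint Resolve p0E : core.
Let alpha0E i : 0 <= (alpha i)%:E. Proof. by rewrite lee_fin ltW. Qed.
#[local] Hint Resolve alpha0E : core.
Let P0 x y : (0 <= P x y)%R. Proof. exact: fp_mx_ge0. Qed.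
Let P0E x y : 0 <= (P x y)%:E. Proof. by rewrite lee_fin. Qed.
#[local] Hint Resolve P0 P0E : core.
Local Notation L := (@fp_lv R r V o p alpha).
Let L0 x : 0 <= L x. Proof. exact: fp_lv_ge0. Qed.
#[local] Hint Resolve L0 : core.
Let lv n x := last_visit P n (fp_root o) x.
Let lv0 n x : 0 <= lv n x. Proof. exact: last_visit_ge0. Qed.
#[local] Hint Resolve lv0 : core.

Lemma fp_mx_sum1 x : \esum_(y in [set: freeprod o]) (P x y)%:E = 1.
Proof.
transitivity (\esum_(y in [set: freeprod o]) ((P x y)%:E * 1)).
  by apply: eq_esum => y _; rewrite mule1.
rewrite (@fp_mx_succ R r V o p alpha p0 alpha0 (cst 1))// -[in RHS]alpha1 -sumEFin.
apply: eq_bigr => i _; rewrite -[RHS]mule1; congr (_ * _).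
have [_ p1] := hstoch i; rewrite -[RHS](p1 (coord i (sval x))).
by apply: eq_esum => v _; rewrite /= mule1.
Qed.

Lemma fp_mx_first_type x y : (0 < P x y)%R -> x != fp_root o -> y != fp_root o ->
  first_type (sval x) = first_type (sval y).
Proof.
move=> /fp_mx_gt0 => /(_ alpha0) [i [e _]] xo yo.
by rewrite (first_type_stem i xo) e -(first_type_stem i yo).
Qed.

Lemma path_first_type x s : x != fp_root o -> all (predC1 (fp_root o)) s ->
  path_prob P x s != 0%R -> first_type (sval (last x s)) = first_type (sval x).
Proof.
elim: s x => [//|y s ih] x xo /= /andP[yo sa]; rewrite mulf_eq0 negb_or => /andP[Pxy Ps].
rewrite ih//; apply/esym/fp_mx_first_type => //.
by rewrite lt_neqAle eq_sym Pxy P0.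
Qed.

Lemma lift_mx_root_neq0 j x : lift_mx p j x (fp_root o) != 0%R ->
  first_type (sval x) = Some j.
Proof.
rewrite /lift_mx; case: (eqVneq x (fp_root o)) => [->|xo].
  by rewrite eqxx hloop eqxx.
case: (stem j (sval x) =P _) => [e _|]; last by rewrite eqxx.
by rewrite (first_type_stem j)// e.
Qed.

(** Until it returns, a path keeps the type of its first letter, so the condition on [X_1] means
    that the returning step is made in a factor [j] other than [i]. Removing that step leaves [n]
    steps that avoid the root. *)
Lemma Hbar_coefE i n : Hbar_coef o p alpha i n.+1 =
  \sum_(j < r | j != i) ((alpha j)%:E *
     \esum_(v in [set: V j]) (lv n (fp_emb v) * (p j v (o j))%:E)).
Proof.
pose hc (s : seq (freeprod o)) := forall g : letter o, tag g = i ->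
               head (fp_root o) s <> fp_letter g.
have liftE j x y : 0 <= (lift_mx p j x y)%:E by rewrite lee_fin lift_mx_ge0.
pose Q x := \sum_(j < r | j != i) ((alpha j)%:E * (lift_mx p j x (fp_root o))%:E).
have Q0 x : 0 <= Q x by apply: sume_ge0 => j _; exact: mule_ge0.
transitivity (\esum_(s in [set s | size s = n /\ all (predC1 (fp_root o)) s])
    ((path_prob P (fp_root o) s)%:E * Q (last (fp_root o) s))); last first.
  rewrite (esum_fiber (last (fp_root o))); last first.
    by move=> s; rewrite mule_ge0// lee_fin path_prob_ge0.
  transitivity (\esum_(x in [set: freeprod o]) (lv n x * Q x)).
    apply: eq_esum => x _; rewrite /lv last_visit_taboo /taboo /chain_prob.
    rewrite -esumZr//; last by move=> s; rewrite lee_fin path_prob_ge0.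
    have -> : [set i0 | [set s | size s = n /\ all (predC1 (fp_root o)) s] i0 /\
         last (fp_root o) i0 = x] = [set s | size s = n /\
         [set s0 | last (fp_root o) s0 = x /\ all (predC1 (fp_root o)) s0] s].
      by apply/seteqP; split => s /=; tauto.
    by apply: eq_esum => s [_ [-> _]].
  transitivity (\esum_(x in [set: freeprod o]) \sum_(j < r | j != i)
      ((alpha j)%:E * (lv n x * (lift_mx p j x (fp_root o))%:E))).
    apply: eq_esum => x _; rewrite ge0_sume_distrr; last by move=> j _; exact: mule_ge0.
    by apply: eq_bigr => j _; rewrite muleCA.
  rewrite esum_sum; last by move=> x j _ _; rewrite mule_ge0// mule_ge0.
  apply: eq_bigr => j _; rewrite esumZl//; last by move=> x; rewrite mule_ge0.
  by rewrite lift_mx_pred.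
rewrite /Hbar_coef /chain_prob.
rewrite (reindex_esum [set s | (size s = n /\ all (predC1 (fp_root o)) s) /\
    hc (rcons s (fp_root o))] _ (fun s => rcons s (fp_root o))); last first.
  split => /=.
  - move=> s [[<- sa] hs] /=; split; first by rewrite size_rcons.
    split => //; rewrite -cats1 index_cat ifN /= ?eqxx ?addn0//.
    by apply/negP => /(allP sa) /=; rewrite ?eqxx.
  - by move=> s t _ _ /rcons_inj[].
  - move=> s [ss [si hs]]; move: s ss si hs; apply: last_ind => // s x _.
    rewrite size_rcons -cats1 index_cat => -[sn] -[].
    case: ifPn => [so|so]; first by move=> e; move: so; rewrite -index_mem e sn ltnn.
    rewrite sn /=; case: eqVneq => [->|_]; last first.
      by move=> /eqP; rewrite -[X in _ == X]addn0 eqn_add2l.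
    move=> _ hs; exists s; last by rewrite cats1.
    split; last by rewrite -cats1.
    by split => //; apply/allP => y ys /=; apply: contra so => /eqP <-.
rewrite esum_mkcond [RHS]esum_mkcond. apply: eq_esum => s _.
have [/set_mem [sn sa]|nA] := boolP (s \in [set s |
    size s = n /\ all (predC1 (fp_root o)) s]); last first.
  by rewrite ifN//; apply: contra nA => /set_mem [? _]; exact: mem_set.
rewrite path_prob_rcons.
have [pp0|pp] := eqVneq (path_prob P (fp_root o) s) 0%R.
  by rewrite pp0 mul0r mul0e if_same.
have QE : (P (last (fp_root o) s) (fp_root o))%:E =
   \sum_(j < r) ((alpha j)%:E * (lift_mx p j (last (fp_root o) s) (fp_root o))%:E).
  by rewrite /fp_mx -sumEFin; apply: eq_bigr.
(* The empty [s] is the immediate return [X_1 = o]; without loops both sides vanish. *)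
case: s sn sa pp QE => [|x s] sn /= sa pp QE.
  have l0 j : lift_mx p j (fp_root o) (fp_root o) = 0%R.
    by rewrite /lift_mx eqxx hloop.
  rewrite /Q big1 ?mule0; last by move=> j _; rewrite l0 mule0.
  rewrite [P _ _](_ : _ = 0%R) ?mulr0 ?if_same//.
  by rewrite /fp_mx big1// => j _; rewrite l0 mulr0.
move/andP: sa => [xo sa]; move: pp; rewrite mulf_eq0 negb_or => /andP[Pox ps].
have Pox' : (0 < P (fp_root o) x)%R by rewrite lt_neqAle eq_sym Pox P0.
have [k [ke kp]] := fp_mx_gt0 alpha0 Pox'.
have xE : fp_emb (coord k (sval x)) = x by exact: fp_move_coord.
have ftx : first_type (sval x) = Some k.
  by rewrite (first_type_stem k)// -ke.
have lk j : j != k -> lift_mx p j (last x s) (fp_root o) = 0%R.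
  move=> jk; apply/eqP; apply: contraT => /lift_mx_root_neq0.
  by rewrite path_first_type// ftx => -[] kj; rewrite kj eqxx in jk.
have hcE : hc (x :: rcons s (fp_root o)) <-> k != i.
  split=> [h|/eqP ki g gi /= xg].
    apply/eqP => ki.
    have vk : coord k (sval x) != o k.
      by apply: contra xo => /eqP e; rewrite -xE e fp_emb_root.
    apply: (h (Tagged (nonroot o) (Sub (coord k (sval x)) vk : nonroot o k))) => //.
    by rewrite /= -fp_emb_letter /= xE.
  apply: ki; move: ftx; rewrite xg /= => -[<-]; exact: gi.
have -> : Q (last x s) = if k != i then (P (last x s) (fp_root o))%:E else 0.
  rewrite QE; case: ifPn => ki.
    rewrite /Q [RHS](bigD1 i)//= [X in X + _](_ : _ = 0) ?add0e//.
    by rewrite lk 1?eq_sym// mule0.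
  by rewrite /Q big1// => j ji; rewrite lk ?mule0//; move: ki; rewrite negbK => /eqP ->.
case: (boolP (k != i)) => ki.
  rewrite ifT ?EFinM//; apply: mem_set; split; last exact/hcE.
  by split => //=; rewrite xo.
rewrite ifN ?mule0//; apply/negP => /set_mem [_ /hcE ki']; by rewrite ki' in ki.
Qed.

(** [alpha i * ret i] is the probability of returning to the root after a first
    step into [V i]. *)
Definition ret i : \bar R :=
  \esum_(v in [set: V i]) (L (fp_emb v) * (p i v (o i))%:E).

Lemma ret_ge0 i : 0 <= ret i.
Proof. by apply: esum_ge0 => v _; exact: mule_ge0. Qed.

Lemma retE i : ret i = \sum_(0 <= n <oo)
  \esum_(v in [set: V i]) (lv n (fp_emb v) * (p i v (o i))%:E).
Proof.
rewrite nneseries_esum_exchange; last by move=> n v; exact: mule_ge0.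
apply: eq_esum => v _; rewrite muleC -nneseriesZl; last first.
  by move=> n _; rewrite mule_ge0// lv0.
by apply: eq_eseriesr => n _; rewrite expr1n mule1 muleC.
Qed.

Lemma HbarE i : Hbar o p alpha i 1 = \sum_(j < r | j != i) ((alpha j)%:E * ret j).
Proof.
have e0 n j : 0 <= \esum_(v in [set: V j]) (lv n (fp_emb v) * (p j v (o j))%:E).
  by apply: esum_ge0 => v _; exact: mule_ge0.
rewrite /Hbar -nneseries_addn; last first.
  by move=> n; rewrite expr1n mule1; apply: esum_ge0 => s _; rewrite lee_fin path_prob_ge0.
transitivity (\sum_(0 <= n <oo) \sum_(j < r | j != i) ((alpha j)%:E *
     \esum_(v in [set: V j]) (lv n (fp_emb v) * (p j v (o j))%:E))).
  by apply: eq_eseriesr => n _; rewrite addn1 expr1n mule1 Hbar_coefE.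
rewrite nneseries_sum; last by move=> j n _; rewrite mule_ge0.
apply: eq_bigr => j _; rewrite nneseriesZl//; congr (_ * _).
by rewrite retE.
Qed.

(** Mass balance on the words whose first letter has type [j]: the first step brings at most
    [alpha j] into this set, paths leave it only by hitting the root, and the total that leaks is at
    least [alpha j * ret j]. *)
Lemma ret_le1 j : ret j <= 1.
Proof.
pose phi x : \bar R := (first_type (sval x) == Some j)%:R%:E.
pose psi x := phi x * (P x (fp_root o))%:E.
have phi0 x : 0 <= phi x by rewrite lee_fin.
have psi0 x : 0 <= psi x by rewrite mule_ge0.
have leak : forall y, y != fp_root o -> \esum_(u in [set: freeprod o])
     (if u == fp_root o then 0 else (P y u)%:E * phi u) + psi y <= phi y.
  move=> y yo; rewrite /psi /phi; have [fy|fy] := eqVneq (first_type (sval y)) (Some j).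
    rewrite mul1e -(fp_mx_sum1 y).
    have -> : (P y (fp_root o))%:E = \esum_(u in [set: freeprod o])
        if u \in [set fp_root o] then (P y u)%:E else 0.
      by rewrite -esum_mkcond esum_set1.
    rewrite -esumD; last 2 first.
    - by move=> u _; case: ifP => // _; rewrite mule_ge0// lee_fin.
    - by move=> u _; case: ifP.
    apply: le_esum => u _; case: eqVneq => [->|uo].
      by rewrite add0e mem_set.
    rewrite [X in _ + X]ifN; last by apply: contra uo => /set_mem ->.
    by rewrite adde0 -[leRHS]mule1; apply: lee_wpmul2l => //; rewrite lee_fin lern1 leq_b1.
  rewrite mul0e adde0 esum1// => u _; case: eqVneq => // uo.
  have [Pyu|Pyu] := eqVneq (P y u) 0%R; first by rewrite Pyu mul0e.
  rewrite -(@fp_mx_first_type y u)// ?(negbTE fy) ?mule0//.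
  by rewrite lt_neqAle eq_sym Pyu P0.
have := last_visit_leak P0 phi0 psi0 leak.
have lv1 : \esum_(y in [set: freeprod o]) (last_visit P 1 (fp_root o) y * phi y) <= (alpha j)%:E.
  apply: (@le_trans _ _ (\esum_(y in [set: freeprod o]) ((P (fp_root o) y)%:E * phi y))).
    apply: le_esum => y _; apply: lee_wpmul2r => //.
    apply: le_trans (last_visit_le_nstep P0 _ _ _) _; rewrite nstepS//.
    rewrite (esumID [set fp_root o]); last by move=> u _; rewrite mule_ge0// nstep_ge0.
    rewrite setTI esum_set1; last by rewrite mule_ge0// nstep_ge0.
    rewrite nstep0 eqxx mul1e esum1 ?adde0// => u [_ /= /eqP uo].
    by rewrite nstep0 eq_sym (negbTE uo) mul0e.
  rewrite fp_mx_succ// (bigD1 j)//= big1 ?adde0.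
    rewrite -[leRHS]mule1; apply: lee_wpmul2l => //.
    have [_ p1] := hstoch j; rewrite -[leRHS](p1 (o j)); apply: le_esum => v _.
    by rewrite -[leRHS]mule1; apply: lee_wpmul2l => //; rewrite lee_fin lern1 leq_b1.
  move=> i ij; rewrite esum1 ?mule0// => v _.
  rewrite /phi (_ : fp_move _ _ = fp_emb v)// first_type_emb; case: ifP => _; rewrite ?mule0//.
  by case: eqP => [[e]|_]; [rewrite e eqxx in ij|rewrite mule0].
move=> /le_trans /(_ lv1) h.
have hj : (alpha j)%:E * ret j <= (alpha j)%:E.
  apply: le_trans h; rewrite retE -nneseriesZl; last first.
    by move=> n _; apply: esum_ge0 => v _; exact: mule_ge0.
  (* The term [n = 0] vanishes because the root has no loop; the shifted series is the one of
     [last_visit_leak]. *)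
  rewrite eseries_recl; last first.
    by move=> n; rewrite mule_ge0// esum_ge0// => v _; exact: mule_ge0.
  rewrite esum1; last first.
    move=> v _; rewrite /lv last_visit_taboo taboo0; have [->|vo] := eqVneq v (o j).
      by rewrite hloop mule0.
    by rewrite eq_sym (negbTE (fp_emb_neq vo)) mul0e.
  rewrite mule0 add0e; apply: lee_nneseries.
    by move=> n _; rewrite mule_ge0// esum_ge0// => v _; exact: mule_ge0.
  move=> n _; have := @lift_mx_pred R r V o p (lv n.+1) j (fp_root o).
  move=> /= <-; rewrite -esumZl//; last first.
    by move=> x; rewrite mule_ge0// lee_fin lift_mx_ge0.
  apply: le_esum => x _; rewrite muleCA; apply: lee_wpmul2l => //.
  have [->|lx] := eqVneq (lift_mx p j x (fp_root o)) 0%R.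
    by rewrite mule0.
  rewrite /psi /phi (lift_mx_root_neq0 lx) eqxx mul1e -EFinM lee_fin.
  rewrite /fp_mx (bigD1 j)//= lerDl sumr_ge0// => i _.
  by rewrite mulr_ge0 ?lift_mx_ge0// ltW.
move: hj; rewrite -[leRHS]mule1 lee_pmul2l// lte_fin//.
Qed.

End return_probabilities.

(** * Factorization of the last visit generating function *)

Section factorization.
Context {R : realType} {r : nat} {V : 'I_r -> countType} {o : forall i, V i}.
Variables (p : forall i, V i -> V i -> R) (alpha : 'I_r -> R).
Arguments p : clear implicits.
Hypothesis hstoch : forall i, stochastic (p i).
Hypothesis hloop : forall i x, p i x x = 0%R.
Hypothesis alpha0 : forall i, (0 < alpha i)%R.
Hypothesis alpha1 : (\sum_(i < r) alpha i = 1)%R.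
Hypothesis Gfin : forall x,
  (green (@fp_mx R r V o p alpha) (fp_root o) x 1 < +oo)%E.
Implicit Types (x y : freeprod o) (w : seq (letter o)) (i j : 'I_r).

Local Notation P := (@fp_mx R r V o p alpha).
Local Notation L := (@fp_lv R r V o p alpha).
Local Notation xi i := (xi o p alpha i).

Let p0 i (u v : V i) : 0 <= p i u v. Proof. by have [] := hstoch i. Qed.
Let p0E i (u v : V i) : (0 <= (p i u v)%:E)%E. Proof. by rewrite lee_fin. Qed.
#[local] Hint Resolve p0E : core.
Let alpha0W i : 0 <= alpha i. Proof. by rewrite ltW. Qed.
Let alpha0E i : (0 <= (alpha i)%:E)%E. Proof. by rewrite lee_fin. Qed.
#[local] Hint Resolve alpha0E : core.
Let P0 x y : 0 <= P x y. Proof. exact: fp_mx_ge0. Qed.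
Let P0E x y : (0 <= (P x y)%:E)%E. Proof. by rewrite lee_fin. Qed.
#[local] Hint Resolve P0 P0E : core.
Let L0 x : (0 <= L x)%E. Proof. exact: fp_lv_ge0. Qed.
#[local] Hint Resolve L0 : core.

Definition green_oo : R := fine (green P (fp_root o) (fp_root o) 1).
Local Notation g := green_oo.

Let GE : green P (fp_root o) (fp_root o) 1 = g%:E.
Proof. by rewrite fineK// ge0_fin_numE// green_ge0. Qed.

Lemma fp_greenE x : green P (fp_root o) x 1 = (g%:E * L x)%E.
Proof. by rewrite green_factor// GE. Qed.

Lemma green_oo_ge1 : 1 <= g.
Proof.
rewrite -lee_fin -GE green_renewal//= leeDl// mule_ge0 ?green_ge0// mul1e.
by apply: esum_ge0 => u _; rewrite mule_ge0//; exact: L0.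
Qed.

Let g_gt0 : 0 < g. Proof. exact: lt_le_trans green_oo_ge1. Qed.

Lemma fp_lv_fin x : (L x < +oo)%E.
Proof.
apply: le_lt_trans (Gfin x); rewrite fp_greenE -[leLHS]mul1e.
by apply: lee_wpmul2r => //; rewrite lee_fin green_oo_ge1.
Qed.

Definition ret_pr i : R := fine (@ret R r V o p alpha i).
Local Notation t := ret_pr.

Lemma retK i : @ret R r V o p alpha i = (t i)%:E.
Proof.
rewrite fineK// ge0_fin_numE; last exact: ret_ge0.
by apply: le_lt_trans (ret_le1 hstoch hloop alpha0 alpha1 i) _; rewrite ltry.
Qed.

Lemma ret_pr_ge0 i : 0 <= t i. Proof. by apply: fine_ge0; exact: ret_ge0. Qed.

Lemma ret_pr_le1 i : t i <= 1. Proof. by rewrite -lee_fin -retK; exact: ret_le1. Qed.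

(** The probability of never returning to the root, that is [1 / G] by [escape_green]. *)
Definition escape : R := 1 - \sum_(i < r) alpha i * t i.
Local Notation B := escape.

Lemma escape_green : B * g = 1.
Proof.
have : g%:E = (1 + g%:E * (\sum_(i < r) alpha i * t i)%:E)%E.
  rewrite -GE {1}green_renewal//; congr (1 + _ * _)%E; rewrite mul1e.
  apply: etrans (@fp_mx_pred R r V o p alpha p0 alpha0 L (fp_root o) L0) _.
  by rewrite -sumEFin; apply: eq_bigr => i _; rewrite EFinM -retK.
rewrite -EFinM -EFinD => -[h].
by rewrite /escape mulrBl mul1r {1}h (mulrC g) addrK.
Qed.

Lemma escape_gt0 : 0 < B.
Proof. by rewrite -(pmulr_lgt0 _ g_gt0) escape_green. Qed.

Lemma escapeD i : B + alpha i * t i = 1 - \sum_(j < r | j != i) alpha j * t j.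
Proof. by rewrite /escape (bigD1 i)//= opprD addrA addrAC subrK. Qed.

Lemma one_sub_Hbar i : 1 - fine (Hbar o p alpha i 1) = B + alpha i * t i.
Proof.
rewrite HbarE//; under eq_bigr do rewrite retK -EFinM.
by rewrite sumEFin escapeD.
Qed.

Lemma escape_sum : B = \sum_(i < r) alpha i * (1 - t i).
Proof.
by rewrite /escape -[X in X - _]alpha1 -sumrB; apply: eq_bigr => i _; rewrite mulrBr mulr1.
Qed.

Lemma escape_ret_ge i : alpha i <= B + alpha i * t i.
Proof.
rewrite escape_sum (bigD1 i)//= mulrBr mulr1 addrAC subrK lerDl.
by apply: sumr_ge0 => j _; rewrite mulr_ge0// subr_ge0 ret_pr_le1.
Qed.

Let e_gt0 i : 0 < B + alpha i * t i.
Proof. exact: lt_le_trans (escape_ret_ge i). Qed.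

Lemma xiE i : xi i = alpha i / (B + alpha i * t i).
Proof. by rewrite -one_sub_Hbar -{1}[alpha i]mulr1. Qed.

Lemma xi_gt0 i : 0 < xi i. Proof. by rewrite xiE divr_gt0. Qed.

Lemma xi_le1 i : xi i <= 1.
Proof. by rewrite xiE ler_pdivrMr// mul1r escape_ret_ge. Qed.

Lemma alpha_div_xi i : alpha i / xi i = B + alpha i * t i.
Proof.
rewrite xiE invf_div mulrCA divff ?mulr1// gt_eqF//.
Qed.

Let xi0E i : (0 <= (xi i)%:E)%E. Proof. by rewrite lee_fin ltW// xi_gt0. Qed.
#[local] Hint Resolve xi0E : core.

Local Notation Li i v := (last_visit_gf (p i) (o i) v (xi i)).

Let Li0 i v : (0 <= Li i v)%E.
Proof. by apply: last_visit_gf_ge0 => //; exact: ltW (xi_gt0 i). Qed.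
#[local] Hint Resolve Li0 : core.

Lemma fp_move_emb i (u v : V i) : fp_move (fp_emb v) u = fp_emb u :> freeprod o.
Proof. by apply: val_inj => /=; rewrite -[wcat [::] v]/(sval (fp_emb v)) stem_fp_move. Qed.

Lemma wtype_emb i j (v : V i) : j != i -> wtype (sval (fp_emb v : freeprod o)) != Some j.
Proof.
move=> ji; rewrite sval_fp_emb /wcat; case: insub => //= a.
by apply: contra ji => /eqP[->].
Qed.

(** On [V i], [L] is a supersolution for the chain [p i] discounted by [xi i]. In the equation of
    [L] at [v], excursions into another factor [j] contribute at least [alpha j * t j * L(v)] by
    [fp_lv_cat]; moving these terms to the other side leaves the coefficient [B + alpha i * t i],
    which is [alpha i / xi i]. *)
Lemma letter_lv_le i (v : V i) : (Li i v <= L (fp_emb v))%E.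
Proof.
have z0 : 0 <= xi i by rewrite ltW// xi_gt0.
rewrite -[leLHS]mul1e.
apply: (@last_visit_gf_min _ _ _ (p0 (i:=i)) _ z0 _ 1 (fun v => L (fp_emb v))) => //.
  by rewrite fp_emb_root fp_lv_root.
move=> {}v vo; set A := esum _ _.
have A0 : (0 <= A)%E by apply: esum_ge0 => u _; exact: mule_ge0.
have Lf u : L u \is a fin_num by rewrite ge0_fin_numE// fp_lv_fin.
have key : ((alpha i)%:E * A + L (fp_emb v) *
    (\sum_(j < r | j != i) alpha j * t j)%:E <= L (fp_emb v))%E.
  rewrite [leRHS]fp_lv_eq//; last exact: fp_emb_neq.
  rewrite [leRHS](bigD1 i)//=; apply: leeD.
    apply: lee_wpmul2l => //; apply: le_esum => u _.
    by rewrite fp_move_emb [coord i _](coord_fp_move (fp_root o) v).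
  rewrite -sumEFin ge0_sume_distrr; last first.
    by move=> j _; rewrite lee_fin mulr_ge0// ret_pr_ge0.
  apply: lee_sum => j ji; rewrite EFinM -retK muleCA; apply: lee_wpmul2l => //.
  rewrite -esumZl//; last by move=> u; rewrite mule_ge0.
  apply: le_esum => u _; rewrite coord_neq ?wtype_emb//.
  rewrite muleA; apply: lee_wpmul2r => //; apply: fp_lv_cat => //.
    by rewrite /= stem_neq ?wtype_emb// -wcat_cat cats0.
  exact: fp_lv_fin.
have Af : A \is a fin_num.
  rewrite ge0_fin_numE//; have := fp_lv_fin (fp_emb v); apply: contraLR.
  rewrite -!leNgt !leye_eq => /eqP Ay; move: key; rewrite Ay gt0_muley ?lte_fin//.
  by rewrite addye ?leye_eq// gt_eqF// (lt_le_trans (ltNyr 0))// mule_ge0//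
     lee_fin sumr_ge0// => j _; rewrite mulr_ge0// ret_pr_ge0.
move: key; rewrite -(fineK Af) -(fineK (Lf (fp_emb v))).
set l := fine (L _); set a := fine A; rewrite -!EFinM -EFinD !lee_fin.
rewrite xiE mulrAC ler_pdivrMr//.
by rewrite escapeD mulrBr mulr1 lerBrDr mulrC.
Qed.

Lemma letter_lv_fin i (v : V i) : Li i v \is a fin_num.
Proof.
by rewrite ge0_fin_numE//; exact: le_lt_trans (letter_lv_le v) (fp_lv_fin _).
Qed.

Definition letter_lv i (v : V i) : R := fine (Li i v).
Local Notation li := letter_lv.

Lemma letter_lv_ge0 i (v : V i) : 0 <= li v. Proof. exact: fine_ge0. Qed.

Lemma letter_lvK i (v : V i) : Li i v = (li v)%:E.
Proof. by rewrite fineK// letter_lv_fin. Qed.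

Lemma letter_lv_root i : li (o i) = 1.
Proof. by rewrite /li last_visit_gf_diag// ltW// xi_gt0. Qed.

Definition word_lv (w : seq (letter o)) : R := \prod_(a <- w) li (val (tagged a)).

Lemma word_lv_ge0 w : 0 <= word_lv w.
Proof. by apply: prodr_ge0 => a _; exact: letter_lv_ge0. Qed.

Lemma word_lv_rcons w a : word_lv (rcons w a) = word_lv w * li (val (tagged a)).
Proof. by rewrite /word_lv -cats1 big_cat big_seq1. Qed.

Lemma word_lv_wcat w i (v : V i) : word_lv (wcat w v) = word_lv w * li v.
Proof.
have [->|vo] := eqVneq v (o i); first by rewrite wcat_root letter_lv_root mulr1.
by rewrite -[v]/(val (Sub v vo : nonroot o i)) wcat_nonroot word_lv_rcons.
Qed.

Lemma fp_lv_le_word x : (L x <= (word_lv (sval x))%:E)%E.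
Proof.
rewrite -[leLHS]mul1e.
apply: (@last_visit_gf_min _ _ _ P0 _ ler01 _ 1 (fun x => (word_lv (sval x))%:E)) => //.
- by move=> y; rewrite lee_fin word_lv_ge0.
- by rewrite lee_fin /word_lv big_nil.
move=> y yo; rewrite mul1e fp_mx_pred//; last by move=> u; rewrite lee_fin word_lv_ge0.
move: yo; rewrite fp_root_neqP; case: y => y; case/lastP: y => // w a ry _ /=.
pose i := tag a; have z0 : 0 <= xi i by rewrite ltW// xi_gt0.
rewrite (bigD1 i)//=.
(* Moves in the factor of the last letter: the last-visit equation of [p i] at [xi i] replaces the
   sum by a division by [xi i]. *)
have -> : (\esum_(v in [set: V i]) ((word_lv (wcat (stem i (rcons w a)) v))%:E *
     (p i v (coord i (rcons w a)))%:E) = (word_lv (rcons w a) / xi i)%:E)%E.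
  rewrite stem_rcons_eq coord_rcons_eq word_lv_rcons -mulrA EFinM.
  transitivity (\esum_(v in [set: V i]) ((word_lv w)%:E *
      (Li i v * (p i v (val (tagged a)))%:E)))%E.
    by apply: eq_esum => v _; rewrite word_lv_wcat letter_lvK muleA -EFinM.
  rewrite esumZl; [|by rewrite lee_fin word_lv_ge0|by move=> v; exact: mule_ge0].
  congr (_ * _)%E; have an : val (tagged a) != o i by exact: valP (tagged a).
  have := @last_visit_gf_eq _ _ _ (p0 (i:=i)) _ z0 _ _ an.
  set A := esum _ _; rewrite letter_lvK => e.
  by rewrite mulrC EFinM -/i e muleA -EFinM mulVf ?mul1e// gt_eqF// xi_gt0.
rewrite -EFinM mulrCA alpha_div_xi.
(* Moves in a factor [j] other than [i] append a letter, and [letter_lv_le] bounds the resulting sum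
   by [t j]. The coefficients then add up to [B] plus all [alpha j * t j], which is 1. *)
apply: (@le_trans _ _ (((word_lv (rcons w a)) * (B + alpha i * t i))%:E +
    \sum_(j < r | j != i) ((alpha j * (word_lv (rcons w a) * t j))%:E))%E).
  rewrite leeD2l//; apply: lee_sum => j ji; rewrite EFinM; apply: lee_wpmul2l => //.
  have wj : wtype (rcons w a) != Some j by rewrite wtype_rcons; apply: contra ji => /eqP[<-].
  rewrite stem_neq// coord_neq// EFinM -retK -esumZl ?lee_fin ?word_lv_ge0//; last first.
    by move=> v; rewrite mule_ge0.
  apply: le_esum => v _; rewrite word_lv_wcat EFinM -muleA.
  apply: lee_wpmul2l; first by rewrite lee_fin word_lv_ge0.
  by apply: lee_wpmul2r => //; rewrite -letter_lvK letter_lv_le.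
rewrite sumEFin -EFinD lee_fin.
under eq_bigr do rewrite mulrCA.
rewrite -mulr_sumr -mulrDr -addrA -[X in _ * (_ + X)](bigD1 i (P := predT) (F := fun j => alpha j * t j))//=.
by rewrite /escape subrK mulr1.
Qed.

Lemma fp_lv_ge_word x : ((word_lv (sval x))%:E <= L x)%E.
Proof.
case: x => w rw /=; elim/last_ind: w rw => [|w a ih] rw.
  rewrite (_ : exist _ _ _ = fp_root o); last exact: val_inj.
  by rewrite fp_lv_root// /word_lv big_nil.
have rw' : reduced w by move: rw; rewrite reduced_rcons => /andP[].
pose x : freeprod o := exist (fun w => is_true (reduced w)) w rw'.
rewrite word_lv_rcons EFinM.
apply: (@le_trans _ _ (L x * L (fp_letter a))%E); last first.
  by apply: fp_lv_cat => //=; [rewrite cats1|exact: fp_lv_fin].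
apply: lee_pmul; rewrite ?lee_fin ?word_lv_ge0 ?letter_lv_ge0//; first exact: ih.
by rewrite -letter_lvK -fp_emb_letter letter_lv_le.
Qed.

(* [>=] is multiplicativity under concatenation; [<=] holds because the product is a
   supersolution of the last-visit equation, whose least solution is [L]. *)
Lemma fp_lvE x : L x = (word_lv (sval x))%:E.
Proof. by apply/eqP; rewrite eq_le fp_lv_le_word fp_lv_ge_word. Qed.

Lemma fp_lv_emb i (v : V i) : L (fp_emb v) = Li i v.
Proof. by rewrite fp_lvE sval_fp_emb word_lv_wcat /word_lv big_nil mul1r letter_lvK. Qed.

End factorization.

(** * Discounted chains on a single factor *)

Section geometric_bounds.
Context {R : realType}.

Lemma geometric_nneseries_le (c z : R) : 0 <= c -> 0 < z < 1 ->
  (\sum_(0 <= n <oo) (c * z ^+ n)%:E <= (c / (1 - z))%:E)%E.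
Proof.
move=> c0 /andP[z0 z1]; apply: lime_le.
  by apply: is_cvg_nneseries => n _ _; rewrite lee_fin mulr_ge0// exprn_ge0// ltW.
apply: nearW => n; rewrite sumEFin lee_fin.
have := @geometric_le_lim R n c z c0 z0; rewrite ger0_norm ?(ltW z0)// => /(_ z1).
by rewrite /series.
Qed.

Lemma bernoulli_ineq (h : R) n : 0 <= h -> n%:R * h <= (1 + h) ^+ n.
Proof.
move=> h0; suff : 1 + n%:R * h <= (1 + h) ^+ n by apply: le_trans; rewrite lerDr.
elim: n => [|n ih]; first by rewrite mul0r addr0 expr0.
rewrite exprSr; have := ler_wpM2r (addr_ge0 ler01 h0) ih; apply: le_trans.
rewrite -natr1 -subr_ge0.
have -> : (1 + n%:R * h) * (1 + h) - (1 + (n%:R + 1) * h) = n%:R * h ^+ 2 by ring.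
by rewrite mulr_ge0// exprn_ge0.
Qed.

Lemma sqr_nneseries_fin (z : R) : 0 < z < 1 -> exists C : R, 0 <= C /\
  (\sum_(0 <= n <oo) (n%:R ^+ 2 * z ^+ n)%:E <= C%:E)%E.
Proof.
(* With this [h] the ratio [rho] is below 1, since [z = 1 - 4 h]; the bound [n <= (1 + h)^n / h]
   then turns [n^2 z^n] into a geometric term. *)
move=> /andP[z0 z1]; pose h := (1 - z) / 4%:R; pose rho := (1 + h) ^+ 2 * z.
have h0 : 0 < h by rewrite divr_gt0 ?subr_gt0.
have rho01 : 0 < rho < 1.
  apply/andP; split; first by rewrite mulr_gt0// exprn_gt0// addr_gt0.
  by rewrite /rho /h; nra.
exists (h ^- 2 / (1 - rho)); split.
  by rewrite divr_ge0 ?invr_ge0 ?exprn_ge0 ?ltW// subr_gt0; case/andP: rho01.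
apply: le_trans (geometric_nneseries_le _ rho01); last first.
  by rewrite invr_ge0 exprn_ge0// ltW.
apply: lee_nneseries => n _; first by move=> _; rewrite lee_fin mulr_ge0 ?exprn_ge0// ltW.
rewrite lee_fin.
have -> : h ^- 2 * rho ^+ n = ((1 + h) ^+ n / h) ^+ 2 * z ^+ n.
  rewrite /rho [(_ * z) ^+ n]exprMn mulrA -exprM (mulnC 2%N) exprM.
  by rewrite [in RHS]exprMn exprVn (mulrC (h ^- 2)).
apply: ler_wpM2r; first by rewrite exprn_ge0// ltW.
have h0' := ltW h0; have hh : 0 <= (1 + h) ^+ n / h.
  by apply: divr_ge0 => //; apply: exprn_ge0; exact: addr_ge0.
by rewrite ler_sqr ?nnegrE// ler_pdivlMr// bernoulli_ineq.
Qed.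

End geometric_bounds.

Section discounted_chain.
Local Open Scope ereal_scope.
Context {R : realType} {S : countType} (q : S -> S -> R) (x0 : S) (z : R).
Hypothesis hq : stochastic q.
Hypothesis z01 : (0 < z < 1)%R.
Implicit Types (x y u v : S).

Let q0 x y : (0 <= q x y)%R. Proof. by have [] := hq. Qed.
Let q1 x : \esum_(y in [set: S]) (q x y)%:E = 1. Proof. by have [] := hq. Qed.
Let z0 : (0 <= z)%R. Proof. by case/andP: z01 => /ltW. Qed.
Let z0E : 0 <= z%:E. Proof. by rewrite lee_fin. Qed.
Let zX n : 0 <= (z ^+ n)%:E. Proof. by rewrite lee_fin exprn_ge0. Qed.

(** At each time the chain has total mass 1, so a bound of [f] on the support at time [n] bounds its
    sum against that law. *)
Lemma green_weight_le (f : S -> R) (F : nat -> R) :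
  (forall v, 0 <= f v)%R ->
  (forall n, 0 <= F n)%R ->
  (forall n v, 0 < nstep q n x0 v -> (f v <= F n)%R) ->
  \esum_(v in [set: S]) (green q x0 v z * (f v)%:E) <=
  \sum_(0 <= n <oo) (F n * z ^+ n)%:E.
Proof.
move=> f0 F0 fF.
have -> : \esum_(v in [set: S]) (green q x0 v z * (f v)%:E) =
  \sum_(0 <= n <oo) \esum_(v in [set: S]) (nstep q n x0 v * (z ^+ n)%:E * (f v)%:E).
  rewrite nneseries_esum_exchange; last first.
    by move=> n v; rewrite mule_ge0 ?lee_fin// mule_ge0// nstep_ge0.
  apply: eq_esum => v _; rewrite muleC -nneseriesZl; last first.
    by move=> n _; rewrite mule_ge0// nstep_ge0.
  by apply: eq_eseriesr => n _; rewrite muleC.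
apply: lee_nneseries.
  move=> n _ _; apply: esum_ge0 => v _.
  by rewrite mule_ge0 ?lee_fin// mule_ge0// nstep_ge0.
move=> n _; rewrite -[leRHS]mul1e -(nstep_sum1 q0 q1 n x0) -esumZr; last 2 first.
- by rewrite lee_fin mulr_ge0// exprn_ge0.
- by move=> v; exact: nstep_ge0.
apply: le_esum => v _; rewrite -muleA -EFinM mulrC.
have [e|ne] := eqVneq (nstep q n x0 v) 0; first by rewrite e !mul0e.
apply: lee_wpmul2l; first exact: nstep_ge0.
rewrite lee_fin ler_wpM2r ?exprn_ge0//; apply: fF.
by rewrite lt_neqAle eq_sym ne nstep_ge0.
Qed.

Lemma green_sum_le : \esum_(v in [set: S]) green q x0 v z <= ((1 - z)^-1)%:E.
Proof.
have -> : \esum_(v in [set: S]) green q x0 v z = \esum_(v in [set: S]) (green q x0 v z * (1%R)%:E).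
  by apply: eq_esum => v _; rewrite mule1.
apply: le_trans (@green_weight_le (cst 1%R) (cst 1%R) _ _ _) _ => //=.
by apply: le_trans (@geometric_nneseries_le _ 1 z _ z01) _ => //; rewrite div1r.
Qed.

Lemma green_le v : green q x0 v z <= ((1 - z)^-1)%:E.
Proof.
by apply: le_trans green_sum_le; apply: esum_ge_term => // u; exact: green_ge0.
Qed.

Lemma green_lty v : green q x0 v z < +oo.
Proof. by apply: le_lt_trans (green_le v) _; rewrite ltry. Qed.

Lemma green_diag_ge1 : 1 <= green q x0 x0 z.
Proof.
rewrite green_eq// eqxx leeDl// mule_ge0//; apply: esum_ge0 => u _.
by rewrite mule_ge0 ?lee_fin ?green_ge0.
Qed.

Lemma last_visit_gf_le_green v : last_visit_gf q x0 v z <= green q x0 v z.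
Proof.
rewrite [leRHS]green_factor ?green_lty// -[leLHS]mul1e.
by apply: lee_wpmul2r; [exact: last_visit_gf_ge0|exact: green_diag_ge1].
Qed.

Lemma last_visit_gf_sum_le :
  \esum_(v in [set: S]) last_visit_gf q x0 v z <= ((1 - z)^-1)%:E.
Proof.
by apply: le_trans green_sum_le; apply: le_esum => v _; exact: last_visit_gf_le_green.
Qed.

(** Sum of the last-visit equations over all states. The state [x0], where the value is 1 in place
    of the equation, accounts for the two extra terms. This is what evaluates [letter_mass]. *)
Lemma last_visit_gf_sum :
  (\esum_(v in [set: S]) last_visit_gf q x0 v z) +
  z%:E * (\esum_(v in [set: S]) (last_visit_gf q x0 v z * (q v x0)%:E)) =
  1 + z%:E * (\esum_(v in [set: S]) last_visit_gf q x0 v z).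
Proof.
have l0 v : 0 <= last_visit_gf q x0 v z by exact: last_visit_gf_ge0.
have lq v u : 0 <= last_visit_gf q x0 v z * (q v u)%:E by rewrite mule_ge0// lee_fin.
pose F u := z%:E * \esum_(v in [set: S]) (last_visit_gf q x0 v z * (q v u)%:E).
have F0 u : 0 <= F u by rewrite mule_ge0// esum_ge0.
have -> : z%:E * (\esum_(v in [set: S]) last_visit_gf q x0 v z) = \esum_(u in [set: S]) F u.
  rewrite /F esumZl//; last by move=> u; exact: esum_ge0.
  congr (_ * _); rewrite esum_exchange//; apply: eq_esum => v _.
  by rewrite esumZl ?q1 ?mule1// => u; rewrite lee_fin.
rewrite (esumID [set x0])// !setTI esum_set1// last_visit_gf_diag//.
rewrite [in RHS](esumID [set x0])// !setTI esum_set1// -addeA; congr (1 + _).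
rewrite addeC; congr (_ + _); apply: eq_esum => u /= /eqP ux.
by rewrite last_visit_gf_eq.
Qed.

End discounted_chain.

Section return_bound.
Local Open Scope ereal_scope.
Context {R : realType} {S : countType} (q : S -> S -> R) (x0 : S) (z : R).
Hypothesis hq : stochastic q.
Hypothesis z01 : (0 <= z <= 1)%R.

(** Without a loop at [x0] the term [n = 0] vanishes, so one factor [z] comes out of every remaining
    term; the undiscounted rest is at most 1 by mass balance. *)
Lemma last_visit_gf_return_le : q x0 x0 = 0%R ->
  \esum_(v in [set: S]) (last_visit_gf q x0 v z * (q v x0)%:E) <= z%:E.
Proof.
move=> q00; have [z0 z1] := andP z01; have [q0 q1] := hq.
have q0E x y : 0 <= (q x y)%:E by rewrite lee_fin.
have zX n : 0 <= (z ^+ n)%:E by rewrite lee_fin exprn_ge0.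
have lv0 n v : 0 <= last_visit q n x0 v by exact: last_visit_ge0.
pose D n := \esum_(v in [set: S]) (last_visit q n x0 v * (q v x0)%:E).
have D0 n : 0 <= D n by apply: esum_ge0 => v _; rewrite mule_ge0.
have -> : \esum_(v in [set: S]) (last_visit_gf q x0 v z * (q v x0)%:E) =
  \sum_(0 <= n <oo) ((z ^+ n)%:E * D n).
  transitivity (\sum_(0 <= n <oo) \esum_(v in [set: S])
      ((z ^+ n)%:E * (last_visit q n x0 v * (q v x0)%:E))).
    rewrite nneseries_esum_exchange; last by move=> n v; rewrite mule_ge0// mule_ge0.
    apply: eq_esum => v _; rewrite muleC -nneseriesZl; last first.
      by move=> n _; rewrite mule_ge0.
    by apply: eq_eseriesr => n _; rewrite muleC -muleA muleCA.
  by apply: eq_eseriesr => n _; rewrite esumZl// => v; rewrite mule_ge0.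
rewrite eseries_recl; last by move=> n; rewrite mule_ge0.
rewrite [D 0%N]esum1 ?mule0 ?add0e; last first.
  move=> v _; rewrite last_visit_taboo taboo0; case: eqVneq => [<-|_]; last by rewrite mul0e.
  by rewrite q00 mule0.
apply: (@le_trans _ _ (z%:E * \sum_(0 <= n <oo) D n.+1)).
  rewrite -nneseriesZl//; apply: lee_nneseries => [n _ _|n _]; first by rewrite mule_ge0.
  apply: lee_wpmul2r => //; rewrite lee_fin exprS ler_piMr// exprn_ile1//.
rewrite -[leRHS]mule1; apply: lee_wpmul2l; first by rewrite lee_fin.
apply: le_trans (@last_visit_leak _ _ _ q0 (cst 1) (fun v => (q v x0)%:E) x0 _ _ _) _ => //.
  move=> y _ /=; rewrite -[leRHS](q1 y).
  have -> : (q y x0)%:E = \esum_(u in [set: S]) if u \in [set x0] then (q y u)%:E else 0.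
    by rewrite -esum_mkcond esum_set1.
  rewrite -esumD; last 2 first.
  - by move=> u _; case: ifP => // _; rewrite mule1.
  - by move=> u _; case: ifP.
  by apply: le_esum => u _; rewrite in_set1; case: eqP => _; rewrite ?add0e ?adde0 ?mule1.
apply: le_trans (_ : \esum_(v in [set: S]) nstep q 1 x0 v <= 1).
  by apply: le_esum => v _; rewrite mule1 last_visit_le_nstep.
by rewrite nstep_sum1.
Qed.

End return_bound.

(** * Sums of arbitrary sign *)

Section csum_theory.
Context {R : realType}.
Implicit Types S : countType.

Definition asum_fin S (f : S -> R) : Prop :=
  (\esum_(x in [set: S]) `|f x|%:E < +oo)%E.

Let esumE S (a : S -> R) : (forall x, 0 <= a x) -> asum_fin a ->
  (\esum_(x in [set: S]) (a x)%:E = (fine (\esum_(x in [set: S]) (a x)%:E))%:E)%E.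
Proof.
move=> a0 fa; rewrite fineK// ge0_fin_numE; last first.
  by apply: esum_ge0 => x _; rewrite lee_fin.
by apply: le_lt_trans fa; apply: le_esum => x _; rewrite lee_fin ler_norm.
Qed.

Lemma asum_fin_le S (f a : S -> R) : (forall x, `|f x| <= `|a x|) -> asum_fin a -> asum_fin f.
Proof. by move=> fa; apply: le_lt_trans; apply: le_esum => x _; rewrite lee_fin. Qed.

Lemma asum_finD S (f g : S -> R) : asum_fin f -> asum_fin g -> asum_fin (fun x => f x + g x).
Proof.
move=> hf hg; apply: le_lt_trans (lte_add_pinfty hf hg).
rewrite -esumD//; apply: le_esum => x _; by rewrite -EFinD lee_fin ler_normD.
Qed.

Lemma asum_finZ S (c : R) (f : S -> R) : asum_fin f -> asum_fin (fun x => c * f x).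
Proof.
move=> hf; rewrite /asum_fin.
have -> : (\esum_(x in [set: S]) `|c * f x|%:E =
    `|c|%:E * \esum_(x in [set: S]) `|f x|%:E)%E.
  rewrite -esumZl ?lee_fin//.
  by apply: eq_esum => x _; rewrite normrM EFinM.
have f0 : (0 <= \esum_(x in [set: S]) `|f x|%:E)%E.
  by apply: esum_ge0 => x _; rewrite lee_fin.
have ff : (\esum_(x in [set: S]) `|f x|%:E)%E \is a fin_num by rewrite ge0_fin_numE.
by rewrite -(fineK ff) -EFinM ltry.
Qed.

(** The positive part plus [b] equals the negative part plus [a]: adding across compares sums of
    nonnegative terms only, and finiteness allows the subtraction. *)
Lemma csum_diff S (f a b : S -> R) : (forall x, 0 <= a x) -> (forall x, 0 <= b x) ->
  asum_fin a -> asum_fin b -> (forall x, f x = a x - b x) ->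
  csum f = fine (\esum_(x in [set: S]) (a x)%:E)%E -
           fine (\esum_(x in [set: S]) (b x)%:E)%E.
Proof.
move=> a0 b0 fa fb fab.
pose f1 x := Num.max (f x) 0; pose f2 x := Num.max (- f x) 0.
have f10 x : 0 <= f1 x by rewrite le_max lexx orbT.
have f20 x : 0 <= f2 x by rewrite le_max lexx orbT.
have f1a : asum_fin f1.
  apply: asum_fin_le fa => x; rewrite !ger0_norm// /f1 ge_max a0 andbT fab.
  by rewrite gerBl.
have f2b : asum_fin f2.
  apply: asum_fin_le fb => x; rewrite !ger0_norm// /f2 ge_max b0 andbT fab.
  by rewrite opprB gerBl.
have : (\esum_(x in [set: S]) (f1 x)%:E + \esum_(x in [set: S]) (b x)%:E =
   \esum_(x in [set: S]) (f2 x)%:E + \esum_(x in [set: S]) (a x)%:E)%E.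
  rewrite -!esumD; do ?by move=> x _; rewrite lee_fin.
  apply: eq_esum => x _; rewrite -!EFinD; congr EFin.
  have -> : f1 x = f2 x + f x.
    by rewrite /f1 /f2; case: (leP (f x) 0); case: (leP (- f x) 0); lra.
  by rewrite fab; lra.
rewrite (esumE f10 f1a) (esumE f20 f2b) (esumE a0 fa) (esumE b0 fb) -!EFinD => -[e].
have -> : csum f = fine (\esum_(x in [set: S]) (f1 x)%:E)%E -
    fine (\esum_(x in [set: S]) (f2 x)%:E)%E by [].
by apply/eqP; rewrite subr_eq addrAC eq_sym subr_eq addrC -e addrC.
Qed.

Lemma csum_ge0E S (f : S -> R) : (forall x, 0 <= f x) -> asum_fin f ->
  (\esum_(x in [set: S]) (f x)%:E = (csum f)%:E)%E.
Proof.
move=> f0 ff; rewrite (@csum_diff _ f f (fun=> 0))//.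
- by rewrite [X in _ - fine X]esum1//= subr0 -esumE.
- by rewrite /asum_fin esum1 ?ltry// => x _; rewrite normr0.
- by move=> x; rewrite subr0.
Qed.

Let parts S (f : S -> R) : asum_fin f -> [/\ asum_fin (fun x => Num.max (f x) 0),
  asum_fin (fun x => Num.max (- f x) 0) & forall x, f x = Num.max (f x) 0 - Num.max (- f x) 0].
Proof.
move=> ff; split.
- by apply: asum_fin_le ff => x; rewrite [leLHS]ger0_norm ?le_max ?lexx ?orbT// ge_max ler_norm normr_ge0.
- by apply: asum_fin_le ff => x; rewrite [leLHS]ger0_norm ?le_max ?lexx ?orbT// ge_max -normrN ler_norm normr_ge0.
- by move=> x; case: (leP (f x) 0); case: (leP (- f x) 0); lra.
Qed.

Lemma csumD S (f g : S -> R) : asum_fin f -> asum_fin g ->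
  csum (fun x => f x + g x) = csum f + csum g.
Proof.
move=> /parts[f1 f2 fE] /parts[g1 g2 gE].
have m0 (y : R) : 0 <= Num.max y 0 by rewrite le_max lexx orbT.
rewrite (@csum_diff _ _ (fun x => Num.max (f x) 0 + Num.max (g x) 0)
  (fun x => Num.max (- f x) 0 + Num.max (- g x) 0)).
- have sE (a b : S -> R) : (forall x, 0 <= a x) -> (forall x, 0 <= b x) ->
      asum_fin a -> asum_fin b ->
      fine (\esum_(x in [set: S]) (a x + b x)%:E)%E =
      fine (\esum_(x in [set: S]) (a x)%:E)%E + fine (\esum_(x in [set: S]) (b x)%:E)%E.
    move=> a0 b0 fa fb; under eq_esum do rewrite EFinD.
    rewrite esumD; do ?by move=> x _; rewrite lee_fin.
    by rewrite (esumE a0 fa) (esumE b0 fb).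
  by rewrite !sE// /csum; lra.
- by move=> x; rewrite addr_ge0.
- by move=> x; rewrite addr_ge0.
- exact: asum_finD.
- exact: asum_finD.
- by move=> x; rewrite {1}fE {1}gE; lra.
Qed.

Lemma csumZ S (c : R) (f : S -> R) : asum_fin f ->
  csum (fun x => c * f x) = c * csum f.
Proof.
move=> /parts[f1 f2 fE].
have m0 (y : R) : 0 <= Num.max y 0 by rewrite le_max lexx orbT.
have sE (k : R) (a : S -> R) : 0 <= k -> (forall x, 0 <= a x) -> asum_fin a ->
    fine (\esum_(x in [set: S]) (k * a x)%:E)%E =
    k * fine (\esum_(x in [set: S]) (a x)%:E)%E.
  move=> k0 a0 fa; under eq_esum do rewrite EFinM.
  by rewrite esumZl ?lee_fin// (esumE a0 fa).
have [c0|c0] := leP 0 c.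
  rewrite (@csum_diff _ _ (fun x => c * Num.max (f x) 0) (fun x => c * Num.max (- f x) 0)).
  - by rewrite !sE// /csum mulrBr.
  - by move=> x; rewrite mulr_ge0.
  - by move=> x; rewrite mulr_ge0.
  - exact: asum_finZ.
  - exact: asum_finZ.
  - by move=> x; rewrite {1}fE mulrBr.
have c0' : 0 <= - c by rewrite oppr_ge0 ltW.
rewrite (@csum_diff _ _ (fun x => - c * Num.max (- f x) 0) (fun x => - c * Num.max (f x) 0)).
- by rewrite !sE// /csum; lra.
- by move=> x; rewrite mulr_ge0.
- by move=> x; rewrite mulr_ge0.
- exact: asum_finZ.
- exact: asum_finZ.
- by move=> x; rewrite {1}fE; lra.
Qed.

End csum_theory.

Section letter_sums.
Context {R : realType} {r : nat} {V : 'I_r -> countType} {o : forall i, V i}.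

(** The roots, which are not letters, are put back with value 0 so that sums run over the full sets
    [V i]. *)
Lemma esum_letter (f : letter o -> \bar R) (f' : forall i, V i -> \bar R) :
  (forall g, 0 <= f g)%E -> (forall i, f' i (o i) = 0%E) ->
  (forall g, f g = f' (tag g) (val (tagged g))) ->
  (\esum_(g in [set: letter o]) f g = \sum_(i < r) \esum_(v in [set: V i]) f' i v)%E.
Proof.
move=> f0 f'o ff'.
transitivity (\esum_(g in [set: letter o]) \sum_(i < r) if tag g == i then f g else 0)%E.
  apply: eq_esum => g _; rewrite (bigD1 (tag g))//= eqxx big1 ?adde0// => i ig.
  by rewrite eq_sym (negbTE ig).
rewrite esum_sum; last by move=> g i _ _; case: ifP.
apply: eq_bigr => i _.
rewrite (@esum_inj _ _ _ (fun x : nonroot o i => val x)); last 2 first.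
- exact: val_inj.
- move=> v hv; have [->//|vo] := eqVneq v (o i).
  by have := hv (Sub v vo).
rewrite (@esum_inj _ _ _ (fun x : nonroot o i => Tagged (nonroot o) x)); last 2 first.
- by move=> x y /eqP; rewrite eq_Tagged => /eqP.
- move=> [j x] hg /=; case: eqVneq => // e; exfalso.
  by case: i / e hg => /(_ x).
by apply: eq_esum => x _; rewrite /= eqxx ff'.
Qed.

Lemma csum_letter (f : letter o -> R) (f' : forall i, V i -> R) :
  (forall i, f' i (o i) = 0) -> (forall i, asum_fin (f' i)) ->
  (forall g, f g = f' (tag g) (val (tagged g))) ->
  asum_fin f /\ csum f = \sum_(i < r) csum (f' i).
Proof.
move=> f'o ff' fE.
have m0 (y : R) : (0 <= (Num.max y 0)%:E)%E by rewrite lee_fin le_max lexx orbT.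
have finE i (s : R) : `|s| = 1 ->
   (\esum_(v in [set: V i]) (Num.max (s * f' i v) 0)%:E)%E \is a fin_num.
  move=> s1; rewrite ge0_fin_numE; last exact: esum_ge0.
  apply: le_lt_trans (ff' i); apply: le_esum => v _; rewrite lee_fin ge_max normr_ge0 andbT.
  by rewrite -[leRHS]mul1r -s1 -normrM ler_norm.
split.
  rewrite /asum_fin (@esum_letter _ (fun i v => `|f' i v|%:E)).
  - apply: lte_sum_pinfty => i _; exact: ff'.
  - by move=> g; rewrite lee_fin.
  - by move=> i; rewrite f'o normr0.
  - by move=> g; rewrite fE.
rewrite /csum (@esum_letter _ (fun i v => (Num.max (f' i v) 0)%:E))//; last 2 first.
- by move=> i; rewrite f'o maxxx.
- by move=> g; rewrite fE.
rewrite (@esum_letter _ (fun i v => (Num.max (- f' i v) 0)%:E))//; last 2 first.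
- by move=> i; rewrite f'o oppr0 maxxx.
- by move=> g; rewrite fE.
rewrite sumrB -!sum_fine//.
- by move=> i _; have := finE i (-1); rewrite normrN1 => /(_ erefl); under eq_esum do rewrite mulN1r.
- by move=> i _; have := finE i 1; rewrite normr1 => /(_ erefl); under eq_esum do rewrite mul1r.
Qed.

End letter_sums.

(** * The chain of types and the length of letters *)

Section letters.
Context {R : realType} {r : nat} {V : 'I_r -> countType} {o : forall i, V i}.
Variables (p : forall i, V i -> V i -> R) (alpha : 'I_r -> R).
Arguments p : clear implicits.
Hypothesis hr : (2 <= r)%N.
Hypothesis hstoch : forall i, stochastic (p i).
Hypothesis hloop : forall i x, p i x x = 0%R.
Hypothesis alpha0 : forall i, (0 < alpha i)%R.
Hypothesis alpha1 : (\sum_(i < r) alpha i = 1)%R.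
Hypothesis Gfin : forall x,
  (green (@fp_mx R r V o p alpha) (fp_root o) x 1 < +oo)%E.
Implicit Types (x y : freeprod o) (w : seq (letter o)) (i j : 'I_r).

Local Notation xi i := (xi o p alpha i).
Local Notation t := (@ret_pr R r V o p alpha).
Local Notation B := (@escape R r V o p alpha).
Local Notation Li i v := (last_visit_gf (p i) (o i) v (xi i)).
Local Notation li := (@letter_lv R r V o p alpha _).

Let p0 i (u v : V i) : 0 <= p i u v. Proof. by have [] := hstoch i. Qed.
Let alpha0W i : 0 <= alpha i. Proof. by rewrite ltW. Qed.
Let LiK i (v : V i) : Li i v = (li v)%:E.
Proof. exact: (letter_lvK hstoch hloop alpha0 alpha1 Gfin). Qed.
Let xi0 i : 0 < xi i. Proof. exact: (xi_gt0 hstoch hloop alpha0 alpha1). Qed.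
Let xi1 i : xi i <= 1. Proof. exact: (xi_le1 hstoch hloop alpha0 alpha1). Qed.
Let li0 i (v : V i) : 0 <= li v.
Proof. exact: (letter_lv_ge0 hstoch hloop alpha0 alpha1). Qed.
Let t1 i : t i <= 1. Proof. exact: (ret_pr_le1 hstoch hloop alpha0 alpha1). Qed.
Let B0 : 0 < B. Proof. exact: (escape_gt0 hstoch hloop alpha0 alpha1 Gfin). Qed.
Let BE : B = \sum_(i < r) alpha i * (1 - t i). Proof. exact: escape_sum. Qed.
Let xiE' i : xi i = alpha i / (B + alpha i * t i).
Proof. exact: (xiE hstoch hloop alpha0 alpha1). Qed.
Let axi i : alpha i / xi i = B + alpha i * t i.
Proof. exact: (alpha_div_xi hstoch hloop alpha0 alpha1). Qed.

Lemma ret_prE i :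
  ((t i)%:E = \esum_(v in [set: V i]) (Li i v * (p i v (o i))%:E))%E.
Proof.
rewrite -(retK hstoch hloop alpha0 alpha1); apply: eq_esum => v _.
by rewrite (fp_lv_emb hstoch hloop alpha0 alpha1 Gfin).
Qed.

Lemma ret_pr_le_xi i : t i <= xi i.
Proof.
by rewrite -lee_fin ret_prE; apply: last_visit_gf_return_le => //; rewrite ltW//= xi1.
Qed.

(** By [A], [xi j < 1] as soon as [t k < 1] for some [k] other than [j]. Since [B > 0], some [k] has
    [t k < 1], which settles every index but [k]. A second index [j], available because [r >= 2],
    then has [t j <= xi j < 1] and settles [k] itself. *)
Lemma xi_lt1 i : xi i < 1.
Proof.
have A j k : k != j -> t k < 1 -> xi j < 1.
  move=> kj tk; have e0 : 0 < B + alpha j * t j.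
    by rewrite -axi divr_gt0.
  rewrite xiE' ltr_pdivrMr// mul1r -ltrBlDr -{1}[alpha j]mulr1 -mulrBr BE.
  rewrite [ltRHS](bigD1 j)//= ltrDl (bigD1 k)//= ltr_pwDl//.
    by rewrite mulr_gt0// subr_gt0.
  by apply: sumr_ge0 => l _; rewrite mulr_ge0// subr_ge0.
have [k tk] : exists k, t k < 1.
  apply: contrapT => h; have := B0; rewrite BE big1 ?ltxx// => k _.
  have [tk|tk] := ltP (t k) 1; first by exfalso; apply: h; exists k.
  by rewrite (_ : t k = 1) ?subrr ?mulr0//; apply/eqP; rewrite eq_le tk t1.
have [->|ik] := eqVneq i k; last by apply: A tk; rewrite eq_sym.
have [j jk] : exists j : 'I_r, j != k.
  have r0 : (0 < r)%N by exact: leq_trans hr.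
  have [k0|k0] := eqVneq (val k) 0%N.
    by exists (Ordinal hr); apply/eqP => /(congr1 val); rewrite k0.
  by exists (Ordinal r0); apply/eqP => /(congr1 val) /esym/eqP; rewrite (negbTE k0).
apply: (A _ j) => //; apply: le_lt_trans (ret_pr_le_xi j) _.
by apply: A tk; rewrite eq_sym.
Qed.

Let xi01 i : 0 < xi i < 1. Proof. by rewrite xi0 xi_lt1. Qed.

(** By [exit_prE] this is the sum of the branches other than [i]: from a word of type [i], the
    probability of never coming back while moving into its extensions. Note that [letter_mass]
    counts the root, which contributes 1. *)
Definition exit_pr i : R := alpha i * (1 - xi i) / xi i.
Definition branch i : R := alpha i * (1 - t i).
Definition letter_mass i : R := csum (fun v : V i => li v).

Local Notation w := exit_pr.
Local Notation b := branch.
Local Notation S := letter_mass.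

Lemma exit_pr_gt0 i : 0 < w i.
Proof. by rewrite /exit_pr divr_gt0// mulr_gt0// subr_gt0 xi_lt1. Qed.

Lemma branch_ge0 i : 0 <= b i.
Proof. by rewrite /branch mulr_ge0// subr_ge0. Qed.

Lemma branch_sum : \sum_(i < r) b i = B. Proof. by rewrite BE. Qed.

Lemma exit_prE i : w i = B - b i.
Proof.
rewrite /exit_pr mulrBr mulr1 mulrBl axi mulfK ?gt_eqF// /branch mulrBr mulr1.
by rewrite opprB addrA.
Qed.

Lemma letter_lv_asum i : asum_fin (fun v : V i => li v).
Proof.
apply: (@le_lt_trans _ _ ((1 - xi i)^-1)%:E); last exact: ltry.
apply: le_trans (last_visit_gf_sum_le (o i) (hstoch i) (xi01 i)).
by apply: le_esum => v _; rewrite ger0_norm// LiK.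
Qed.

Lemma letter_massE i : (\esum_(v in [set: V i]) Li i v = (S i)%:E)%E.
Proof.
rewrite -csum_ge0E//; last exact: letter_lv_asum.
by apply: eq_esum => v _; rewrite LiK.
Qed.

(** The consistency of the weights between spheres: the letters of type [j], each weighted by [w j],
    have total mass [b j], and the [b j] with [j] different from [i] add up to [w i]. *)
Lemma exit_pr_mass i : w i * (S i - 1) = b i.
Proof.
have := last_visit_gf_sum (o i) (hstoch i) (xi01 i).
rewrite -ret_prE letter_massE -!EFinM -!EFinD => -[] h.
have {}h : (1 - xi i) * (S i - 1) = xi i * (1 - t i) by lra.
have -> : w i * (S i - 1) = alpha i / xi i * ((1 - xi i) * (S i - 1)).
  by rewrite /exit_pr; ring.
by rewrite h /branch mulrA divfK// gt_eqF.
Qed.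

(** The renewal equation gives [1 / (1 - xi t)], and [alpha (1 - xi t) = xi B] by the formula for
    [xi]. *)
Lemma letter_greenE i : fine (green (p i) (o i) (o i) (xi i)) = alpha i / (xi i * B).
Proof.
have Gf : green (p i) (o i) (o i) (xi i) \is a fin_num.
  by rewrite ge0_fin_numE ?green_lty// green_ge0// ltW.
have := green_renewal (p0 (i:=i)) (ltW (xi0 i)) (green_lty (o i) (hstoch i) (xi01 i) (o i)).
rewrite -ret_prE -(fineK Gf); set g := fine _; rewrite -!EFinM -EFinD => -[] h.
have e : alpha i = xi i * B + xi i * (alpha i * t i).
  by rewrite -mulrDr -axi mulrCA divff ?mulr1// gt_eqF.
have xB : xi i * B != 0 by rewrite mulf_neq0// gt_eqF.
apply/(mulIf xB); rewrite divfK//.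
have : g * (alpha i - xi i * (alpha i * t i)) = alpha i.
  have -> : g * (alpha i - xi i * (alpha i * t i)) = alpha i * (g - g * (xi i * t i)) by ring.
  by rewrite {1}h addrK mulr1.
by rewrite {1}e addrK.
Qed.

(** As [(1 - xi) G_i] is [w / B], the last factor of [nu_weight] is [b / B]. So [nu] is proportional
    to [w i * b i], the stationary law of the chain of types that moves from [i] to another [j] with
    probability [b j / w i]. *)
Lemma nu_weightE i : nu_weight o p alpha i = w i * b i / B.
Proof.
rewrite /nu_weight letter_greenE -/(w i) -mulrA; congr (_ * _).
have -> : (1 - xi i) * (alpha i / (xi i * B)) = w i / B.
  by rewrite /exit_pr invfM; ring.
have Bn : B != 0 by rewrite gt_eqF.
by rewrite exit_prE mulrBl divff// opprB addrCA subrr addr0.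
Qed.

Definition branch_norm : R := \sum_(i < r) w i * b i.
Local Notation W := branch_norm.

Lemma branch_norm_gt0 : 0 < W.
Proof.
rewrite lt_neqAle; apply/andP; split; last first.
  by apply: sumr_ge0 => i _; rewrite mulr_ge0 ?branch_ge0// ltW// exit_pr_gt0.
apply/eqP => W0; have := B0; rewrite -branch_sum big1 ?ltxx// => i _.
have /eqP := esym W0; rewrite psumr_eq0; last first.
  by move=> j _; rewrite mulr_ge0 ?branch_ge0// ltW// exit_pr_gt0.
move=> /allP /(_ i (mem_index_enum i)) /=.
by rewrite mulf_eq0 gt_eqF ?exit_pr_gt0// => /eqP.
Qed.

(** The factor [w i] cancels, and the [b i] with [i] different from [j] add up to a second [w j];
    hence the square. Here [m] and [q] stand for [nu] and [q_mx] at a fixed letter of type [j]. *)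
Lemma mixture_exit_pr (m q : 'I_r -> R) j (l : R) :
  (forall i, m i = w i * b i / W) -> q j = 0 ->
  (forall i, i != j -> q i = w j / w i * l) ->
  \sum_(i < r) m i * q i = w j ^+ 2 / W * l.
Proof.
move=> mE q0 qE; have Wn : W != 0 by rewrite gt_eqF// branch_norm_gt0.
rewrite (bigD1 j)//= q0 mulr0 add0r.
transitivity (\sum_(i < r | i != j) b i * (w j / W * l)).
  apply: eq_bigr => i ij; rewrite mE qE//.
  have wn : w i != 0 by rewrite gt_eqF// exit_pr_gt0.
  by field; rewrite wn Wn.
rewrite -mulr_suml (_ : \sum_(i < r | i != j) b i = w j); first by ring.
by rewrite exit_prE -branch_sum [in RHS](bigD1 j)//= addrAC subrr add0r.
Qed.

Lemma pi_letterE (g : letter o) :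
  pi_letter p alpha g = w (tag g) ^+ 2 / W * li (val (tagged g)).
Proof.
have Bn : B != 0 by rewrite gt_eqF.
have Wn : W != 0 by rewrite gt_eqF// branch_norm_gt0.
have nuE j : nu o p alpha j = w j * b j / W.
  rewrite /nu; under eq_bigr do rewrite nu_weightE.
  by rewrite -mulr_suml -/branch_norm nu_weightE; field; rewrite Bn Wn.
pose j : 'I_r := tag g; rewrite -[tag g]/j.
have qE i : i != j -> q_mx p alpha i g = w j / w i * li (val (tagged g)).
  move=> ij; rewrite /q_mx ifN//; congr (_ * _).
  rewrite /exit_pr -/j.
  have xn k : xi k != 0 by rewrite gt_eqF.
  have an k : alpha k != 0 by rewrite gt_eqF.
  have x1n k : 1 - xi k != 0 by rewrite gt_eqF// subr_gt0 xi_lt1.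
  by field; rewrite !xn !an !x1n.
have q0 : q_mx p alpha j g = 0 by rewrite /q_mx eqxx.
exact: (mixture_exit_pr nuE q0 qE).
Qed.

End letters.

(** * Lengths of letters: linear bounds and second moments *)

Section letter_length.
Context {R : realType} {r : nat} {V : 'I_r -> countType} {o : forall i, V i}.
Variables (p : forall i, V i -> V i -> R) (alpha : 'I_r -> R).
Arguments p : clear implicits.
Hypothesis hr : (2 <= r)%N.
Hypothesis hstoch : forall i, stochastic (p i).
Hypothesis hacc : forall i, root_accessible (p i) (o i).
Hypothesis hloop : forall i x, p i x x = 0%R.
Hypothesis hunif : forall i, uniformly_irreducible (p i).
Hypothesis alpha0 : forall i, (0 < alpha i)%R.
Hypothesis alpha1 : (\sum_(i < r) alpha i = 1)%R.
Hypothesis Gfin : forall x,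
  (green (@fp_mx R r V o p alpha) (fp_root o) x 1 < +oo)%E.
Implicit Types (x y : freeprod o) (w : seq (letter o)) (i j : 'I_r).

Local Notation P := (@fp_mx R r V o p alpha).
Local Notation xi i := (xi o p alpha i).
Local Notation Li i v := (last_visit_gf (p i) (o i) v (xi i)).
Local Notation li := (@letter_lv R r V o p alpha _).

Let p0 i (u v : V i) : 0 <= p i u v. Proof. by have [] := hstoch i. Qed.
Let LiK i (v : V i) : Li i v = (li v)%:E.
Proof. exact: (letter_lvK hstoch hloop alpha0 alpha1 Gfin). Qed.
Let xi0 i : 0 < xi i. Proof. exact: (xi_gt0 hstoch hloop alpha0 alpha1). Qed.
Let xi01 i : 0 < xi i < 1.
Proof. by rewrite xi0 (xi_lt1 hr hstoch hloop alpha0 alpha1 Gfin). Qed.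
Let li0 i (v : V i) : 0 <= li v.
Proof. exact: (letter_lv_ge0 hstoch hloop alpha0 alpha1). Qed.
Let lio i : li (o i) = 1. Proof. exact: (letter_lv_root hstoch hloop alpha0 alpha1). Qed.

Definition dist i (v : V i) : nat := ex_minn (hacc v).

Lemma dist_reach i (v : V i) : (0 < nstep (p i) (dist v) (o i) v)%E.
Proof. by rewrite /dist; case: ex_minnP. Qed.

Lemma dist_le i (v : V i) n : (0 < nstep (p i) n (o i) v)%E -> (dist v <= n)%N.
Proof. by rewrite /dist; case: ex_minnP => m _; apply. Qed.

Lemma dist_root i : dist (o i) = 0%N.
Proof. by apply/eqP; rewrite -leqn0 dist_le// nstep0 eqxx lte_fin. Qed.

Lemma dist_gt0 i (v : V i) : v != o i -> (0 < dist v)%N.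
Proof.
move=> vo; rewrite lt0n; apply/eqP => d0; have := dist_reach v.
by rewrite d0 nstep0 eq_sym (negbTE vo) ltxx.
Qed.

Lemma dist_step i (u v : V i) : 0 < p i u v -> (dist v <= (dist u).+1)%N.
Proof.
by move=> puv; apply: dist_le; apply: nstep_gt0_step puv => //; exact: dist_reach.
Qed.

Definition letter_len i (v : V i) : R := - ln (li v).
Local Notation h := (@letter_len _).

Lemma letter_len_root i : h (o i) = 0.
Proof. by rewrite /letter_len lio ln1 oppr0. Qed.

(** Upper bound: the discounted Green function is at most [T]. Lower bound: by uniform
    irreducibility [v] is reached at some time [k <= K * dist v] with probability at least
    [eps ^+ dist v], discounting costs at most [xi ^+ (K * dist v)], and passing from the Green
    function to [li] costs at most [T]. Off the root [dist v >= 1] absorbs [ln T]; at the root the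
    length is 0. *)
Lemma letter_bounds i : exists c : R, 0 <= c /\
  forall v : V i, 0 < li v /\ `|h v| <= c * (dist v)%:R.
Proof.
have [eps [K [eps0 eps1 heps]]] := uniformly_irreducible_nstep_ge (p0 (i:=i)) (hunif i).
have [z0 z1] := andP (xi01 i).
pose T := (1 - xi i)^-1.
have T1 : 1 <= T by rewrite invf_ge1 ?subr_gt0// gerBl ltW.
have T0 : 0 < T by exact: lt_le_trans T1.
pose a := eps * xi i ^+ K.
have a0 : 0 < a by rewrite mulr_gt0// exprn_gt0.
have a1 : a <= 1 by rewrite mulr_ile1// ?exprn_ile1// ?exprn_ge0// ltW.
have upper (v : V i) : li v <= T.
  rewrite -lee_fin -LiK; apply: le_trans (last_visit_gf_le_green _ (hstoch i) (xi01 i) _) _.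
  exact: green_le.
have lower (v : V i) : a ^+ dist v / T <= li v.
  have [k [kK hk]] := heps _ _ _ (dist_reach v).
  rewrite ler_pdivrMr// -lee_fin.
  have : ((a ^+ dist v)%:E <= green (p i) (o i) v (xi i))%E.
    rewrite green_taboo /taboo_gf.
    apply: le_trans (nneseries_lim_ge k.+1 _); last first.
      by move=> n _ _; rewrite mule_ge0 ?taboo_ge0// lee_fin exprn_ge0// ltW.
    rewrite big_nat_recr//= -[leLHS]add0e; apply: leeD.
      by apply: sume_ge0 => n _; rewrite mule_ge0 ?taboo_ge0// lee_fin exprn_ge0// ltW.
    rewrite -nstep_taboo exprMn EFinM; apply: lee_pmul => //.
    - by rewrite lee_fin exprn_ge0// ltW.
    - by rewrite lee_fin exprn_ge0// exprn_ge0// ltW.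
    - by rewrite lee_fin -exprM; apply: ler_wiXn2l => //; exact: ltW.
  move=> /le_trans; apply; rewrite green_factor//; [|exact: ltW|exact: green_lty].
  rewrite LiK EFinM muleC; apply: lee_wpmul2l; first by rewrite lee_fin.
  exact: green_le.
have lpos (v : V i) : 0 < li v.
  by apply: lt_le_trans (lower v); rewrite divr_gt0// exprn_gt0.
clearbody T a; exists (- ln a + ln T); split.
  by rewrite addr_ge0 ?ln_ge0// oppr_ge0 ln_le0.
move=> v; split => //.
have lT : 0 <= ln T by rewrite ln_ge0.
have la : 0 <= - ln a by rewrite oppr_ge0 ln_le0.
have [->|vo] := eqVneq v (o i).
  by rewrite letter_len_root normr0 mulr_ge0// addr_ge0.
have d1 : 1 <= (dist v)%:R :> R by rewrite ler1n dist_gt0.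
rewrite ler_norml; apply/andP; split.
  rewrite /letter_len lerNl opprK.
  have : ln (li v) <= ln T by rewrite ler_ln ?posrE.
  move=> /le_trans; apply; nra.
have : ln (a ^+ dist v / T) <= ln (li v).
  by rewrite ler_ln ?posrE// divr_gt0// exprn_gt0.
have -> : ln (a ^+ dist v / T) = (dist v)%:R * ln a - ln T.
  have ad : 0 < a ^+ dist v by exact: exprn_gt0.
  by rewrite lnM ?posrE ?invr_gt0// lnV ?posrE// lnXn// mulr_natl.
by rewrite /letter_len; nra.
Qed.

Lemma letter_lv_gt0 i (v : V i) : 0 < li v.
Proof. by have [c [_ /(_ v)[]]] := letter_bounds i. Qed.

Lemma letter_len_le : exists c : R, 0 <= c /\
  forall i (v : V i), `|h v| <= c * (dist v)%:R.
Proof.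
have [c hc] := choice letter_bounds.
exists (\sum_(i < r) c i); split; first by apply: sumr_ge0 => i _; case: (hc i).
move=> i v; have [_ /(_ v)[_]] := hc i; move=> /le_trans; apply.
rewrite ler_wpM2r// (bigD1 i)//= lerDl; apply: sumr_ge0 => j _; by case: (hc j).
Qed.

(** The chain is at [dist] at most [n] at time [n], so the sum is dominated by that of
    [n^2 xi^n]. *)
Lemma dist_sqr_asum i : asum_fin (fun v : V i => li v * (dist v)%:R ^+ 2).
Proof.
have [C [C0 hC]] := sqr_nneseries_fin (xi01 i).
apply: (@le_lt_trans _ _ C%:E); last exact: ltry.
apply: le_trans hC.
apply: le_trans (@green_weight_le _ _ (p i) (o i) _ (hstoch i) (xi01 i)
  (fun v => (dist v)%:R ^+ 2) (fun n => n%:R ^+ 2) _ _ _).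
- apply: le_esum => v _; rewrite ger0_norm; last by rewrite mulr_ge0// exprn_ge0.
  rewrite EFinM; apply: lee_wpmul2r; first by rewrite lee_fin exprn_ge0.
  by rewrite -LiK; exact: last_visit_gf_le_green.
- by move=> v; rewrite exprn_ge0.
- by move=> n; rewrite exprn_ge0.
- by move=> n v /dist_le dn; rewrite ler_sqr ?nnegrE// ler_nat.
Qed.

Lemma len_sqr_asum i : asum_fin (fun v : V i => li v * h v ^+ 2).
Proof.
have [c [c0 hc]] := letter_len_le.
apply: asum_fin_le (asum_finZ (c ^+ 2) (dist_sqr_asum i)) => v /=.
have n1 : 0 <= li v * h v ^+ 2 by rewrite mulr_ge0// sqr_ge0.
have n2 : 0 <= c ^+ 2 * (li v * (dist v)%:R ^+ 2).
  by rewrite mulr_ge0 ?sqr_ge0// mulr_ge0// sqr_ge0.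
rewrite (ger0_norm n1) (ger0_norm n2).
rewrite [leRHS]mulrCA; apply: ler_wpM2l => //; rewrite -exprMn -(ger0_norm (sqr_ge0 (h v))) normrX.
by rewrite ler_sqr ?nnegrE// ?mulr_ge0.
Qed.

Lemma len_asum i : asum_fin (fun v : V i => li v * h v).
Proof.
apply: asum_fin_le (asum_finD (@letter_lv_asum R r V o p alpha hr hstoch hloop alpha0 alpha1 Gfin i)
  (len_sqr_asum i)) => v /=.
have n1 : 0 <= li v + li v * h v ^+ 2.
  by rewrite addr_ge0//; apply: mulr_ge0 => //; exact: sqr_ge0.
rewrite normrM (ger0_norm (li0 v)) (ger0_norm n1).
rewrite -{2}[li v]mulr1 -mulrDr; apply: ler_wpM2l => //.
have := sqr_ge0 (`|h v| - 1); rewrite -(ger0_norm (sqr_ge0 (h v))) normrX.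
by have := normr_ge0 (h v); nra.
Qed.

Definition len_mean i : R := csum (fun v : V i => li v * h v).
Definition len_sqr_mean i : R := csum (fun v : V i => li v * h v ^+ 2).
Local Notation S := (@letter_mass R r V o p alpha).

Lemma len_shift_sqr i (c : R) :
  (\esum_(v in [set: V i]) (li v * (h v + c) ^+ 2)%:E =
   (len_sqr_mean i + 2 * c * len_mean i + c ^+ 2 * S i)%:E)%E.
Proof.
have e : (fun v : V i => li v * (h v + c) ^+ 2) =
    (fun v => (li v * h v ^+ 2 + (2 * c) * (li v * h v)) + c ^+ 2 * li v).
  by apply/funext => v; ring.
have lS := @letter_lv_asum R r V o p alpha hr hstoch hloop alpha0 alpha1 Gfin i.
have A1 := asum_finZ (2 * c) (len_asum i).
have A2 := asum_finZ (c ^+ 2) lS.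
have A3 := asum_finD (len_sqr_asum i) A1.
rewrite csum_ge0E; first by rewrite e (csumD A3 A2) (csumD (len_sqr_asum i) A1)
  (csumZ _ (len_asum i)) (csumZ _ lS).
- by move=> v; rewrite mulr_ge0// sqr_ge0.
- by rewrite e; exact: asum_finD.
Qed.

Definition word_len (w : seq (letter o)) : R := \sum_(a <- w) h (val (tagged a)).

Lemma word_lv_gt0 w : 0 < word_lv p alpha w.
Proof. by apply: prodr_gt0 => a _; exact: letter_lv_gt0. Qed.

Lemma word_lenE w : word_len w = - ln (word_lv p alpha w).
Proof.
elim: w => [|a w ih]; first by rewrite /word_len /word_lv !big_nil ln1 oppr0.
rewrite /word_len /word_lv !big_cons lnM ?posrE ?letter_lv_gt0 ?word_lv_gt0//.
by rewrite opprD; congr (_ + _); exact: ih.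
Qed.

Lemma fp_lenE x : fp_len p alpha x = word_len (sval x).
Proof.
by rewrite word_lenE /fp_len -[last_visit_gf _ _ _ _]/(fp_lv p alpha x)
  (fp_lvE hstoch hloop alpha0 alpha1 Gfin).
Qed.

(** A step changes one coordinate, hence this quantity by at most one upwards. It thus bounds both
    the block length and, up to a constant, [word_len] at time [n]. *)
Definition word_dist (w : seq (letter o)) : nat := \sum_(a <- w) dist (val (tagged a)).

Lemma word_dist_wcat w i (v : V i) : word_dist (wcat w v) = (word_dist w + dist v)%N.
Proof.
have [->|vo] := eqVneq v (o i); first by rewrite wcat_root dist_root addn0.
rewrite -[v]/(val (Sub v vo : nonroot o i)) wcat_nonroot.
by rewrite /word_dist -cats1 big_cat big_seq1.
Qed.

Lemma size_le_word_dist w : (size w <= word_dist w)%N.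
Proof.
rewrite /word_dist -sum1_size; apply: leq_sum => a _.
exact: (@dist_gt0 (tag a) (val (tagged a)) (valP (tagged a))).
Qed.

Lemma word_dist_step x y : 0 < P x y -> (word_dist (sval y) <= (word_dist (sval x)).+1)%N.
Proof.
move=> /(fp_mx_gt0 alpha0) [i [e pxy]].
have [_ yE] := stem_coord i (svalP y); have [_ xE] := stem_coord i (svalP x).
by rewrite -yE -xE !word_dist_wcat e -addnS leq_add2l; exact: dist_step.
Qed.

Lemma word_dist_nstep n y : (0 < nstep P n (fp_root o) y)%E -> (word_dist (sval y) <= n)%N.
Proof.
elim: n y => [|n ih] y.
  rewrite nstep0; case: eqVneq => [<- _|]; last by rewrite ltxx.
  by rewrite /word_dist big_nil.
move=> /nstep_gt0S => /(_ (fp_mx_ge0 p0 alpha0)) [x /ih hx /word_dist_step hy].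
by rewrite (leq_trans hy).
Qed.

Lemma word_len_le : exists c : R, 0 <= c /\
  forall w, `|word_len w| <= c * (word_dist w)%:R.
Proof.
have [c [c0 hc]] := letter_len_le; exists c; split=> // w.
rewrite /word_len /word_dist natr_sum mulr_sumr.
by apply: le_trans (ler_norm_sum _ _ _) _; apply: ler_sum => a _; exact: hc.
Qed.

End letter_length.

(** * Sums over spheres of the block length *)

Section spheres.
Context {R : realType} {r : nat} {V : 'I_r -> countType} {o : forall i, V i}.
Implicit Types (x y : freeprod o) (i j : 'I_r).

(** Moving the last coordinate to its root deletes the last letter; the empty word is fixed. *)
Definition fp_pred y : freeprod o :=
  if wtype (sval y) is Some i then fp_move y (o i) else y.

Lemma sval_fp_pred (s : seq (letter o)) a (rs : reduced (rcons s a)) :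
  sval (fp_pred (exist _ (rcons s a) rs)) = s.
Proof. by rewrite /fp_pred /= wtype_rcons /= stem_rcons_eq wcat_root. Qed.

Lemma fp_move_rcons x (a : letter o) : wtype (sval x) != Some (tag a) ->
  sval (fp_move x (val (tagged a))) = rcons (sval x) a.
Proof. by move=> h /=; rewrite stem_neq// wcat_nonroot; case: a h. Qed.

(** Words are grouped by their prefix [x]; the admissible last letters are those whose type differs
    from the type of [x]. *)
Lemma esum_sphereS (f : freeprod o -> \bar R) k : (forall x, 0 <= f x)%E ->
  (\esum_(y in [set y : freeprod o | block_length y = k.+1]) f y =
   \esum_(x in [set x : freeprod o | block_length x = k])
     \sum_(j < r | Some j != wtype (sval x))
       \esum_(v in [set: V j]) (if v == o j then 0 else f (fp_move x v)))%E.
Proof.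
move=> f0; rewrite (esum_fiber fp_pred)//.
rewrite [RHS]esum_mkcond; apply: eq_esum => x _.
have [/set_mem /= xk|xk] := boolP (x \in _); last first.
  apply: esum1 => y [/= yk xE]; exfalso; move/negP: xk; apply; apply: mem_set => /=.
  rewrite -xE; case: y yk {xE} => s rs /=; case/lastP: s rs => // s a rs.
  by rewrite /block_length sval_fp_pred /= size_rcons => -[].
pose F (a : letter o) : \bar R :=
  if Some (tag a) != wtype (sval x) then f (fp_move x (val (tagged a))) else 0%E.
pose F' j (v : V j) : \bar R :=
  if Some j != wtype (sval x) then if v == o j then 0%E else f (fp_move x v) else 0%E.
transitivity (\esum_(a in [set: letter o]) F a)%E; last first.
  rewrite (@esum_letter _ _ _ _ _ F').
  - rewrite [RHS]big_mkcond; apply: eq_bigr => j _.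
    rewrite /F'; case: ifP => _ //; exact: esum1.
  - by move=> a; rewrite /F; case: ifP.
  - by move=> i; rewrite /F' eqxx; case: ifP.
  - move=> a; rewrite /F /F'; case: ifP => // _.
    by rewrite ifN//; exact: valP (tagged a).
transitivity (\esum_(a in [set a : letter o | Some (tag a) != wtype (sval x)])
    f (fp_move x (val (tagged a))))%E; last first.
  rewrite esum_mkcond; apply: eq_esum => a _; rewrite /F.
  case: ifPn => [/set_mem /= ->//|na]; rewrite ifN//.
  by apply: contra na => ha; apply: mem_set.
apply: reindex_esum; split => /=.
- move=> a ha; have e := @fp_move_rcons x a; rewrite eq_sym in e; have {}e := e ha.
  split; first by rewrite /= /block_length e size_rcons -xk.
  have re : reduced (rcons (sval x) a) by rewrite -e; exact: (svalP (fp_move x (val (tagged a)))).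
  have -> : fp_move x (val (tagged a)) = exist (fun w => is_true (reduced w)) _ re.
    exact: val_inj.
  by apply: val_inj; exact: sval_fp_pred.
- move=> a a' /set_mem /= ha /set_mem /= ha' /(congr1 sval).
  by rewrite !fp_move_rcons 1?eq_sym// => /rcons_inj[].
- move=> [s rs] [/= sk sx]; move: rs sk sx; case/lastP: s => // s a rs sk sx.
  have sE : s = sval x by rewrite -sx sval_fp_pred.
  have ha : Some (tag a) != wtype (sval x).
    by move: (rs); rewrite reduced_rcons -sE eq_sym => /andP[].
  exists a => //; apply: val_inj; apply: etrans (fp_move_rcons _) _.
    by rewrite eq_sym.
  by rewrite -sE.
Qed.


(** * The martingale on spheres, from the algebraic relations between letter sums alone *)

Variables (li h : forall i, V i -> R) (w b S a m : 'I_r -> R) (B W mbar : R).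
Arguments li : clear implicits.
Arguments h : clear implicits.
Hypothesis li0 : forall i v, 0 <= li i v.
Hypothesis lio : forall i, li i (o i) = 1.
Hypothesis ho : forall i, h i (o i) = 0.
Hypothesis liS : forall i, (\esum_(v in [set: V i]) (li i v)%:E = (S i)%:E)%E.
Hypothesis lih : forall i c, (\esum_(v in [set: V i]) (li i v * (h i v + c) ^+ 2)%:E =
  (a i + 2 * c * m i + c ^+ 2 * S i)%:E)%E.
Hypothesis w_gt0 : forall i, 0 < w i.
Hypothesis B_gt0 : 0 < B.
Hypothesis b_sum : \sum_(i < r) b i = B.
Hypothesis wE : forall i, w i = B - b i.
Hypothesis wS : forall i, w i * (S i - 1) = b i.
Hypothesis WE : W = \sum_(i < r) w i * b i.
Hypothesis mbarE : mbar * W = \sum_(i < r) w i ^+ 2 * m i.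

Definition weight (s : seq (letter o)) : R := \prod_(g <- s) li (tag g) (val (tagged g)).
Definition height (s : seq (letter o)) : R := \sum_(g <- s) h (tag g) (val (tagged g)).

Lemma weight_ge0 s : 0 <= weight s.
Proof. by apply: prodr_ge0 => g _. Qed.

Lemma weight_wcat s i (v : V i) : weight (wcat s v) = weight s * li i v.
Proof.
have [->|vo] := eqVneq v (o i); first by rewrite wcat_root lio mulr1.
rewrite -[v]/(val (Sub v vo : nonroot o i)) wcat_nonroot.
by rewrite /weight -cats1 big_cat big_seq1.
Qed.

Lemma height_wcat s i (v : V i) : height (wcat s v) = height s + h i v.
Proof.
have [->|vo] := eqVneq v (o i); first by rewrite wcat_root ho addr0.
rewrite -[v]/(val (Sub v vo : nonroot o i)) wcat_nonroot.
by rewrite /height -cats1 big_cat big_seq1.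
Qed.

(* [exit_at] and [corr] solve the mean and Poisson equations of the Markov chain of types,
   started at the type [None] of the empty word. *)
Definition exit_at (oi : option 'I_r) : R := if oi is Some i then w i else B.
Definition corr (oi : option 'I_r) : R :=
  if oi is Some i then - (w i * (m i + mbar)) / B else - mbar.

Lemma exit_at_gt0 oi : 0 < exit_at oi. Proof. by case: oi. Qed.

Lemma exit_at_sum oi : \sum_(j < r | Some j != oi) b j = exit_at oi.
Proof.
case: oi => [i|] /=; last by rewrite b_sum.
by rewrite wE -b_sum [in RHS](bigD1 i)//= addrAC subrr add0r.
Qed.

(** If the sum of [w j * m j + b j * corr (Some j)] over all [j] is 0, the equation at type [i] can
    be solved for [corr (Some i)], which gives its definition; that sum vanishes by the choice of
    [mbar]. At the empty word no type is excluded, which forces [corr None = - mbar]. *)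
Lemma corr_poisson oi :
  \sum_(j < r | Some j != oi) (w j * m j + b j * (corr (Some j) - corr oi - mbar)) = 0.
Proof.
have Bn : B != 0 by rewrite gt_eqF.
have K0 : \sum_(j < r) (w j * m j + b j * corr (Some j)) = 0.
  transitivity (\sum_(j < r) (B^-1 * (w j ^+ 2 * m j) - B^-1 * mbar * (w j * b j))).
    apply: eq_bigr => j _ /=.
    have -> : w j ^+ 2 * m j = w j * (B - b j) * m j by rewrite expr2 {2}wE.
    by field.
  by rewrite sumrB -!mulr_sumr -WE -mbarE; field.
transitivity (\sum_(j < r | Some j != oi) (w j * m j + b j * corr (Some j)) -
   (corr oi + mbar) * \sum_(j < r | Some j != oi) b j).
  by rewrite mulr_sumr -sumrB; apply: eq_bigr => j _; ring.
rewrite exit_at_sum; case: oi => [i|]; last by rewrite K0 /= addNr mul0r subrr.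
have -> : \sum_(j < r | Some j != Some i) (w j * m j + b j * corr (Some j)) =
    - (w i * m i + b i * corr (Some i)).
  by apply/eqP; rewrite -addr_eq0 addrC -[X in X == 0](bigD1 i (P := predT))// K0.
have -> : exit_at (Some i) = B - b i by rewrite -wE.
have -> : w i * m i = - B * corr (Some i) - w i * mbar by rewrite /=; field.
by rewrite wE; ring.
Qed.

Lemma esum_off_root i (f : V i -> R) (c : R) : (forall v, 0 <= f v) ->
  (\esum_(v in [set: V i]) (f v)%:E = c%:E)%E ->
  (\esum_(v in [set: V i]) (if v == o i then 0 else (f v)%:E) = (c - f (o i))%:E)%E.
Proof.
move=> f0; rewrite (esumID [set o i]); last by move=> v _; rewrite lee_fin.
rewrite setTI esum_set1 ?lee_fin// => e.
have -> : (\esum_(v in [set: V i]) (if v == o i then 0 else (f v)%:E) =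
    \esum_(v in [set: V i] `&` ~` [set o i]) (f v)%:E)%E.
  rewrite esum_mkcondr; apply: eq_esum => v _; rewrite in_setC in_set1.
  by case: eqP.
by rewrite EFinB -e [X in (X - _)%E]addeC addeK.
Qed.

Definition sphere_sum k (phi : freeprod o -> R) : \bar R :=
  (\esum_(x in [set x : freeprod o | block_length x = k])
    (weight (sval x) * exit_at (wtype (sval x)) * phi x)%:E)%E.

(** A new letter of type [j] multiplies [weight] by its [li] and replaces the exit weight of [x] by
    [w j], so only the letter sum [psi] depends on [phi]. *)
Lemma sphere_sumS k phi (psi : freeprod o -> 'I_r -> R) : (forall x, 0 <= phi x) ->
  (forall x j, Some j != wtype (sval x) ->
    \esum_(v in [set: V j]) (if v == o j then 0 else (li j v * phi (fp_move x v))%:E)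
    = (psi x j)%:E)%E ->
  (sphere_sum k.+1 phi = \esum_(x in [set x : freeprod o | block_length x = k])
    (weight (sval x) * \sum_(j < r | Some j != wtype (sval x)) w j * psi x j)%:E)%E.
Proof.
move=> phi0 psiE; rewrite /sphere_sum esum_sphereS; last first.
  by move=> x; rewrite lee_fin !mulr_ge0 ?weight_ge0// ltW// exit_at_gt0.
apply: eq_esum => x _; rewrite mulr_sumr -sumEFin; apply: eq_bigr => j jx.
rewrite mulrA EFinM -psiE// -esumZl.
- apply: eq_esum => v _; case: eqVneq => vo; first by rewrite mule0.
  have sx : sval (fp_move x v) = wcat (sval x) v by rewrite /= stem_neq// eq_sym.
  rewrite sx weight_wcat -EFinM; congr EFin.
  have -> : wtype (wcat (sval x) v) = Some j.
    by rewrite -[v]/(val (Sub v vo : nonroot o j)) wcat_nonroot wtype_rcons.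
  by rewrite /=; ring.
- by rewrite lee_fin mulr_ge0 ?weight_ge0// ltW.
- by move=> v; case: ifP => // _; rewrite lee_fin mulr_ge0.
Qed.

Let sphere0 : [set x : freeprod o | block_length x = 0%N] = [set fp_root o].
Proof.
apply/seteqP; split => [x /= /size0nil e|x ->//]; exact: val_inj.
Qed.

(** Conservation of mass: appending letters of type [j] turns the exit weight into
    [w j * (S j - 1) = b j], and these add up to the former exit weight. Divided by [B], the weights
    form the law of the prefix of length [k] of the limit word. *)
Lemma sphere_mass k : sphere_sum k (fun=> 1) = B%:E.
Proof.
elim: k => [|k ih].
  rewrite /sphere_sum sphere0 esum_set1 /= /weight big_nil ?mul1r ?mulr1//.
  by rewrite lee_fin ltW.
rewrite (@sphere_sumS _ _ (fun _ j => S j - 1))//.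
  rewrite -ih; apply: eq_esum => x _; rewrite mulr1 -exit_at_sum.
  by under eq_bigr do rewrite wS.
move=> x j _; have := @esum_off_root j (fun v => li j v * 1) (S j).
rewrite lio mulr1; apply=> [v|]; first by rewrite mulr1.
by rewrite -liS; apply: eq_esum => v _; rewrite mulr1.
Qed.

Definition defect k x : R := height (sval x) + corr (wtype (sval x)) - k%:R * mbar.

Lemma sphere_defect : exists C : R, 0 <= C /\
  forall k, (sphere_sum k (fun x => defect k x ^+ 2)%R <= (C * k.+1%:R)%:E)%E.
Proof.
(* [d] is the part of the increment of the defect that depends on the types alone, [sg] the second
   moment of the whole increment times the exit weight. As there are finitely many types, [C1]
   bounds their ratio uniformly. *)
pose d oi j := corr (Some j) - corr oi - mbar.
pose sg oi := \sum_(j < r | Some j != oi)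
  (w j * a j + 2 * d oi j * (w j * m j) + d oi j ^+ 2 * b j).
pose C1 := \sum_(oi : option 'I_r) `|sg oi| / exit_at oi.
have C1_0 : 0 <= C1.
  by apply: sumr_ge0 => oi _; rewrite divr_ge0// ltW// exit_at_gt0.
have sgC oi : sg oi <= C1 * exit_at oi.
  rewrite -ler_pdivrMr ?exit_at_gt0//; apply: (@le_trans _ _ (`|sg oi| / exit_at oi)).
    by rewrite ler_wpM2r ?invr_ge0 ?ler_norm// ltW// exit_at_gt0.
  rewrite /C1 (bigD1 oi)//= lerDl; apply: sumr_ge0 => oj _.
  by rewrite divr_ge0// ltW// exit_at_gt0.
have step k : (sphere_sum k.+1 (fun x => defect k.+1 x ^+ 2)%R <=
    sphere_sum k (fun x => defect k x ^+ 2)%R + (C1 * B)%:E)%E.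
  pose e x j := defect k x + d (wtype (sval x)) j.
  rewrite (@sphere_sumS _ _ (fun x j => a j + 2 * e x j * m j + e x j ^+ 2 * S j - e x j ^+ 2)).
  - rewrite EFinM -(sphere_mass k) /sphere_sum -esumZl ?lee_fin//; last first.
      by move=> x; rewrite lee_fin !mulr_ge0 ?weight_ge0// ltW// exit_at_gt0.
    rewrite -esumD; last 2 first.
    + move=> x _; rewrite lee_fin; apply: mulr_ge0; last exact: sqr_ge0.
      by rewrite mulr_ge0 ?weight_ge0// ltW// exit_at_gt0.
    + by move=> x _; rewrite mule_ge0 ?lee_fin// !mulr_ge0 ?weight_ge0// ltW// exit_at_gt0.
    apply: le_esum => x _; rewrite -EFinM -EFinD lee_fin mulr1.
    set oi := wtype (sval x); set c := defect k x.
    (* Expanding the square around [c], the cross term [2 * c] has coefficient 0 by [corr_poisson]: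
       the defect is a martingale, and only the variance of the increment is added. *)
    have -> : \sum_(j < r | Some j != oi) w j * (a j + 2 * e x j * m j + e x j ^+ 2 * S j - e x j ^+ 2)
        = c ^+ 2 * exit_at oi + sg oi.
      transitivity (\sum_(j < r | Some j != oi) (c ^+ 2 * b j +
         2 * c * (w j * m j + b j * d oi j) +
         (w j * a j + 2 * d oi j * (w j * m j) + d oi j ^+ 2 * b j))).
        apply: eq_bigr => j _; rewrite /e -/c -/oi.
        have -> : w j * (a j + 2 * (c + d oi j) * m j + (c + d oi j) ^+ 2 * S j - (c + d oi j) ^+ 2)
          = w j * a j + 2 * (c + d oi j) * (w j * m j) + (c + d oi j) ^+ 2 * (w j * (S j - 1)) by ring.
        by rewrite wS; ring.
      by rewrite /sg !big_split/= -!mulr_sumr exit_at_sum corr_poisson mulr0 addr0.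
    rewrite [leRHS](_ : _ = weight (sval x) * (c ^+ 2 * exit_at oi + C1 * exit_at oi)); last by ring.
    by apply: ler_wpM2l; [exact: weight_ge0|rewrite lerD2l; exact: sgC].
  - by move=> x; exact: sqr_ge0.
  - move=> x j jx.
    have eE v : defect k.+1 (fp_move x v) = h j v + e x j \/ v = o j.
      have [->|vo] := eqVneq v (o j); [by right|left].
      have sx : sval (fp_move x v) = wcat (sval x) v by rewrite /= stem_neq// eq_sym.
      rewrite /defect sx height_wcat /e /d /defect.
      have -> : wtype (wcat (sval x) v) = Some j.
        by rewrite -[v]/(val (Sub v vo : nonroot o j)) wcat_nonroot wtype_rcons.
      by rewrite -natr1; ring.
    have -> : e x j ^+ 2 = li j (o j) * (h j (o j) + e x j) ^+ 2 by rewrite lio ho add0r mul1r.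
    transitivity (\esum_(v in [set: V j]) (if v == o j then 0 else
        (li j v * (h j v + e x j) ^+ 2)%:E))%E.
      by apply: eq_esum => v _; case: eqVneq => // vo; case: (eE v) => [->//|vo']; rewrite vo' eqxx in vo.
    rewrite (esum_off_root _ (lih j (e x j))) => [|v]; last by rewrite mulr_ge0// sqr_ge0.
    by rewrite lio ho add0r mul1r.
(* The value on the sphere of length 0, where the defect is [corr None = - mbar]. *)
pose C0 := B * mbar ^+ 2.
have C0_0 : 0 <= C0 by rewrite mulr_ge0 ?sqr_ge0// ltW.
exists (C0 + C1 * B); split; first by rewrite addr_ge0// mulr_ge0// ltW.
elim=> [|k ih].
  rewrite /sphere_sum sphere0 esum_set1 /= /weight /defect /height !big_nil /=; last first.
    by rewrite lee_fin; apply: mulr_ge0; [rewrite mul1r ltW|exact: sqr_ge0].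
  rewrite lee_fin mul1r mul0r subr0 add0r sqrrN mulr1 lerDl mulr_ge0// ltW//.
apply: le_trans (step k) _; apply: le_trans (leeD2r _ ih) _.
rewrite -EFinD lee_fin -[k.+2%:R]natr1 [leRHS]mulrDr mulr1 lerD2l lerDr//.
Qed.

End spheres.

(** * Discrete random variables and Markov chains *)

Section discrete_variable.
Local Open Scope ereal_scope.
Context {R : realType} {d : measure_display} {T : measurableType d}
  (Pr : probability T R) {S : countType} (Z : T -> S).
Hypothesis mZ : forall x, measurable (Z @^-1` [set x]).

Lemma discrete_preimage_measurable (A : set S) : measurable (Z @^-1` A).
Proof.
have -> : Z @^-1` A = \bigcup_x (if `[< A x >] then Z @^-1` [set x] else set0).
  apply/seteqP; split => [t /= At|t [x _]].
    by exists (Z t) => //; rewrite asboolT.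
  by case: asboolP => //= Ax ->.
apply: countable_bigcupT_measurable; first exact: countableP.
by move=> x; case: ifP.
Qed.

Lemma discrete_measurable d' (U : measurableType d') (f : S -> U) (D : set T) :
  measurable D -> measurable_fun D (fun t => f (Z t)).
Proof.
move=> mD _ B mB; apply: measurableI => //.
exact: (discrete_preimage_measurable (f @^-1` B)).
Qed.

(** Fibres are indexed through [pickle], since countable additivity runs over natural numbers; a
    number that codes no value of [Z] has an empty fibre and drops out. *)
Let F n := Z @^-1` [set x | pickle x = n].

Let mF n : measurable (F n). Proof. exact: discrete_preimage_measurable. Qed.

Let FT : \bigcup_n F n = setT.
Proof. by apply/seteqP; split => // t _; exists (pickle (Z t)). Qed.

Let Fdisj : trivIset setT F.
Proof. by move=> i j _ _ [t [/= <- <-]]. Qed.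

Let Fpickle x : F (pickle x) = Z @^-1` [set x].
Proof.
by rewrite /F; apply/seteqP; split => t /=; [move=> /(pcan_inj pickleK)|move=> ->].
Qed.

Let sum_pickle (a : nat -> \bar R) : (forall n, 0 <= a n) ->
  (forall n, F n = set0 -> a n = 0) ->
  \sum_(0 <= n <oo) a n = \esum_(x in [set: S]) a (pickle x).
Proof.
move=> a0 aF; rewrite nneseries_esumT// (esum_inj (pcan_inj (@pickleK S)))//.
move=> n hn; apply: aF; apply/seteqP; split => // t /= e; exact: (hn (Z t)).
Qed.

Lemma discrete_integral (f : S -> \bar R) : (forall x, 0 <= f x) ->
  \int[Pr]_t f (Z t) = \esum_(x in [set: S]) (f x * Pr (Z @^-1` [set x])).
Proof.
move=> f0; have mfZ : measurable_fun (\bigcup_n F n) (f \o Z).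
  by apply: discrete_measurable; rewrite FT.
rewrite -FT (ge0_integral_bigcup Pr mF mfZ (fun t _ => f0 (Z t)) Fdisj) sum_pickle.
- apply: eq_esum => x _; rewrite Fpickle.
  rewrite (eq_integral (cst (f x))) => [|t]; last by rewrite inE /= => ->.
  by rewrite integral_cst; [|exact: mZ].
- by move=> n; apply: integral_ge0 => t _; exact: f0.
- by move=> n ->; rewrite integral_set0.
Qed.

Lemma discrete_measure (A : set T) : measurable A ->
  Pr A = \esum_(x in [set: S]) Pr (A `&` Z @^-1` [set x]).
Proof.
move=> mA.
have AE : A = \bigcup_n (A `&` F n) by rewrite -setI_bigcupr FT setIT.
rewrite [in LHS]AE measure_bigcup; last 2 first.
- by move=> n _; exact: measurableI.
- by move=> i j _ _ [t [[_ /= <-] [_ /= <-]]].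
rewrite (eq_eseriesl (Q := xpredT)); last by move=> n; rewrite in_setT.
rewrite sum_pickle//.
- by apply: eq_esum => x _; rewrite Fpickle.
- by move=> n ->; rewrite setI0 measure0.
Qed.

Lemma discrete_ae (A : S -> Prop) :
  (forall x, Pr (Z @^-1` [set x]) != 0 -> A x) -> {ae Pr, forall t, A (Z t)}.
Proof.
move=> hA; exists (Z @^-1` [set x | ~ A x]); split => //.
  exact: discrete_preimage_measurable.
rewrite discrete_measure; last exact: discrete_preimage_measurable.
apply: esum1 => x _; have [Ax|nAx] := pselect (A x).
  rewrite (_ : _ `&` _ = set0) ?measure0//.
  by apply/seteqP; split => // t /= [] nA e; apply: nA; rewrite e.
have [e|ne] := eqVneq (Pr (Z @^-1` [set x])) 0; last by have := hA _ ne.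
apply/eqP; rewrite eq_le measure_ge0 andbT -e; apply: le_measure => //=.
- by rewrite inE; apply: measurableI => //; exact: discrete_preimage_measurable.
- by rewrite inE.
Qed.

End discrete_variable.

(** * The law of a Markov chain at a fixed time *)

Section markov_law.
Local Open Scope ereal_scope.
Context {R : realType} {S : countType} (q : S -> S -> R) (x0 : S)
  {d : measure_display} {T : measurableType d} (Pr : probability T R)
  (X : nat -> T -> S).
Hypothesis q0 : forall x y, (0 <= q x y)%R.
Hypothesis hX : markov_chain q x0 Pr X.

Let mX n x : measurable (X n @^-1` [set x]). Proof. by have [] := hX. Qed.

Definition history n (t : T) : seq S := [seq X k t | k <- iota 0 n].

Let history_fiber n s : size s = n -> forall y0,
  history n @^-1` [set s] = \bigcap_(k in `I_n) (X k @^-1` [set nth y0 s k]).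
Proof.
move=> sn y0; apply/seteqP; split => [t /= <- k /= kn|t /= h].
  by rewrite (nth_map 0%N) ?size_iota// nth_iota.
apply: (@eq_from_nth _ y0); first by rewrite size_map size_iota sn.
move=> k; rewrite size_map size_iota => kn.
by rewrite (nth_map 0%N) ?size_iota// nth_iota//; exact: h.
Qed.

Lemma history_measurable n s : measurable (history n @^-1` [set s]).
Proof.
have [sn|sn] := eqVneq (size s) n.
  rewrite (history_fiber sn x0); apply: bigcap_measurableType => k _; exact: mX.
rewrite (_ : _ @^-1` _ = set0)//; apply/seteqP; split => // t /= e.
by move: sn; rewrite -e size_map size_iota eqxx.
Qed.

(** The Markov property speaks of complete trajectories; summing it over [history n], the values at
    times 0 to [n - 1], forgets the past. *)
Lemma markov_step n u y :
  Pr (X n.+1 @^-1` [set y] `&` X n @^-1` [set u]) =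
  Pr (X n @^-1` [set u]) * (q u y)%:E.
Proof.
have mA : measurable (X n.+1 @^-1` [set y] `&` X n @^-1` [set u]) by exact: measurableI.
rewrite (discrete_measure Pr (@history_measurable n) mA).
rewrite [in RHS](discrete_measure Pr (@history_measurable n) (mX n u)).
rewrite -esumZr ?lee_fin//; apply: eq_esum => s _.
have [sn|sn] := eqVneq (size s) n; last first.
  rewrite (_ : history n @^-1` [set s] = set0) ?setI0 ?measure0 ?mul0e//.
  by apply/seteqP; split => // t /= e; move: sn; rewrite -e size_map size_iota eqxx.
have [_ _ /(_ n (fun k => nth x0 (rcons (rcons s u) y) k))] := hX.
have nthy : nth x0 (rcons (rcons s u) y) n.+1 = y.
  by rewrite nth_rcons size_rcons sn ltnn eqxx.
have nthu : nth x0 (rcons (rcons s u) y) n = u.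
  by rewrite nth_rcons size_rcons sn ltnSn nth_rcons sn ltnn eqxx.
have nths k : (k < n)%N -> nth x0 (rcons (rcons s u) y) k = nth x0 s k.
  by move=> kn; rewrite nth_rcons size_rcons sn ltnS (ltnW kn) nth_rcons sn kn.
rewrite nthu nthy (history_fiber sn x0) => e.
have E1 : \bigcap_(k in `I_n.+1) (X k @^-1` [set nth x0 (rcons (rcons s u) y) k]) =
    X n @^-1` [set u] `&` \bigcap_(k in `I_n) (X k @^-1` [set nth x0 s k]).
  apply/seteqP; split => [t h|t [/= hn h] k /=].
    split; first by have := h n (ltnSn n); rewrite nthu.
    by move=> k /= kn; rewrite -nths//; exact: (h k (ltnW kn)).
  by rewrite ltnS leq_eqVlt => /orP[/eqP ->|kn]; [rewrite nthu|rewrite nths//; exact: h].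
have E2 : \bigcap_(k in `I_n.+2) (X k @^-1` [set nth x0 (rcons (rcons s u) y) k]) =
    X n.+1 @^-1` [set y] `&` X n @^-1` [set u] `&` \bigcap_(k in `I_n) (X k @^-1` [set nth x0 s k]).
  rewrite -setIA -E1; apply/seteqP; split => [t h|t [/= hn h] k /=].
    split; first by have := h n.+1 (ltnSn n.+1); rewrite nthy.
    by move=> k /= kn; exact: (h k (ltnW kn)).
  by rewrite ltnS leq_eqVlt => /orP[/eqP ->|kn]; [rewrite nthy|exact: h].
by move: e; rewrite E1 E2.
Qed.

Lemma markov_law n y : Pr (X n @^-1` [set y]) = nstep q n x0 y.
Proof.
elim: n y => [|n ih] y.
  have [_ h0 _] := hX; have {}h0 : Pr (X 0%N @^-1` [set x0]) = 1 by exact: h0.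
  rewrite nstep0; have [<-|xy] := eqVneq x0 y; first exact: h0.
  have : Pr (X 0%N @^-1` [set x0] `|` X 0%N @^-1` [set y]) <= 1.
    by apply: probability_le1; exact: measurableU.
  rewrite (measureU Pr (mX 0%N x0) (mX 0%N y)); last first.
    by apply/seteqP; split => // t [/= -> e]; move: xy; rewrite e eqxx.
  move=> hle; have : 1 + Pr (X 0%N @^-1` [set y]) <= 1.
    by rewrite -[X in X + _]h0; exact: hle.
  rewrite -[leRHS]adde0 leeD2lE// => h.
  by apply/eqP; rewrite eq_le h measure_ge0.
rewrite nstepS// (discrete_measure Pr (mX n) (mX n.+1 y)).
by apply: eq_esum => u _; rewrite markov_step ih.
Qed.

End markov_law.

(** * Entropy and rate of escape *)

Section entropy_limit.
Context {R : realType} {S : countType} {d : measure_display} {T : measurableType d}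
  (Pr : probability T R) (X : nat -> T -> S).
(** The free product enters only through these data: [M] is [L(o,x|1)], [g] is [G(o,o|1)], [bl] the
    block length, [c] the bounded solution of the Poisson equation, and [C] the linear growth rate
    of [len]. *)
Variables (pi : nat -> S -> R) (M len c : S -> R) (bl : S -> nat).
Variables (g C C3 C4 C5 mbar ell ell0 : R).
Hypothesis mX : forall n x, measurable (X n @^-1` [set x]).
Hypothesis piE : forall n x, Pr (X n @^-1` [set x]) = (pi n x)%:E.
Hypothesis pi0 : forall n x, 0 <= pi n x.
Hypothesis M0 : forall x, 0 < M x.
Hypothesis lenE : forall x, len x = - ln (M x).
Hypothesis g1 : 1 <= g.
Hypothesis C0 : 0 <= C.
Hypothesis C30 : 0 <= C3.
Hypothesis C40 : 0 <= C4.
Hypothesis C50 : 0 <= C5.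
Hypothesis supp_bl : forall n x, pi n x != 0 -> (bl x <= n)%N.
Hypothesis supp_len : forall n x, pi n x != 0 -> `|len x| <= C * n%:R.
Hypothesis green_sum : forall x, (\sum_(0 <= n <oo) (pi n x)%:E = (g * M x)%:E)%E.
Hypothesis sphere_le : forall k,
  (\esum_(x in [set x | bl x = k]) (M x)%:E <= C3%:E)%E.
Hypothesis c_le : forall x, `|c x| <= C4.
Let y x := len x + c x - (bl x)%:R * mbar.
Hypothesis sphere_sqr_le : forall k,
  (\esum_(x in [set x | bl x = k]) (M x * y x ^+ 2)%:E <= (C5 * k.+1%:R)%:E)%E.
Hypothesis hell0 : {ae Pr, forall t : T,
  (fun n : nat => (bl (X n t))%:R / n%:R : R) @ \oo --> ell0}.
Hypothesis hell : {ae Pr, forall t : T,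
  (fun n : nat => len (X n t) / n%:R : R) @ \oo --> ell}.

Let mfX n (f : S -> R) : measurable_fun setT (fun t => (f (X n t))%:E).
Proof. exact: (@discrete_measurable _ _ _ (X n) (mX n) _ _ (fun x => (f x)%:E)). Qed.

Let EX n (f : S -> R) : \bar R := (\int[Pr]_t (f (X n t))%:E)%E.

Let EXE n f : (forall x, 0 <= f x) ->
  EX n f = (\esum_(x in [set: S]) (f x * pi n x)%:E)%E.
Proof.
move=> f0; rewrite /EX (discrete_integral Pr (mX n) (f := fun x => (f x)%:E)).
  by apply: eq_esum => x _; rewrite piE EFinM.
by move=> x; rewrite lee_fin.
Qed.

Let EX_le n (f h : S -> R) : (forall x, 0 <= f x) -> (forall x, 0 <= h x) ->
  (forall x, pi n x != 0 -> f x <= h x) -> (EX n f <= EX n h)%E.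
Proof.
move=> f0 h0 fh; rewrite !EXE//; apply: le_esum => x _; rewrite lee_fin.
have [->|px] := eqVneq (pi n x) 0; first by rewrite !mulr0.
by rewrite ler_wpM2r// fh.
Qed.

Let EXD n (f h : S -> R) : (forall x, 0 <= f x) -> (forall x, 0 <= h x) ->
  EX n (fun x => f x + h x) = (EX n f + EX n h)%E.
Proof.
move=> f0 h0; rewrite !EXE// => [|x]; last exact: addr_ge0.
rewrite -esumD; do ?by move=> x _; rewrite lee_fin mulr_ge0.
by apply: eq_esum => x _; rewrite mulrDl EFinD.
Qed.

Let EX_cst n k : EX n (fun=> k) = k%:E.
Proof. by rewrite /EX integral_cst//= probability_setT mule1. Qed.

Let ae_supp : {ae Pr, forall t n, pi n (X n t) != 0}.
Proof.
apply/ae_foralln => n.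
apply: (@discrete_ae _ _ _ Pr _ _ (mX n) (fun x => pi n x != 0)) => x.
by rewrite piE; apply: contra => /eqP ->.
Qed.

(* Off the support of [pi n] the bounds on [len] fail and [ln (pi n x)] is the junk
   value [ln 0 = 0]. *)
Let trunc n (f : S -> R) x : R := if pi n x == 0 then 0 else f x.

Let DCT (f : nat -> S -> R) (K l : R) : 0 <= K ->
  (forall n x, pi n x != 0 -> `|f n x| <= K) ->
  {ae Pr, forall t, (fun n => f n (X n t)) @ \oo --> l} ->
  (fun n => EX n (trunc n (f n))) @ \oo --> l%:E.
Proof.
move=> K0 fK cvf.
have [|||||_ _] := @dominated_convergence _ _ _ Pr setT measurableT
  (fun n t => (trunc n (f n) (X n t))%:E) (cst l%:E) (cst K%:E).
- by move=> n; exact: mfX.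
- exact: measurable_cst.
- have := ae_supp; apply: filterS2 cvf => t ft st _ /=.
  apply/fine_cvgP; split; first by apply: nearW.
  rewrite [X in X @ _ --> _](_ : _ = (fun n => f n (X n t)))//.
  by apply/funext => n /=; rewrite /trunc (negbTE (st n)).
- exact: finite_measure_integrable_cst.
- apply: aeW => t n _ /=; rewrite lee_fin /trunc; case: ifPn => h.
    by rewrite normr0.
  exact: fK.
- by rewrite integral_cst//= probability_setT mule1.
Qed.

Let pi_le n x : pi n x <= g * M x.
Proof.
rewrite -lee_fin -green_sum.
apply: le_trans (nneseries_lim_ge n.+1 _); last by move=> k _ _; rewrite lee_fin.
by rewrite big_nat_recr//= leeDr// sume_ge0// => k _; rewrite lee_fin.
Qed.

Let pi_le1 n x : pi n x <= 1.
Proof. by rewrite -lee_fin -piE; apply: probability_le1. Qed.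

(** The shift by [C] makes the rate nonnegative on the support of [pi n], so that extended
    expectations may be added. At [n = 0] the quotient is 0. *)
Let Lrate n x := len x / n%:R + C.

Let supp_rate n x : pi n x != 0 -> `|len x / n%:R| <= C.
Proof.
move=> px; have [->|n0] := eqVneq n 0%N; first by rewrite invr0 mulr0 normr0.
rewrite normrM normfV normr_nat ler_pdivrMr ?ltr0n ?lt0n//.
exact: supp_len.
Qed.

Let A_cvg : (fun n => EX n (trunc n (Lrate n))) @ \oo --> (ell + C)%:E.
Proof.
apply: (@DCT _ (C + C)); first exact: addr_ge0.
  by move=> n x px; rewrite (le_trans (ler_normD _ _))// lerD ?supp_rate// ger0_norm.
by apply: filterS hell => t ht; apply: cvgD => //; exact: cvg_cst.
Qed.

Let trunc_rate_ge0 n x : 0 <= trunc n (Lrate n) x.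
Proof.
rewrite /trunc; case: ifPn => // px; have := supp_rate px.
by rewrite /Lrate ler_norml => /andP[h _]; rewrite -lerBlDr sub0r.
Qed.

(** Bounds the mass of [M] on the ball of radius [n]; the added 1 keeps [ln (Z n)] nonnegative. *)
Let Z n : R := 1 + C3 * n.+1%:R.
Let Z1 n : 1 <= Z n. Proof. by rewrite lerDl mulr_ge0. Qed.

Let ball_sum (F : S -> R) n : (forall x, 0 <= F x) ->
  (\esum_(x in [set x | (bl x < n)%N]) (F x)%:E =
   \sum_(k < n) \esum_(x in [set x | bl x = k]) (F x)%:E)%E.
Proof.
move=> F0; rewrite esum_mkcond; under [RHS]eq_bigr do rewrite esum_mkcond.
rewrite -esum_sum; last by move=> x k _ _; case: ifP => // _; rewrite lee_fin.
apply: eq_esum => x _; case: ifPn => [/set_mem /= xn|/negP xn].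
  rewrite (bigD1 (Ordinal xn))//= mem_set// big1 ?adde0// => k kx.
  rewrite ifN//; apply: contra kx => /set_mem /= e; exact/eqP/val_inj.
rewrite big1// => k _; rewrite ifN//; apply/negP => /set_mem /= e; apply: xn.
by apply: mem_set; rewrite /= e.
Qed.

Let ball_le n : (\esum_(x in [set x | (bl x < n.+1)%N]) (M x)%:E <= (Z n)%:E)%E.
Proof.
rewrite ball_sum; last by move=> x; exact: ltW.
apply: (@le_trans _ _ (\sum_(k < n.+1) C3%:E)%E); first by apply: lee_sum => k _.
by rewrite sumEFin lee_fin sumr_const card_ord /Z mulr_natr lerDr.
Qed.

Let ent n x : R := - ln (pi n x).

Let ent_ge0 n x : 0 <= ent n x. Proof. by rewrite oppr_ge0 ln_le0. Qed.

Let scal_ent n x : R := n%:R^-1 * ent n x.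

Let scal_ent_ge0 n x : 0 <= scal_ent n x.
Proof. by rewrite mulr_ge0// ?invr_ge0. Qed.

Let lower n : (EX n (trunc n (Lrate n)) <= EX n (scal_ent n) + (C + n%:R^-1 * ln g)%:E)%E.
Proof.
have gg : 0 <= C + n%:R^-1 * ln g by rewrite addr_ge0// mulr_ge0// ?invr_ge0// ln_ge0.
rewrite -(EX_cst n) -EXD//; apply: EX_le => // [x|x px]; first by rewrite addr_ge0.
have g0 : 0 < g by exact: lt_le_trans g1.
have p0 : 0 < pi n x by rewrite lt_neqAle eq_sym px pi0.
rewrite /trunc (negbTE px) /Lrate /scal_ent [leLHS]addrC [leRHS]addrCA lerD2l -mulrDr [len x / _]mulrC.
rewrite ler_wpM2l ?invr_ge0// lenE /ent.
have : ln (pi n x) <= ln (g * M x) by rewrite ler_ln ?posrE ?mulr_gt0.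
by rewrite lnM ?posrE//; lra.
Qed.

(* Gibbs' inequality against [M] restricted to the ball of radius [n], whose total
   mass grows only linearly in [n]. *)
Let upper n : (EX n (scal_ent n) + C%:E <=
  EX n (trunc n (Lrate n)) + (n%:R^-1 * (ln (Z n) + 1))%:E)%E.
Proof.
pose mu x := if (bl x <= n)%N then M x / Z n else 0.
have Zp : 0 < Z n by exact: lt_le_trans (Z1 n).
have mu0 x : 0 <= mu x by rewrite /mu; case: ifP => // _; rewrite divr_ge0// ltW.
(* Where [pi n x = 0] the quotient is 0 by convention, so mass of [mu] may be lost and [Erho] is
   only an inequality. *)
pose rho x := n%:R^-1 * (mu x / pi n x).
have rho0 x : 0 <= rho x by rewrite mulr_ge0 ?invr_ge0// divr_ge0.
have Erho : (EX n rho <= (n%:R^-1)%:E)%E.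
  rewrite EXE//.
  apply: (@le_trans _ _ (\esum_(x in [set: S]) ((n%:R^-1)%:E * (mu x)%:E))%E).
    apply: le_esum => x _; rewrite -EFinM lee_fin /rho -mulrA ler_wpM2l ?invr_ge0//.
    have [->|px] := eqVneq (pi n x) 0; first by rewrite mulr0.
    by rewrite divfK.
  rewrite esumZl ?lee_fin ?invr_ge0//.
  rewrite -[leRHS]mule1; apply: lee_wpmul2l; first by rewrite lee_fin invr_ge0.
  have -> : (\esum_(x in [set: S]) (mu x)%:E =
     \esum_(x in [set x | (bl x < n.+1)%N]) (((Z n)^-1)%:E * (M x)%:E))%E.
    rewrite [RHS]esum_mkcond; apply: eq_esum => x _; rewrite /mu.
    case: ifPn => h; first by rewrite ifT ?mem_set// -EFinM mulrC.
    by rewrite ifN//; apply: contra h => /set_mem.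
  rewrite esumZl ?lee_fin ?invr_ge0 ?(ltW Zp)//; last by move=> x; rewrite lee_fin ltW.
  apply: (@le_trans _ _ (((Z n)^-1)%:E * (Z n)%:E)%E).
    by apply: lee_wpmul2l; [rewrite lee_fin invr_ge0 ltW|exact: ball_le].
  by rewrite -EFinM mulVf// gt_eqF.
have lZ : 0 <= n%:R^-1 * ln (Z n) by rewrite mulr_ge0 ?invr_ge0// ln_ge0.
rewrite mulrDr mulr1 [in leRHS]EFinD addeA.
apply: (@le_trans _ _ (EX n (trunc n (Lrate n)) + (n%:R^-1 * ln (Z n))%:E + EX n rho)%E); last first.
  by rewrite leeD2l.
rewrite -(EX_cst n C) -[(n%:R^-1 * ln (Z n))%:E](EX_cst n) -!EXD//; last first.
  by move=> x; rewrite addr_ge0.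
apply: EX_le => [x|x|x px]; rewrite ?addr_ge0// ?addr_ge0//.
have p0 : 0 < pi n x by rewrite lt_neqAle eq_sym px pi0.
rewrite /trunc (negbTE px) /Lrate /scal_ent /rho /mu supp_bl//.
rewrite [len x / _]mulrC [_ + C + _]addrAC [_ + C + _]addrAC lerD2r -!mulrDr.
rewrite ler_wpM2l ?invr_ge0// /ent lenE.
set s := M x / Z n / pi n x.
have s0 : 0 < s by rewrite !divr_gt0.
(* Using [ln s <= s] rather than [ln s <= s - 1] costs the 1 added to [ln (Z n)]. *)
have : ln s <= s by rewrite ltW// ln_sublinear.
rewrite {1}/s !lnM ?posrE ?invr_gt0 ?divr_gt0// !lnV ?posrE//.
by lra.
Qed.

Let EXe n : EX n (scal_ent n) \is a fin_num.
Proof.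
have An : (EX n (trunc n (Lrate n)) < +oo)%E.
  apply: (@le_lt_trans _ _ (EX n (fun=> C + C))); last by rewrite EX_cst ltry.
  apply: EX_le => // [x|x px]; first by rewrite addr_ge0.
  rewrite /trunc (negbTE px) /Lrate lerD2r.
  by apply: le_trans (supp_rate px); rewrite ler_norm.
rewrite ge0_fin_numE; last by apply: integral_ge0 => t _; rewrite lee_fin.
apply: (@le_lt_trans _ _ (EX n (scal_ent n) + C%:E)%E); first by rewrite leeDl.
by apply: le_lt_trans (upper n) _; rewrite lte_add_pinfty// ltry.
Qed.

Let invn_cvg0 : (fun n : nat => n%:R^-1 : R) @ \oo --> (0 : R).
Proof. by apply/gtr0_cvgV0; [exact: nbhs_infty_gtr|exact: cvgr_idn]. Qed.

Let lnZ_cvg0 : (fun n : nat => n%:R^-1 * (ln (Z n) + 1) : R) @ \oo --> (0 : R).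
Proof.
apply/cvgr0Pnorm_lt => e e0.
pose D := 1 + 2 * C3; have D0 : 0 < D by rewrite ltr_wpDr// mulr_ge0.
(* From [ln Z <= Z / K + ln K]: as [Z n / n <= D], this [K] makes the first term less than [e / 2]
   after division by [n], and the second tends to 0. *)
pose K := 1 + 2 * D / e.
have K1 : 1 <= K by rewrite lerDl divr_ge0// ?mulr_ge0// ltW.
have K0 : 0 < K by exact: lt_le_trans K1.
have DK : D / K < e / 2.
  rewrite ltr_pdivrMr// /K mulrDr mulr1.
  have -> : e / 2 * (2 * D / e) = D by field; rewrite gt_eqF.
  by rewrite ltrDr divr_gt0.
have e2 : 0 < e / 2 by rewrite divr_gt0.
have hK : (fun n : nat => n%:R^-1 * (ln K + 1) : R) @ \oo --> (0 : R).
  by rewrite -[X in _ --> X](mul0r (ln K + 1)); apply: cvgM => //; exact: cvg_cst.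
have small := (cvgr0Pnorm_lt _).1 hK _ e2.
near=> n.
have n0 : 0 < n%:R :> R by near: n; exact: nbhs_infty_gtr.
have Zp : 0 < Z n by exact: lt_le_trans (Z1 n).
have lZ : 0 <= ln (Z n) by rewrite ln_ge0.
rewrite ger0_norm; last by rewrite mulr_ge0 ?invr_ge0 ?addr_ge0// ltW.
have h1 : ln (Z n) <= Z n / K + ln K.
  have -> : ln (Z n) = ln (Z n / K) + ln K.
    by rewrite lnM ?posrE ?invr_gt0// lnV ?posrE// subrK.
  by rewrite lerD2r ltW// ln_sublinear// divr_gt0.
have h2 : n%:R^-1 * Z n <= D.
  rewrite ler_pdivrMl// /Z /D -natr1.
  have n1 : 1 <= n%:R :> R by rewrite ler1n -(ltr0n R).
  rewrite -subr_ge0.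
  have -> : n%:R * (1 + 2 * C3) - (1 + C3 * (n%:R + 1)) = (n%:R - 1) * (1 + C3) by ring.
  by rewrite mulr_ge0 ?subr_ge0 ?addr_ge0.
have h3 : n%:R^-1 * (ln K + 1) < e / 2.
  by apply: le_lt_trans (ler_norm _) _; near: n; exact: small.
apply: (@le_lt_trans _ _ (n%:R^-1 * Z n / K + n%:R^-1 * (ln K + 1))).
  rewrite -mulrA -mulrDr ler_wpM2l ?invr_ge0 ?(ltW n0)// addrA lerD2r//.
rewrite [ltRHS](_ : e = e / 2 + e / 2); last by field.
apply: ler_ltD => //; apply: le_trans (ltW DK).
by rewrite ler_wpM2r// invr_ge0 ltW.
Unshelve. all: by end_near. Qed.

Lemma entropy_cvg :
  (fun n => (n%:R^-1)%:E * \int[Pr]_t (- ln (pi n (X n t)))%:E)%E @ \oo --> ell%:E.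
Proof.
have -> : (fun n => (n%:R^-1)%:E * \int[Pr]_t (- ln (pi n (X n t)))%:E)%E =
    (fun n => EX n (scal_ent n)).
  apply/funext => n; rewrite -ge0_integralZl_EFin ?invr_ge0//.
  - by move=> t _; rewrite lee_fin; exact: ent_ge0.
  - exact: (mfX n (ent n)).
have [_ Acvg] := (fine_cvgP _ _).1 A_cvg.
apply/fine_cvgP; split; first by apply: nearW => n; exact: EXe.
have Af n : EX n (trunc n (Lrate n)) \is a fin_num.
  rewrite ge0_fin_numE; last by apply: integral_ge0 => t _; rewrite lee_fin.
  apply: le_lt_trans (lower n) _.
  by rewrite lte_add_pinfty ?ltry// -ge0_fin_numE// integral_ge0// => t _; rewrite lee_fin.
pose al n := fine (EX n (trunc n (Lrate n))).
have alE n : EX n (trunc n (Lrate n)) = (al n)%:E by rewrite fineK.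
have eE n : EX n (scal_ent n) = (fine (EX n (scal_ent n)))%:E by rewrite fineK.
apply: (@squeeze_cvgr _ _ _ _ (fun n => al n - (C + n%:R^-1 * ln g))
   (fun n => al n - C + n%:R^-1 * (ln (Z n) + 1))).
- apply: nearW => n /=; apply/andP; split.
    have := lower n; rewrite alE eE -EFinD lee_fin /=; lra.
  have := upper n; rewrite alE eE -!EFinD lee_fin /=; lra.
- rewrite [X in _ --> X](_ : _ = (ell + C) - (C + 0 * ln g)); last by ring.
  apply: cvgB; first exact: Acvg.
  by apply: cvgD; [exact: cvg_cst|apply: cvgM => //; exact: cvg_cst].
- rewrite [X in _ --> X](_ : _ = (ell + C) - C + 0); last by ring.
  by apply: cvgD => //; apply: cvgB; [exact: Acvg|exact: cvg_cst].
Qed.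

(** * Second moment of [y] along the walk *)

Let yrate n x := (y x / n%:R) ^+ 2.

Let y_cvg : (fun n => EX n (trunc n (yrate n))) @ \oo --> ((ell - ell0 * mbar) ^+ 2)%:E.
Proof.
pose D := C + C4 + `|mbar|.
have D0 : 0 <= D by rewrite !addr_ge0.
apply: (@DCT _ (D ^+ 2)); first exact: sqr_ge0.
  move=> n x px; rewrite /yrate normrX ler_sqr ?nnegrE//.
  have [->|n0] := eqVneq n 0%N; first by rewrite invr0 mulr0 normr0.
  have n1 : 1 <= n%:R :> R by rewrite ler1n lt0n.
  have np : 0 < n%:R :> R by rewrite ltr0n lt0n.
  rewrite normrM normfV normr_nat ler_pdivrMr// /y /D !mulrDl.
  apply: le_trans (ler_normB _ _) _; apply: lerD.
    apply: le_trans (ler_normD _ _) _; apply: lerD; first exact: supp_len.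
    by apply: le_trans (c_le x) _; rewrite ler_peMr.
  rewrite normrM normr_nat mulrC ler_wpM2l// ler_nat; exact: supp_bl px.
apply: filterS2 hell hell0 => t ht h0t.
have c0 : (fun n => c (X n t) * n%:R^-1) @ \oo --> (0 : R).
  apply/cvgr0Pnorm_lt => e e0.
  have hC : (fun n : nat => n%:R^-1 * C4 : R) @ \oo --> (0 : R).
    by rewrite -[X in _ --> X](mul0r C4); apply: cvgM => //; exact: cvg_cst.
  apply: filterS ((cvgr0Pnorm_lt _).1 hC _ e0) => n; apply: le_lt_trans.
  by rewrite !normrM mulrC ler_wpM2l// (ger0_norm C40).
have h : (fun n => y (X n t) / n%:R) @ \oo --> ell - ell0 * mbar.
  have -> : (fun n => y (X n t) / n%:R) = (fun n => len (X n t) / n%:R +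
     c (X n t) * n%:R^-1 - (bl (X n t))%:R / n%:R * mbar).
    by apply/funext => n; rewrite /y; ring.
  rewrite -[ell]addr0; apply: cvgB; first exact: cvgD.
  by apply: cvgM => //; exact: cvg_cst.
by rewrite /yrate expr2; under eq_fun do rewrite expr2; exact: cvgM.
Qed.

(** The factor [n ^+ 2] undoes the normalization. Before time [N] the walk meets only words of block
    length below [N], and its visits to [x] number at most [g * M x] on average; each of the [N]
    spheres then contributes at most [g * C5 * N]. *)
Let y_sum_le N : (\sum_(n < N) ((n%:R ^+ 2)%:E * EX n (trunc n (yrate n)))
  <= (g * C5 * N%:R ^+ 2)%:E)%E.
Proof.
have g0 : 0 <= g by exact: le_trans g1.
have F0 x : 0 <= y x ^+ 2 * (g * M x).
  by rewrite mulr_ge0 ?sqr_ge0// mulr_ge0// ltW.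
have yp n x : (0 <= (y x ^+ 2 * pi n x)%:E)%E by rewrite lee_fin mulr_ge0// sqr_ge0.
have tr0 n x : 0 <= trunc n (yrate n) x by rewrite /trunc; case: ifP => // _; exact: sqr_ge0.
apply: (@le_trans _ _ (\sum_(n < N) \esum_(x in [set x | (bl x < N)%N])
    (y x ^+ 2 * pi n x)%:E)%E).
  apply: lee_sum => n _; rewrite EXE// -esumZl ?lee_fin ?sqr_ge0//; last first.
    by move=> x; rewrite lee_fin mulr_ge0.
  rewrite [leRHS]esum_mkcond; apply: le_esum => x _.
  rewrite -EFinM; have [px|px] := eqVneq (pi n x) 0.
    by rewrite px !mulr0; case: ifP.
  rewrite mem_set /=; last exact: leq_ltn_trans (supp_bl px) (ltn_ord n).
  rewrite lee_fin /trunc (negbTE px) mulrA; apply: ler_wpM2r => //.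
  rewrite /yrate -exprMn; have [n0|n0] := eqVneq (val n) 0%N.
    by rewrite n0 mul0r expr0n /= sqr_ge0.
  by rewrite mulrC divfK// pnatr_eq0.
rewrite -esum_sum//.
apply: (@le_trans _ _ (\esum_(x in [set x | (bl x < N)%N]) (y x ^+ 2 * (g * M x))%:E)%E).
  apply: le_esum => x _; rewrite EFinM -green_sum.
  rewrite (eq_bigr (fun n : 'I_N => ((y x ^+ 2)%:E * (pi n x)%:E)%E)); last first.
    by move=> n _; rewrite EFinM.
  rewrite -ge0_sume_distrr; last by move=> n _; rewrite lee_fin.
  apply: lee_wpmul2l; first by rewrite lee_fin sqr_ge0.
  rewrite -(big_mkord predT (fun n => (pi n x)%:E)).
  by apply: nneseries_lim_ge => n _ _; rewrite lee_fin.
rewrite ball_sum//.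
apply: (@le_trans _ _ (\sum_(k < N) (g * C5 * N%:R)%:E)%E).
  apply: lee_sum => k _.
  apply: (@le_trans _ _ (g%:E * \esum_(x in [set x | bl x = k]) (M x * y x ^+ 2)%:E)%E).
    rewrite -esumZl ?lee_fin//; last by move=> x; rewrite lee_fin mulr_ge0 ?sqr_ge0// ltW.
    by apply: le_esum => x _; rewrite -EFinM lee_fin mulrC -mulrA.
  rewrite -mulrA [leRHS]EFinM; apply: lee_wpmul2l; first by rewrite lee_fin.
  apply: le_trans (sphere_sqr_le k) _; rewrite lee_fin ler_wpM2l// ler_nat; exact: ltn_ord.
by rewrite sumEFin lee_fin sumr_const card_ord expr2 mulrA [leRHS]mulr_natr.
Qed.

(* By [y_cvg], [E[y(X_n)^2]] is asymptotic to [n^2 (ell - ell0 * mbar)^2], which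
   contradicts the bound [O(N^2)] for the sum over [n < N] unless the limit is 0. *)
Lemma rate_identification : ell = ell0 * mbar.
Proof.
apply/eqP; rewrite -subr_eq0 -sqrf_eq0; apply/negPn/negP => ne0.
set q := (ell - ell0 * mbar) ^+ 2 in ne0.
have q0 : 0 < q by rewrite lt_neqAle eq_sym ne0 sqr_ge0.
have : \forall n \near \oo, ((q / 2)%:E <= EX n (trunc n (yrate n)))%E.
  have [fin_e cvg_e] := (fine_cvgP _ _).1 y_cvg.
  have h : \forall n \near \oo, q / 2 < (fine \o (fun n => EX n (trunc n (yrate n)))) n.
    by apply: (cvgr_gt q) => //; rewrite ltr_pdivrMr// ltr_pMr// ltr1n.
  apply: filterS2 fin_e h => n fe /= /ltW.
  by rewrite -lee_fin fineK.
move=> [n0 _ hn0].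
have g0 : 0 <= g by exact: le_trans g1.
(* The window [m <= n < 2 m] has [m] terms, each at least [m^2 q / 2], against the bound
   [4 g C5 m^2]; division by [m^2] leaves a bound on [m] itself. *)
have key (m : nat) : (n0 <= m)%N -> (0 < m)%N -> m%:R * (q / 2) <= g * C5 * 4.
  move=> nm m0; have mp : 0 < m%:R :> R by rewrite ltr0n.
  have := y_sum_le (m + m)%N; rewrite -(big_mkord predT (fun n =>
    ((n%:R ^+ 2)%:E * EX n (trunc n (yrate n)))%E)).
  have pos n : (0 <= (n%:R ^+ 2)%:E * EX n (trunc n (yrate n)))%E.
    rewrite mule_ge0 ?lee_fin ?sqr_ge0//; apply: integral_ge0 => t _.
    by rewrite lee_fin /trunc; case: ifP => // _; exact: sqr_ge0.
  rewrite (big_cat_nat (leq0n m) (leq_addr m m))/=.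
  move=> /(le_trans _) h.
  have : ((m%:R * (m%:R ^+ 2 * (q / 2)))%:E <= (g * C5 * (m + m)%:R ^+ 2)%:E)%E.
    apply: h; apply: (@le_trans _ _ (\sum_(m <= n < m + m)
        ((n%:R ^+ 2)%:E * EX n (trunc n (yrate n))))%E); last first.
      by rewrite leeDr// sume_ge0.
    rewrite -[m%:R * _]/(m%:R * _) mulr_natl.
    have -> : ((m%:R ^+ 2 * (q / 2)) *+ m)%:E =
        (\sum_(m <= n < m + m) ((m%:R ^+ 2)%:E * (q / 2)%:E))%E.
      by rewrite -EFinM sumEFin sumr_const_nat addnK.
    rewrite big_nat [leRHS]big_nat; apply: lee_sum => n /andP[mn _].
    apply: lee_pmul; rewrite ?lee_fin ?sqr_ge0// ?divr_ge0// ?(ltW q0)//.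
      by rewrite ler_sqr ?nnegrE// ler_nat.
    by apply: hn0 => /=; exact: leq_trans nm mn.
  rewrite lee_fin natrD => hh.
  have m2 : 0 < m%:R ^+ 2 :> R by rewrite exprn_gt0.
  rewrite -(ler_pM2r m2) [leLHS](_ : _ = m%:R * (m%:R ^+ 2 * (q / 2))); last by ring.
  by rewrite [leRHS](_ : _ = g * C5 * (m%:R + m%:R) ^+ 2)//; ring.
have : \forall m \near \oo, g * C5 * 4 / (q / 2) < m%:R :> R by exact: nbhs_infty_gtr.
move=> [n1 _ hn1]; pose m := (n0 + n1).+1.
have : g * C5 * 4 / (q / 2) < m%:R by apply: hn1 => /=; rewrite /m leqW// leq_addl.
rewrite ltr_pdivrMr ?divr_gt0// ltNge => /negP; apply; apply: key => //.
by rewrite /m leqW// leq_addr.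
Qed.

End entropy_limit.

(** Some [z > 1] gives a finite series, which dominates the series at 1 term by term. *)
Lemma green_radius_gt1 (R : realType) (S : countType) (q : S -> S -> R) :
  (forall x y, 0 <= q x y) -> (1 < green_radius q)%E ->
  forall x y, (green q x y 1 < +oo)%E.
Proof.
move=> q0 hR x y.
have : (1%:E < ereal_sup [set z%:E | z in
    [set z : R | (0 <= z)%R /\ (green q x y z < +oo)%E]])%E.
  by apply: lt_le_trans hR _; apply: ereal_inf_lbound; exists (x, y).
move=> /ereal_sup_gt[_ [z [z0 Gz] <-]]; rewrite lte_fin => z1.
apply: le_lt_trans Gz; apply: lee_nneseries => [n _ _|n _].
  by rewrite mule_ge0 ?nstep_ge0// lee_fin exprn_ge0.
apply: lee_wpmul2l; first exact: nstep_ge0.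
by rewrite lee_fin expr1n exprn_ege1// ltW.
Qed.

Theorem theorem3p7 (R : realType) (r : nat) (hr : (2 <= r)%N)
    (V : 'I_r -> countType) (o : forall i, V i)
    (p : forall i, V i -> V i -> R)
    (hnot22 : ~ (r = 2%N /\ forall i, ([set: V i] #= `I_2)%card))
    (hstoch : forall i, stochastic (p i))
    (hacc : forall i, root_accessible (p i) (o i))
    (hloop : forall i x, p i x x = 0)
    (hunif : forall i, uniformly_irreducible (p i))
    (alpha : 'I_r -> R) (halpha0 : forall i, 0 < alpha i)
    (halpha1 : \sum_(i < r) alpha i = 1)
    (d : measure_display) (T : measurableType d) (Pr : probability T R)
    (X : nat -> T -> freeprod o)
    (hX : markov_chain (@fp_mx R r V o p alpha) (fp_root o) Pr X)
    (ell0 ell : R) (hell0_pos : 0 < ell0)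
    (hell0 : {ae Pr, forall t : T,
       (fun n : nat => (block_length (X n t))%:R / n%:R : R) @ \oo --> ell0})
    (hell : {ae Pr, forall t : T,
       (fun n : nat => fp_len p alpha (X n t) / n%:R : R) @ \oo --> ell})
    (hR : (1 < green_radius (@fp_mx R r V o p alpha))%E) :
  exists h : R,
    [/\ (fun n : nat =>
           ((n%:R^-1)%:E * 'E_Pr[fun t => (- ln (law Pr X n (X n t)))%R])%E)
          @ \oo --> h%:E,
        summable [set: letter o]
          (fun g => (fp_len p alpha (fp_letter g) * pi_letter p alpha g)%:E),
        h = ell0 * csum (fun g : letter o =>
              fp_len p alpha (fp_letter g) * pi_letter p alpha g)
      & h = ell].
Proof.
have p0 i (u v : V i) : 0 <= p i u v by have [] := hstoch i.
have Gfin x := green_radius_gt1 (fp_mx_ge0 p0 halpha0) hR (fp_root o) x.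
pose li i (v : V i) := @letter_lv R r V o p alpha i v.
pose h i (v : V i) := @letter_len R r V o p alpha i v.
pose w := @exit_pr R r V o p alpha.
pose b := @branch R r V o p alpha.
pose S := @letter_mass R r V o p alpha.
pose a := @len_sqr_mean R r V o p alpha.
pose m := @len_mean R r V o p alpha.
pose B := @escape R r V o p alpha.
pose W := @branch_norm R r V o p alpha.
(* The sum of [l(g) pi(g, tau(g))] grouped by type, by the closed form in [pi_letterE]; [csumE]
   proves it. *)
pose mbar := (\sum_(i < r) w i ^+ 2 * m i) / W.
have li0 i v : 0 <= li i v by exact: (letter_lv_ge0 hstoch hloop halpha0 halpha1).
have lio i : li i (o i) = 1 by exact: (letter_lv_root hstoch hloop halpha0 halpha1).
have ho i : h i (o i) = 0 by exact: (letter_len_root hstoch hloop halpha0 halpha1).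
have liS i : (\esum_(v in [set: V i]) (li i v)%:E = (S i)%:E)%E.
  rewrite -(letter_massE hr hstoch hloop halpha0 halpha1 Gfin).
  by apply: eq_esum => v _; rewrite (letter_lvK hstoch hloop halpha0 halpha1 Gfin).
have lih i c : (\esum_(v in [set: V i]) (li i v * (h i v + c) ^+ 2)%:E =
    (a i + 2 * c * m i + c ^+ 2 * S i)%:E)%E.
  exact: (len_shift_sqr hr hstoch hacc hloop hunif halpha0 halpha1 Gfin).
have w_gt0 i : 0 < w i by exact: (exit_pr_gt0 hr hstoch hloop halpha0 halpha1 Gfin).
have B_gt0 : 0 < B by exact: (escape_gt0 hstoch hloop halpha0 halpha1 Gfin).
have b_sum : \sum_(i < r) b i = B by exact: branch_sum.
have wE i : w i = B - b i by exact: (exit_prE hstoch hloop halpha0 halpha1).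
have wS i : w i * (S i - 1) = b i by exact: (exit_pr_mass hr hstoch hloop halpha0 halpha1 Gfin).
have W_gt0 : 0 < W by exact: (branch_norm_gt0 hr hstoch hloop halpha0 halpha1 Gfin).
have mbarE : mbar * W = \sum_(i < r) w i ^+ 2 * m i by rewrite divfK// gt_eqF.
have mass := sphere_mass (o := o) li0 lio liS w_gt0 B_gt0 b_sum wE wS.
have [C6 [C60 hC6]] := sphere_defect (o := o) li0 lio ho liS lih w_gt0 B_gt0 b_sum wE wS erefl mbarE.
have csumE : asum_fin (fun g : letter o => fp_len p alpha (fp_letter g) * pi_letter p alpha g) /\
    csum (fun g : letter o => fp_len p alpha (fp_letter g) * pi_letter p alpha g) = mbar.
  have [||| asf ->] := @csum_letter R r V o
      (fun g => fp_len p alpha (fp_letter g) * pi_letter p alpha g)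
      (fun i v => w i ^+ 2 / W * (li i v * h i v)).
  - by move=> i; rewrite ho !mulr0.
  - move=> i; apply: asum_finZ.
    exact: (len_asum hr hstoch hacc hloop hunif halpha0 halpha1 Gfin).
  - move=> g; rewrite (pi_letterE hr hstoch hloop halpha0 halpha1 Gfin).
    rewrite (fp_lenE hr hstoch hacc hloop hunif halpha0 halpha1 Gfin).
    by rewrite /word_len /= big_seq1 mulrCA [X in _ = _ * X]mulrC.
  split => //; rewrite /mbar mulr_suml; apply: eq_bigr => i _.
  rewrite csumZ; last exact: (len_asum hr hstoch hacc hloop hunif halpha0 halpha1 Gfin).
  by rewrite mulrAC.
(* With finitely many types the exit weights are bounded below; [kappa] removes them when sums
   weighted by [L(x) w] are compared with sums weighted by [L(x)] alone. *)
pose kappa := \sum_(oi : option 'I_r) (exit_at w B oi)^-1.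
have e_gt0 oi : 0 < exit_at w B oi by case: oi.
have kappa_ge oi : 1 <= kappa * exit_at w B oi.
  rewrite -ler_pdivrMr// div1r /kappa (bigD1 oi)//= lerDl sumr_ge0// => oj _.
  by rewrite invr_ge0 ltW.
have kappa0 : 0 <= kappa by apply: sumr_ge0 => oi _; rewrite invr_ge0 ltW.
pose M (x : freeprod o) := word_lv p alpha (sval x).
have M_gt0 x : 0 < M x.
  exact: (word_lv_gt0 hr hstoch hacc hloop hunif halpha0 halpha1 Gfin).
have sphere_bound k (phi : freeprod o -> R) : (forall x, 0 <= phi x) ->
    (\esum_(x in [set x : freeprod o | block_length x = k]) (M x * phi x)%:E <=
     kappa%:E * sphere_sum li w B k phi)%E.
  move=> phi0; rewrite /sphere_sum -esumZl ?lee_fin//; last first.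
    by move=> x; rewrite lee_fin !mulr_ge0// ltW// M_gt0.
  apply: le_esum => x _; rewrite -EFinM lee_fin mulrA; apply: ler_wpM2r => //.
  rewrite mulrCA -[leLHS]mulr1; apply: ler_wpM2l; first exact: ltW.
  exact: kappa_ge.
pose g := @green_oo R r V o p alpha.
have g1 : 1 <= g by exact: (green_oo_ge1 hstoch halpha0 Gfin).
pose pn n x := law Pr X n x.
have lawE n x : Pr (X n @^-1` [set x]) = (pn n x)%:E.
  rewrite /pn /law fineK//; exact: fin_num_measure (let: And3 mX _ _ := hX in mX n x).
have mX n x : measurable (X n @^-1` [set x]) by have [] := hX.
have P0 : forall x y, 0 <= @fp_mx R r V o p alpha x y by exact: fp_mx_ge0.
have nstepE n x : nstep (@fp_mx R r V o p alpha) n (fp_root o) x = (pn n x)%:E.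
  by rewrite -lawE (markov_law P0 hX).
have pn0 n x : 0 <= pn n x by rewrite -lee_fin -lawE measure_ge0.
have [C [C0 hC]] := word_len_le hr hstoch hacc hloop hunif halpha0 halpha1 Gfin.
have lenE (x : freeprod o) : fp_len p alpha x = word_len p alpha (sval x).
  exact (fp_lenE hr hstoch hacc hloop hunif halpha0 halpha1 Gfin x).
have supp n x : pn n x != 0 -> (word_dist hacc (sval x) <= n)%N.
  move=> px; apply: (word_dist_nstep hstoch hacc halpha0).
  by rewrite nstepE lte_fin lt_neqAle eq_sym px pn0.
have supp_bl n x : pn n x != 0 -> (block_length x <= n)%N.
  by move=> /supp; apply: leq_trans; exact: size_le_word_dist.
have supp_len n x : pn n x != 0 -> `|fp_len p alpha x| <= C * n%:R.
  move=> /supp dn; rewrite lenE; apply: le_trans (hC _) _.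
  by apply: ler_wpM2l => //; rewrite ler_nat.
have green_sum x : (\sum_(0 <= n <oo) (pn n x)%:E = (g * M x)%:E)%E.
  rewrite EFinM -(fp_lvE hstoch hloop halpha0 halpha1 Gfin).
  rewrite -(fp_greenE hstoch halpha0 Gfin); apply: eq_eseriesr => n _.
  by rewrite expr1n mule1 nstepE.
have len_lnM (x : freeprod o) : fp_len p alpha x = - ln (M x).
  by rewrite lenE (word_lenE hr hstoch hacc hloop hunif halpha0 halpha1 Gfin).
have C30 : 0 <= kappa * B by rewrite mulr_ge0// ltW.
have sphere_le k : (\esum_(x in [set x : freeprod o | block_length x = k]) (M x)%:E <=
    (kappa * B)%:E)%E.
  rewrite EFinM -(mass k); apply: le_trans (sphere_bound k (fun=> 1) _) => //.
  by apply: le_esum => x _; rewrite mulr1.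
pose c (x : freeprod o) := corr w m B mbar (wtype (sval x)).
pose C4 := \sum_(oi : option 'I_r) `|corr w m B mbar oi|.
have C40 : 0 <= C4 by apply: sumr_ge0.
have c_le x : `|c x| <= C4.
  by rewrite /C4 (bigD1 (wtype (sval x)))//= lerDl sumr_ge0.
have sphere_sqr_le k : (\esum_(x in [set x : freeprod o | block_length x = k])
    (M x * (fp_len p alpha x + c x - (block_length x)%:R * mbar) ^+ 2)%:E <=
    (kappa * C6 * k.+1%:R)%:E)%E.
  rewrite -mulrA EFinM.
  apply: (@le_trans _ _ (kappa%:E * sphere_sum li w B k
      (fun x => defect h w m B mbar k x ^+ 2)%R)%E); last first.
    by apply: lee_wpmul2l; [rewrite lee_fin|exact: hC6].
  apply: le_trans (sphere_bound k _ _); last by move=> x; exact: sqr_ge0.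
  by apply: le_esum => x /= xk; rewrite lee_fin xk lenE.
have ellE : ell = ell0 * mbar.
  apply: (rate_identification mX lawE pn0 M_gt0 g1 C0 C40 _ supp_bl supp_len green_sum
    c_le sphere_sqr_le hell0 hell).
  by rewrite mulr_ge0.
exists ell; split => //.
- have := entropy_cvg mX lawE pn0 M_gt0 len_lnM g1 C0 C30 supp_bl supp_len green_sum
    sphere_le hell.
  by rewrite unlock.
- by case: csumE.
- by case: csumE => _ ->.
Qed.
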